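(* The categories $\mathsf{DH}$, $\mathsf{GvG}$, $\mathsf{Hg}$, and $\mathsf{Urq}$ (Dunn-Hartonas, Gehrke-van Gool, Hartung, and Urquhart spaces, with the morphisms defined in the context) are equivalent.
   Context: For $R\subseteq X\times Y$: $R[A]=\{y:\exists x\in A,\ xRy\}$, $R^{-1}[B]=\{x:\exists y\in B,\ xRy\}$, $R[x]=R[\{x\}]$, $R^{-1}[y]=R^{-1}[\{y\}]$, $\Box_RB=\{x\in X:R[x]\subseteq B\}$; $-$ is set complement. **Coherent lattices.** An element $k$ of a complete lattice $L$ is compact if $k\le\bigvee S$ implies $k\le\bigvee T$ for some finite $T\subseteq S$; $K(L)$ is the set of compact elements. $L$ is algebraic if every element is a join of compact elements; coherent if moreover $K(L)$ is closed under finite meets (including $1\in K(L)$). The Lawson topology is the join of the Scott topology (opens are the upsets $U$ such that $\bigvee S\in U$ with $S$ directed implies $S\cap U\ne\varnothing$) and the lower topology (subbasis $\{L\setminus{\uparrow}x:x\in L\}$). $\mathsf{CohLat}_\lambda$: coherent lattices with the Lawson topology; morphisms are Lawson-continuous maps preserving finite meets (including $1$) (such maps preserve arbitrary meets and so have a left adjoint) whose left adjoint preserves finite meets. **Category $\mathsf{DH}$.** A DH-space is a triple $(X,R,Y)$ with $X,Y\in\mathsf{CohLat}_\lambda$ and $R\subseteq X\times Y$ such that: (1) $R[x]$ and $R^{-1}[y]$ are closed for all $x,y$, $R[U]$ is clopen for clopen $U\subseteq X$, and $R^{-1}[V]$ is clopen for clopen $V\subseteq Y$; (2) $-R[x]$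 and $-R^{-1}[y]$ are filters for all $x,y$; (3) $R[x]\subseteq R[x']$ implies $x'\le x$; (4) $R^{-1}[y]\subseteq R^{-1}[y']$ implies $y'\le y$. A DH-morphism $(X_1,R_1,Y_1)\to(X_2,R_2,Y_2)$ is a pair $(f,g)$ of $\mathsf{CohLat}_\lambda$-morphisms $f\colon X_1\to X_2$, $g\colon Y_1\to Y_2$ such that (a) $xR_1y$ implies $f(x)R_2g(y)$; (b) if $x'R_2g(y)$ then there is $x$ with $xR_1y$ and $x'\le f(x)$; (c) if $f(x)R_2y'$ then there is $y$ with $xR_1y$ and $y'\le g(y)$. Composition is componentwise. **Category $\mathsf{GvG}$.** A Priestley space is a compact space with a partial order such that $x\not\le y$ implies there is a clopen upset containing $x$ and missing $y$. For Priestley spaces $X,Y$ and $R\subseteq X\times Y$, let $X_0=\bigcup\{\max R^{-1}[y]:y\in Y\}$ and $Y_0=\bigcup\{\max R[x]:x\in X\}$. A GvG-space is a triple $\mathcal G=(X,R,Y)$ with $X,Y$ Priestley spaces and $R\subseteq X\times Y$ such that: (1) $x\le x'$ iff $R[x']\subseteq R[x]$; (2) $y\le y'$ iff $R^{-1}[y']\subseteq R^{-1}[y]$; (3) if $U$ is a clopen upset of $X$, then $R[U]$ is a clopen downset of $Y$; (4) if $V$ is a clopen downset of $Y$, then $\Box_RV$ is a clopen upset of $X$; (5) if not $xRy$, then there is a clopen upset $U$ of $X$ with $U=\Box_RR[U]$, $x\in U$, $y\notin R[U]$; (6) if $U$ is a clopen upset of $X$ with $X_0\cap\Box_RR[U]\subseteq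 U$, then $U=\Box_RR[U]$; (7) if $V$ is a clopen downset of $Y$ with $Y_0\cap V\subseteq R[\Box_RV]$, then $V=R[\Box_RV]$. Let $L\mathcal G$ be the set of clopen upsets $U$ of $X$ with $U=\Box_RR[U]$. A GvG-morphism $\mathcal G=(X,R,Y)\to\mathcal G'=(X',R',Y')$ is a pair $(S,T)$, $S\subseteq X\times X'$, $T\subseteq Y\times Y'$, such that: (1) if $U'\in L\mathcal G'$, then $\Box_SU'\in L\mathcal G$ and $R[\Box_SU']=T^{-1}[R'[U']]$; (2) if not $xSx'$, there is $U'\in L\mathcal G'$ with $x\in\Box_SU'$ and $x'\notin U'$; (3) if not $yTy'$, there is $U'\in L\mathcal G'$ with $y\notin T^{-1}[R'[U']]$ and $y'\in R'[U']$; (4) if $xRy$, there are $x'\in X',y'\in Y'$ with $xSx'$, $yTy'$, $x'R'y'$. Composition of $(S_1,T_1)\colon\mathcal G_1\to\mathcal G_2$ and $(S_2,T_2)\colon\mathcal G_2\to\mathcal G_3$ is $(S_2\star S_1,T_2\star T_1)$, where $x(S_2\star S_1)z$ iff for all $U\in L\mathcal G_3$, $x\in\Box_{S_1}\Box_{S_2}U$ implies $z\in U$; and $y(T_2\star T_1)w$ iff for all $U\in L\mathcal G_3$, $w\in R_3[U]$ implies $y\in T_1^{-1}[T_2^{-1}[R_3[U]]]$. The identity of $(X,R,Y)$ is $(\le_X,\le_Y)$. **Category $\mathsf{Hg}$.** For topological spaces $X,Y$ and $R\subseteq X\times Y$, put $\mathcal H=(X,R,Y)$ and $L\mathcal H=\{A\subseteq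 X:A=\Box_RR[A],\ A\text{ and }-R[A]\text{ are closed}\}$. Let $x\le_Xx'$ iff $R[x']\subseteq R[x]$, and $y\le_Yy'$ iff $R^{-1}[y']\subseteq R^{-1}[y]$. If $xRy$, then $x$ is $y$-maximal if $x\le_Xx'$ and $x'Ry$ imply $x'=x$; $y$ is $x$-maximal if $y\le_Yy'$ and $xRy'$ imply $y'=y$. $\mathcal H$ is a Hartung space if: (1) $\le_X,\le_Y$ are partial orders; (2) $R$ is a compact subset of $X\times Y$; (3) $L\mathcal H$ is a subbasis of closed sets for $X$ and $\{-R[A]:A\in L\mathcal H\}$ is a subbasis of closed sets for $Y$; (4) $A\subseteq X$ closed implies $\Box_RR[A]$ closed, and $B\subseteq Y$ closed implies $-R[-R^{-1}[B]]$ closed; (5) each $x\in X$ is $y$-maximal for some $y\in Y$, and each $y\in Y$ is $x$-maximal for some $x\in X$; (6) if not $xRy$, there is $A\in L\mathcal H$ with $x\in A$ and $y\notin R[A]$. Hartung morphisms $(S,T)\colon\mathcal H\to\mathcal H'$, their composition $\star$, and identities $(\le_X,\le_Y)$ are defined by exactly the same conditions as for GvG-morphisms, with $L\mathcal H,L\mathcal H',L\mathcal H_3$ in place of $L\mathcal G,L\mathcal G',L\mathcal G_3$. **Category $\mathsf{Urq}$.** Let $\mathcal U=(Z,\le_1,\le_2)$ be a topological space with two quasi-orders. For a $\le_1$-upset $A$ let $\phi A=-{\downarrow_2}A$, and for a $\le_2$-upset $B$ let $\psi B=-{\downarrow_1}B$, where $\downarrow_i$ is the $\le_i$-downset generated.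 Let $L\mathcal U$ be the set of $\le_1$-upsets $C$ with $C=\psi\phi C$ and $C,\phi C$ closed. $\mathcal U$ is an Urquhart space if: (1) $Z$ is compact, and $x\le_1y$ and $x\le_2y$ imply $x=y$; (2) $L\mathcal U\cup\{\phi C:C\in L\mathcal U\}$ is a subbasis of closed sets; (3) if $C_1,C_2\in L\mathcal U$, then $\phi(C_1\cap C_2)$ and $\psi(\phi C_1\cap\phi C_2)$ are closed; (4) if $x\not\le_1y$, there is $C\in L\mathcal U$ with $x\in C$, $y\notin C$; (5) if $x\not\le_2y$, there is $C\in L\mathcal U$ with $x\in\phi C$, $y\notin\phi C$. An Urquhart morphism $\mathcal U\to\mathcal U'$ is a pair $(P,Q)$ of relations $P,Q\subseteq Z\times Z'$ such that: (1) if $C'\in L\mathcal U'$, then $\Box_PC'\in L\mathcal U$ and $\phi\Box_PC'=\Box_Q\phi'C'$; (2) if not $zPz'$, there is $C'\in L\mathcal U'$ with $z\in\Box_PC'$, $z'\notin C'$; (3) if not $zQz'$, there is $C'\in L\mathcal U'$ with $z\in\Box_Q\phi'C'$, $z'\notin\phi'C'$; (4) $P[z]\cap Q[z]\ne\varnothing$ for all $z\in Z$. Composition is $(P_2\star P_1,Q_2\star Q_1)$, where $x(P_2\star P_1)z$ iff for all $C\in L\mathcal U_3$, $x\in\Box_{P_1}\Box_{P_2}C$ implies $z\in C$; and $y(Q_2\star Q_1)w$ iff for all $C\in L\mathcal U_3$, $y\in\Box_{Q_1}\Box_{Q_2}\phi_3C$ implies $w\in\phi_3C$. The identity of $\mathcal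 U$ is $(\le_1,\le_2)$. *)

(* Defs.v *)
From HB Require Import structures.
From mathcomp Require Import all_boot all_order all_classical.
From mathcomp Require Import topology_structure compact product_topology.
From mathcomp Require Import order_topology.
From Corelib Require Relation_Definitions.

Set Implicit Arguments.
Unset Strict Implicit.
Unset Printing Implicit Defensive.

Import Order.TTheory.
Local Open Scope classical_set_scope.

Record category := Category {
  ob :> Type;
  hom : ob -> ob -> Type;
  idm : forall a, hom a a;
  comp : forall a b c, hom b c -> hom a b -> hom a c;
  comp_idl : forall a b (f : hom a b), comp (idm b) f = f;
  comp_idr : forall a b (f : hom a b), comp f (idm a) = f;
  compA : forall a b c d (h : hom c d) (g : hom b c) (f : hom a b),
    comp h (comp g f) = comp (comp h g) f
}.
Arguments idm {_} a.
Arguments comp {_ _ _ _} g f : rename.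

Record functor (C D : category) := Functor {
  fob :> C -> D;
  fmap : forall a b, hom a b -> hom (fob a) (fob b);
  fmap_id : forall a, fmap (idm a) = idm (fob a);
  fmap_comp : forall a b c (g : hom b c) (f : hom a b),
    fmap (comp g f) = comp (fmap g) (fmap f)
}.

Definition id_functor (C : category) : functor C C :=
  @Functor C C id (fun _ _ f => f) (fun _ => erefl) (fun _ _ _ _ _ => erefl).

Section CompFunctor.
Variables (C D E : category) (G : functor D E) (F : functor C D).

Lemma comp_functor_id a : fmap G (fmap F (idm a)) = idm (G (F a)).
Proof. by rewrite !fmap_id. Qed.

Lemma comp_functor_comp a b c (g : hom b c) (f : hom a b) :
  fmap G (fmap F (comp g f)) = comp (fmap G (fmap F g)) (fmap G (fmap F f)).
Proof. by rewrite !fmap_comp. Qed.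

Definition comp_functor : functor C E :=
  @Functor C E (fun a => G (F a)) (fun _ _ f => fmap G (fmap F f))
    comp_functor_id comp_functor_comp.
End CompFunctor.

Definition is_iso (C : category) (a b : C) (f : hom a b) : Prop :=
  exists g : hom b a, comp g f = idm a /\ comp f g = idm b.

Definition naturally_isomorphic (C D : category) (F G : functor C D) : Prop :=
  exists eta : forall a, hom (F a) (G a),
    (forall a, is_iso (eta a)) /\
    (forall a b (f : hom a b),
        comp (eta b) (fmap F f) = comp (fmap G f) (eta a)).

Definition equivalent_categories (C D : category) : Prop :=
  exists (F : functor C D) (G : functor D C),
    naturally_isomorphic (id_functor C) (comp_functor G F) /\
    naturally_isomorphic (comp_functor F G) (id_functor D).

Section Relations.
Variables (X Y : Type) (R : set (X * Y)).

Definition image_rel (A : set X) : set Y := [set y | exists2 x, A x & R (x, y)].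
Definition preimage_rel (B : set Y) : set X :=
  [set x | exists2 y, B y & R (x, y)].
Definition fiber (x : X) : set Y := [set y | R (x, y)].
Definition cofiber (y : Y) : set X := [set x | R (x, y)].
Definition box (B : set Y) : set X := [set x | fiber x `<=` B].

Lemma fiberE x : fiber x = image_rel [set x].
Proof. by apply/seteqP; split=> [y Rxy|y [_ -> //]]; exists x. Qed.

Lemma cofiberE y : cofiber y = preimage_rel [set y].
Proof. by apply/seteqP; split=> [x Rxy|x [_ -> //]]; exists y. Qed.
End Relations.

Section Order.
Variables (T : Type) (le : T -> T -> Prop).

Definition upset (A : set T) : Prop := forall x y, le x y -> A x -> A y.
Definition downset (A : set T) : Prop := forall x y, le x y -> A y -> A x.
Definition downclosure (A : set T) : set T := [set x | exists2 y, A y & le x y].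
Definition maximals (A : set T) : set T :=
  [set x | A x /\ forall y, A y -> le x y -> y = x].
Definition graph : set (T * T) := [set p | le p.1 p.2].
End Order.

Definition po {d} (T : porderType d) (x y : T) : Prop := (x <= y)%O.

(* The closed sets are exactly the intersections of finite unions of members   *)
(* of [B]; the empty union and the empty intersection are allowed.             *)
Definition closed_subbasis (T : topologicalType) (B : set (set T)) : Prop :=
  forall A : set T, closed A <->
    exists F : set (set T),
      (forall C, F C -> exists s : set (set T),
          [/\ finite_set s, s `<=` B & C = \bigcup_(D in s) D]) /\
      A = \bigcap_(C in F) C.

Section CoherentLattices.
Variables (d : Order.disp_t) (L : tbLatticeType d).

Definition complete_lattice : Prop :=
  forall S : set L, exists s, supremums S s.

Definition compact_element (k : L) : Prop :=
  forall (S : set L) (s : L), supremums S s -> (k <= s)%O ->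
    exists (T : set L) (t : L),
      [/\ finite_set T, T `<=` S, supremums T t & (k <= t)%O].

Definition algebraic_lattice : Prop :=
  forall x : L, exists2 S : set L, S `<=` compact_element & supremums S x.

Record coherent_lattice : Prop := CoherentLattice {
  coherent_complete : complete_lattice;
  coherent_algebraic : algebraic_lattice;
  compact_element_top : compact_element \top%O;
  compact_element_meet : forall k l : L,
    compact_element k -> compact_element l -> compact_element (k `&` l)%O
}.

Definition directed (S : set L) : Prop :=
  S !=set0 /\
  forall x y, S x -> S y -> exists z, [/\ S z, (x <= z)%O & (y <= z)%O].

Definition scott_open (U : set L) : Prop :=
  upset (@po d L) U /\
  forall (S : set L) (s : L), directed S -> supremums S s -> U s ->
    (S `&` U) !=set0.

Definition lawson_subbasis : set (set L) :=
  scott_open `|` [set ~` [set y | (x <= y)%O] | x in [set: L]].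

Definition lattice_filter (F : set L) : Prop :=
  [/\ F \top%O, (forall x y, F x -> F y -> F (x `&` y)%O) & upset (@po d L) F].
End CoherentLattices.

(* A type alias, so that [L] itself carries no canonical topology.             *)
Definition lawson d (L : tbLatticeType d) : Type := L.
HB.instance Definition _ d (L : tbLatticeType d) := Choice.on (lawson L).
HB.instance Definition _ d (L : tbLatticeType d) :=
  isSubBaseTopological.Build (lawson L) (@lawson_subbasis d L) id.

Definition preserves_finite_meets d1 d2 (L1 : tbLatticeType d1)
    (L2 : tbLatticeType d2) (f : L1 -> L2) : Prop :=
  f \top%O = \top%O /\ {morph f : x y / (x `&` y)%O}.

Record is_CohLat_morphism d1 d2 (L1 : tbLatticeType d1) (L2 : tbLatticeType d2)
    (f : L1 -> L2) : Prop := IsCohLatMorphism {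
  cohlat_continuous : continuous (f : lawson L1 -> lawson L2);
  cohlat_meets : preserves_finite_meets f;
  cohlat_adjoint : exists2 l : L2 -> L1,
    (forall a b, (l a <= b)%O <-> (a <= f b)%O) & preserves_finite_meets l
}.

(* Displays only affect printing, so fixing one is no restriction.             *)
Fact dual_space_display : Order.disp_t. Proof. exact: Order.Disp tt tt. Qed.

Record is_DH_space d1 d2 (X : tbLatticeType d1) (Y : tbLatticeType d2)
    (R : set (X * Y)) : Prop := IsDHSpace {
  dh_coherentX : coherent_lattice X;
  dh_coherentY : coherent_lattice Y;
  dh_closed_fiber : forall x, closed (fiber R x : set (lawson Y));
  dh_closed_cofiber : forall y, closed (cofiber R y : set (lawson X));
  dh_clopen_image : forall U : set (lawson X),
    clopen U -> clopen (image_rel R U : set (lawson Y));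
  dh_clopen_preimage : forall V : set (lawson Y),
    clopen V -> clopen (preimage_rel R V : set (lawson X));
  dh_filter_fiber : forall x, lattice_filter (~` fiber R x);
  dh_filter_cofiber : forall y, lattice_filter (~` cofiber R y);
  dh_orderX : forall x x', fiber R x `<=` fiber R x' -> (x' <= x)%O;
  dh_orderY : forall y y', cofiber R y `<=` cofiber R y' -> (y' <= y)%O
}.

Record DH_space := DHSpace {
  dhX : tbLatticeType dual_space_display;
  dhY : tbLatticeType dual_space_display;
  dhR : set (dhX * dhY);
  dhP : is_DH_space dhR
}.

Record is_DH_morphism (A B : DH_space) (f : dhX A -> dhX B)
    (g : dhY A -> dhY B) : Prop := IsDHMorphism {
  dhm_f : is_CohLat_morphism f;
  dhm_g : is_CohLat_morphism g;
  dhm_rel : forall x y, dhR (x, y) -> dhR (f x, g y);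
  dhm_back_f : forall x' y, dhR (x', g y) ->
    exists x, dhR (x, y) /\ (x' <= f x)%O;
  dhm_back_g : forall x y', dhR (f x, y') ->
    exists y, dhR (x, y) /\ (y' <= g y)%O
}.

Definition DH_hom (A B : DH_space) :=
  {fg : (dhX A -> dhX B) * (dhY A -> dhY B) | is_DH_morphism fg.1 fg.2}.

Lemma preserves_finite_meets_id d (L : tbLatticeType d) :
  preserves_finite_meets (@id L).
Proof. by split. Qed.

Lemma preserves_finite_meets_comp d1 d2 d3 (L1 : tbLatticeType d1)
    (L2 : tbLatticeType d2) (L3 : tbLatticeType d3) (g : L2 -> L3)
    (f : L1 -> L2) :
  preserves_finite_meets g -> preserves_finite_meets f ->
  preserves_finite_meets (g \o f).
Proof.
move=> [gT gI] [fT fI]; split; first by rewrite /= fT gT.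
by move=> x y; rewrite /= fI gI.
Qed.

Lemma is_CohLat_morphism_id d (L : tbLatticeType d) :
  is_CohLat_morphism (@id L).
Proof.
split; [by move=> x; apply: cvg_id | exact: preserves_finite_meets_id |].
by exists id => //; exact: preserves_finite_meets_id.
Qed.

Lemma is_CohLat_morphism_comp d1 d2 d3 (L1 : tbLatticeType d1)
    (L2 : tbLatticeType d2) (L3 : tbLatticeType d3) (g : L2 -> L3)
    (f : L1 -> L2) :
  is_CohLat_morphism g -> is_CohLat_morphism f -> is_CohLat_morphism (g \o f).
Proof.
move=> [gc gm [m mg mm]] [fc fm [l lf lm]]; split.
- move=> x; apply: (@continuous_comp (lawson L1) (lawson L2) (lawson L3) f g).
    exact: fc.
  exact: gc.
- exact: preserves_finite_meets_comp.
- exists (l \o m); last exact: preserves_finite_meets_comp.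
  by move=> a b; rewrite /= lf mg.
Qed.

Lemma preserves_finite_meets_homo d1 d2 (L1 : tbLatticeType d1)
    (L2 : tbLatticeType d2) (f : L1 -> L2) :
  preserves_finite_meets f -> {homo f : x y / (x <= y)%O}.
Proof. by move=> [_ fI] x y; rewrite !leEmeet -fI => /eqP ->. Qed.

Lemma is_DH_morphism_id (A : DH_space) :
  is_DH_morphism (@id (dhX A)) (@id (dhY A)).
Proof.
split=> //; do ?exact: is_CohLat_morphism_id.
- by move=> x' y Rxy; exists x'.
- by move=> x y' Rxy; exists y'.
Qed.

Lemma is_DH_morphism_comp (A B C : DH_space) (fg' : DH_hom B C)
    (fg : DH_hom A B) :
  is_DH_morphism ((sval fg').1 \o (sval fg).1) ((sval fg').2 \o (sval fg).2).
Proof.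
case: fg' fg => -[f' g'] [/= f'm g'm R' bf' bg'].
move=> [[f g] [/= fm gm R bf bg]]; split.
- exact: is_CohLat_morphism_comp.
- exact: is_CohLat_morphism_comp.
- by move=> x y /R /R'.
- move=> x'' y /bf' [x' [/bf[x [Rxy x'x] x''x']]]; exists x; split=> //.
  apply: le_trans x''x' _.
  exact: (preserves_finite_meets_homo (cohlat_meets f'm)).
- move=> x y'' /bg' [y' [/bg[y [Rxy y'y] y''y']]]; exists y; split=> //.
  apply: le_trans y''y' _.
  exact: (preserves_finite_meets_homo (cohlat_meets g'm)).
Qed.

Definition DH_id (A : DH_space) : DH_hom A A :=
  exist _ (@id (dhX A), @id (dhY A)) (is_DH_morphism_id A).

Definition DH_comp (A B C : DH_space) (fg' : DH_hom B C) (fg : DH_hom A B) :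
    DH_hom A C :=
  exist _ ((sval fg').1 \o (sval fg).1, (sval fg').2 \o (sval fg).2)
    (is_DH_morphism_comp fg' fg).

Lemma DH_comp_idl A B (f : DH_hom A B) : DH_comp (DH_id B) f = f.
Proof. by case: f => -[f g] fgm; exact: eq_exist. Qed.

Lemma DH_comp_idr A B (f : DH_hom A B) : DH_comp f (DH_id A) = f.
Proof. by case: f => -[f g] fgm; exact: eq_exist. Qed.

Lemma DH_compA A B C D (h : DH_hom C D) (g : DH_hom B C) (f : DH_hom A B) :
  DH_comp h (DH_comp g f) = DH_comp (DH_comp h g) f.
Proof. exact: eq_exist. Qed.

Definition DH : category := Category DH_comp_idl DH_comp_idr DH_compA.

(* Common part of GvG-spaces and Hartung spaces: both kinds of morphisms, their *)
(* identities and their composition depend only on these data, and being a      *)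
(* category only on the properties [plL_upX] to [plY_sep].                      *)
Record polarity := Polarity {
  plX : Type;
  plY : Type;
  plR : set (plX * plY);
  plL : set (set plX);
  plleX : plX -> plX -> Prop;
  plleY : plY -> plY -> Prop;
  plleX_refl : forall x, plleX x x;
  plleY_refl : forall y, plleY y y;
  plL_upX : forall U, plL U -> upset plleX U;
  plL_downY : forall U, plL U -> downset plleY (image_rel plR U);
  plX_sep : forall x x', ~ plleX x x' -> exists U, [/\ plL U, U x & ~ U x'];
  plY_sep : forall y y', ~ plleY y y' ->
    exists U, [/\ plL U, ~ image_rel plR U y & image_rel plR U y']
}.

Record is_rel_morphism X Y X' Y' (R : set (X * Y)) (L : set (set X))
    (R' : set (X' * Y')) (L' : set (set X'))
    (S : set (X * X')) (T : set (Y * Y')) : Prop := IsRelMorphism {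
  relm_box : forall U', L' U' ->
    L (box S U') /\
    image_rel R (box S U') = preimage_rel T (image_rel R' U');
  relm_sepX : forall x x', ~ S (x, x') ->
    exists U', [/\ L' U', box S U' x & ~ U' x'];
  relm_sepY : forall y y', ~ T (y, y') ->
    exists U', [/\ L' U', ~ preimage_rel T (image_rel R' U') y
                 & image_rel R' U' y'];
  relm_total : forall x y, R (x, y) ->
    exists x' y', [/\ S (x, x'), T (y, y') & R' (x', y')]
}.

(* The composition of the first components uses [M := L]; that of the second   *)
(* components of Urquhart morphisms uses [M := {phi C : C in L}].              *)
Definition star_box X1 X2 X3 (M : set (set X3)) (S2 : set (X2 * X3))
    (S1 : set (X1 * X2)) : set (X1 * X3) :=
  [set p | forall U, M U -> box S1 (box S2 U) p.1 -> U p.2].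

Definition starY Y1 Y2 X3 Y3 (R3 : set (X3 * Y3)) (L3 : set (set X3))
    (T2 : set (Y2 * Y3)) (T1 : set (Y1 * Y2)) : set (Y1 * Y3) :=
  [set p | forall U, L3 U -> image_rel R3 U p.2 ->
     preimage_rel T1 (preimage_rel T2 (image_rel R3 U)) p.1].

Definition pl_hom (A B : polarity) :=
  {ST : set (plX A * plX B) * set (plY A * plY B) |
    is_rel_morphism (@plR A) (@plL A) (@plR B) (@plL B) ST.1 ST.2}.

Lemma box_star X1 X2 X3 (L3 : set (set X3)) (S2 : set (X2 * X3))
    (S1 : set (X1 * X2)) U :
  L3 U -> box (star_box L3 S2 S1) U = box S1 (box S2 U).
Proof.
move=> LU; apply/seteqP; split=> [x xU y Sxy z Syz|x xU z xz].
  by apply: xU => V _ /(_ _ Sxy) /(_ _ Syz).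
exact: xz LU xU.
Qed.

Lemma preimage_starY Y1 Y2 X3 Y3 (R3 : set (X3 * Y3)) (L3 : set (set X3))
    (T2 : set (Y2 * Y3)) (T1 : set (Y1 * Y2)) U :
  L3 U ->
  preimage_rel (starY R3 L3 T2 T1) (image_rel R3 U) =
  preimage_rel T1 (preimage_rel T2 (image_rel R3 U)).
Proof.
move=> LU; apply/seteqP; split=> [y [w Uw yw]|y [z [w Uw Tzw] Tyz]].
  exact: yw LU Uw.
by exists w => // V LV Vw; exists z => //; exists w.
Qed.

Lemma box_graph (A : polarity) U : plL U -> box (graph (@plleX A)) U = U.
Proof.
move=> LU; apply/seteqP; split=> [x|x Ux y xy]; last exact: plL_upX xy Ux.
by apply; exact: plleX_refl.
Qed.

Lemma preimage_graph (A : polarity) (U : set (plX A)) :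
  plL U ->
  preimage_rel (graph (@plleY A)) (image_rel (@plR A) U) = image_rel (@plR A) U.
Proof.
move=> LU; apply/seteqP; split=> [x [y Uy xy]|y Uy].
  exact: plL_downY xy Uy.
by exists y => //; exact: plleY_refl.
Qed.

Lemma is_rel_morphism_id (A : polarity) :
  is_rel_morphism (@plR A) (@plL A) (@plR A) (@plL A)
    (graph (@plleX A)) (graph (@plleY A)).
Proof.
split.
- by move=> U LU; rewrite box_graph // preimage_graph.
- by move=> x x' /plX_sep[U [LU Ux Ux']]; exists U; rewrite box_graph.
- by move=> y y' /plY_sep[U [LU Uy Uy']]; exists U; rewrite preimage_graph.
- move=> x y Rxy; exists x, y.
  by split=> //; [exact: plleX_refl|exact: plleY_refl].
Qed.

Lemma is_rel_morphism_comp (A B C : polarity) (g : pl_hom B C)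
    (f : pl_hom A B) :
  is_rel_morphism (@plR A) (@plL A) (@plR C) (@plL C)
    (star_box (@plL C) (sval g).1 (sval f).1)
    (starY (@plR C) (@plL C) (sval g).2 (sval f).2).
Proof.
case: g f => -[S2 T2] [/= b2 sX2 sY2 t2] [[S1 T1] [/= b1 sX1 sY1 t1]]; split.
- move=> U LU; rewrite box_star // preimage_starY //.
  have [L2U E2] := b2 _ LU; have [L1U E1] := b1 _ L2U.
  by split=> //; rewrite E1 E2.
- move=> x z /existsNP[U /not_implyP[LU /not_implyP[xU zU]]].
  by exists U; rewrite box_star.
- move=> y w /existsNP[U /not_implyP[LU /not_implyP[wU yU]]].
  by exists U; rewrite preimage_starY.
- move=> x y /t1[x' [y' [xx' yy' /t2[x'' [y'' [x'x'' y'y'' R'']]]]]].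
  exists x'', y''; split=> //.
    by move=> U _ /(_ _ xx') /(_ _ x'x'').
  by move=> U _ Uy''; exists y' => //; exists y''.
Qed.

Definition pl_id (A : polarity) : pl_hom A A :=
  exist _ (graph (@plleX A), graph (@plleY A)) (is_rel_morphism_id A).

Definition pl_comp (A B C : polarity) (g : pl_hom B C) (f : pl_hom A B) :
    pl_hom A C :=
  exist _ (star_box (@plL C) (sval g).1 (sval f).1,
           starY (@plR C) (@plL C) (sval g).2 (sval f).2)
    (is_rel_morphism_comp g f).

Lemma pl_homP (A B : polarity) (f g : pl_hom A B) :
  (forall U, plL U -> box (sval f).1 U = box (sval g).1 U) ->
  (forall U, plL U ->
    preimage_rel (sval f).2 (image_rel (@plR B) U) =
    preimage_rel (sval g).2 (image_rel (@plR B) U)) -> f = g.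
Proof.
case: f g => -[S T] [/= b sX sY t] [[S' T'] [/= b' sX' sY' t']] eS eT.
apply: eq_exist; congr (_, _); apply/seteqP; split=> -[x z] /= xz.
- apply: contrapT => /sX'[U [LU]]; rewrite -eS // => xU; apply; exact: xU.
- apply: contrapT => /sX[U [LU]]; rewrite eS // => xU; apply; exact: xU.
- by apply: contrapT => /sY'[U [LU + Uz]]; rewrite -eT //; apply; exists z.
- by apply: contrapT => /sY[U [LU + Uz]]; rewrite eT //; apply; exists z.
Qed.

Lemma pl_comp_idl (A B : polarity) (f : pl_hom A B) : pl_comp (pl_id B) f = f.
Proof.
apply: pl_homP => U LU /=.
  by rewrite box_star // box_graph.
by rewrite preimage_starY // preimage_graph.
Qed.

Lemma pl_comp_idr (A B : polarity) (f : pl_hom A B) : pl_comp f (pl_id A) = f.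
Proof.
apply: pl_homP => U LU /=; have [LfU fU] := relm_box (svalP f) LU.
  by rewrite box_star // box_graph.
by rewrite preimage_starY // -fU preimage_graph.
Qed.

Lemma pl_compA (A B C D : polarity) (h : pl_hom C D) (g : pl_hom B C)
    (f : pl_hom A B) : pl_comp h (pl_comp g f) = pl_comp (pl_comp h g) f.
Proof.
apply: pl_homP => U LU /=; have [LhU hU] := relm_box (svalP h) LU.
  by rewrite !box_star.
rewrite !preimage_starY // -?hU // preimage_starY //.
Qed.

Definition rel_category (T : Type) (pl : T -> polarity) : category :=
  @Category T (fun A B => pl_hom (pl A) (pl B)) (fun A => pl_id (pl A))
    (fun A B C g f => pl_comp g f)
    (fun A B f => pl_comp_idl f) (fun A B f => pl_comp_idr f)
    (fun A B C D h g f => pl_compA h g f).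

Notation topPOrderType := (POrderedTopological.type dual_space_display).

Definition clopen_upset (X : topPOrderType) (U : set X) : Prop :=
  clopen U /\ upset (@po _ X) U.
Definition clopen_downset (X : topPOrderType) (U : set X) : Prop :=
  clopen U /\ downset (@po _ X) U.

Definition priestley_space (X : topPOrderType) : Prop :=
  compact [set: X] /\
  forall x y : X, ~ (x <= y)%O -> exists U, [/\ clopen_upset U, U x & ~ U y].

Section GvGSpaces.
Variables (X Y : topPOrderType) (R : set (X * Y)).

Definition gvg_X0 : set X := \bigcup_y maximals (@po _ X) (cofiber R y).
Definition gvg_Y0 : set Y := \bigcup_x maximals (@po _ Y) (fiber R x).

Record is_GvG_space : Prop := IsGvGSpace {
  gvg_priestleyX : priestley_space X;
  gvg_priestleyY : priestley_space Y;
  gvg_orderX : forall x x' : X, (x <= x')%O <-> fiber R x' `<=` fiber R x;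
  gvg_orderY : forall y y' : Y, (y <= y')%O <-> cofiber R y' `<=` cofiber R y;
  gvg_image : forall U, clopen_upset U -> clopen_downset (image_rel R U);
  gvg_box : forall V, clopen_downset V -> clopen_upset (box R V);
  gvg_sep : forall x y, ~ R (x, y) ->
    exists U, [/\ clopen_upset U, U = box R (image_rel R U), U x
                & ~ image_rel R U y];
  gvg_stableX : forall U, clopen_upset U ->
    gvg_X0 `&` box R (image_rel R U) `<=` U -> U = box R (image_rel R U);
  gvg_stableY : forall V, clopen_downset V ->
    gvg_Y0 `&` V `<=` image_rel R (box R V) -> V = image_rel R (box R V)
}.

Definition gvg_L : set (set X) :=
  [set U | clopen_upset U /\ U = box R (image_rel R U)].
End GvGSpaces.

Record GvG_space := GvGSpace {
  gvgX : topPOrderType;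
  gvgY : topPOrderType;
  gvgR : set (gvgX * gvgY);
  gvgP : is_GvG_space gvgR
}.

Section GvGPolarity.
Variable G : GvG_space.

Lemma gvg_L_downY U : gvg_L (@gvgR G) U ->
  downset (@po _ (gvgY G)) (image_rel (@gvgR G) U).
Proof. by move=> [/(gvg_image (gvgP G))[]]. Qed.

Lemma gvg_X_sep (x x' : gvgX G) : ~ po x x' ->
  exists U, [/\ gvg_L (@gvgR G) U, U x & ~ U x'].
Proof.
rewrite /po (gvg_orderX (gvgP G)) => /existsNP[y /not_implyP[Rx'y]].
move=> /(gvg_sep (gvgP G))[U [cU LU Ux Uy]]; exists U; split=> // Ux'.
by apply: Uy; exists x'.
Qed.

Lemma gvg_Y_sep (y y' : gvgY G) : ~ po y y' ->
  exists U, [/\ gvg_L (@gvgR G) U, ~ image_rel (@gvgR G) U y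
              & image_rel (@gvgR G) U y'].
Proof.
rewrite /po (gvg_orderY (gvgP G)) => /existsNP[x /not_implyP[Rxy']].
move=> /(gvg_sep (gvgP G))[U [cU LU Ux Uy]]; exists U; split=> //.
by exists x.
Qed.

Definition gvg_polarity : polarity :=
  @Polarity (gvgX G) (gvgY G) (@gvgR G) (gvg_L (@gvgR G))
    (@po _ (gvgX G)) (@po _ (gvgY G)) (fun=> lexx _) (fun=> lexx _)
    (fun _ LU => LU.1.2) gvg_L_downY gvg_X_sep gvg_Y_sep.
End GvGPolarity.

Definition GvG : category := rel_category gvg_polarity.

Section HartungSpaces.
Variables (X Y : topologicalType) (R : set (X * Y)).

Definition hg_leX (x x' : X) : Prop := fiber R x' `<=` fiber R x.
Definition hg_leY (y y' : Y) : Prop := cofiber R y' `<=` cofiber R y.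

Definition hg_L : set (set X) :=
  [set A | [/\ A = box R (image_rel R A), closed A & closed (~` image_rel R A)]].

Definition hg_maximalX (x : X) (y : Y) : Prop :=
  R (x, y) /\ forall x', hg_leX x x' -> R (x', y) -> x' = x.
Definition hg_maximalY (y : Y) (x : X) : Prop :=
  R (x, y) /\ forall y', hg_leY y y' -> R (x, y') -> y' = y.

Record is_Hartung_space : Prop := IsHartungSpace {
  hg_orderX : Relation_Definitions.order X hg_leX;
  hg_orderY : Relation_Definitions.order Y hg_leY;
  hg_compact : compact R;
  hg_subbasisX : closed_subbasis hg_L;
  hg_subbasisY : closed_subbasis [set ~` image_rel R A | A in hg_L];
  hg_closedX : forall A : set X, closed A -> closed (box R (image_rel R A));
  hg_closedY : forall B : set Y, closed B ->
    closed (~` image_rel R (~` preimage_rel R B));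
  hg_maxX : forall x, exists y, hg_maximalX x y;
  hg_maxY : forall y, exists x, hg_maximalY y x;
  hg_sep : forall x y, ~ R (x, y) ->
    exists A, [/\ hg_L A, A x & ~ image_rel R A y]
}.
End HartungSpaces.

Record Hartung_space := HartungSpace {
  hgX : topologicalType;
  hgY : topologicalType;
  hgR : set (hgX * hgY);
  hgP : is_Hartung_space hgR
}.

Section HartungPolarity.
Variable H : Hartung_space.

Lemma hg_L_upX A : hg_L (@hgR H) A -> upset (hg_leX (@hgR H)) A.
Proof.
move=> [AE _ _] x x' xx' Ax; rewrite AE => y Rx'y.
by exists x => //; exact: xx'.
Qed.

Lemma hg_L_downY A : hg_L (@hgR H) A ->
  downset (hg_leY (@hgR H)) (image_rel (@hgR H) A).
Proof. by move=> _ y y' yy' [x Ax Rxy']; exists x => //; exact: yy'. Qed.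

Lemma hg_X_sep x x' : ~ hg_leX (@hgR H) x x' ->
  exists A, [/\ hg_L (@hgR H) A, A x & ~ A x'].
Proof.
move=> /existsNP[y /not_implyP[Rx'y]].
move=> /(hg_sep (hgP H))[A [LA Ax Ay]]; exists A; split=> // Ax'.
by apply: Ay; exists x'.
Qed.

Lemma hg_Y_sep y y' : ~ hg_leY (@hgR H) y y' ->
  exists A, [/\ hg_L (@hgR H) A, ~ image_rel (@hgR H) A y
              & image_rel (@hgR H) A y'].
Proof.
move=> /existsNP[x /not_implyP[Rxy']].
move=> /(hg_sep (hgP H))[A [LA Ax Ay]]; exists A; split=> //.
by exists x.
Qed.

Definition hg_polarity : polarity :=
  @Polarity (hgX H) (hgY H) (@hgR H) (hg_L (@hgR H))
    (hg_leX (@hgR H)) (hg_leY (@hgR H))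
    (fun x => @subset_refl _ (fiber _ x)) (fun y => @subset_refl _ (cofiber _ y))
    hg_L_upX hg_L_downY hg_X_sep hg_Y_sep.
End HartungPolarity.

Definition Hg : category := rel_category hg_polarity.

Section UrquhartSpaces.
Variables (Z : topologicalType) (le1 le2 : Z -> Z -> Prop).

Definition urq_phi (A : set Z) : set Z := ~` downclosure le2 A.
Definition urq_psi (B : set Z) : set Z := ~` downclosure le1 B.

Definition urq_L : set (set Z) :=
  [set C | [/\ upset le1 C, C = urq_psi (urq_phi C), closed C
             & closed (urq_phi C)]].

Record is_Urquhart_space : Prop := IsUrquhartSpace {
  urq_preorder1 : Relation_Definitions.preorder Z le1;
  urq_preorder2 : Relation_Definitions.preorder Z le2;
  urq_compact : compact [set: Z];
  urq_anti : forall x y, le1 x y -> le2 x y -> x = y;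
  urq_subbasis : closed_subbasis (urq_L `|` [set urq_phi C | C in urq_L]);
  urq_phi_closed : forall C1 C2, urq_L C1 -> urq_L C2 ->
    closed (urq_phi (C1 `&` C2));
  urq_psi_closed : forall C1 C2, urq_L C1 -> urq_L C2 ->
    closed (urq_psi (urq_phi C1 `&` urq_phi C2));
  urq_sep1 : forall x y, ~ le1 x y -> exists C, [/\ urq_L C, C x & ~ C y];
  urq_sep2 : forall x y, ~ le2 x y ->
    exists C, [/\ urq_L C, urq_phi C x & ~ urq_phi C y]
}.
End UrquhartSpaces.

Record Urquhart_space := UrquhartSpace {
  urqZ : topologicalType;
  urqle1 : urqZ -> urqZ -> Prop;
  urqle2 : urqZ -> urqZ -> Prop;
  urqP : is_Urquhart_space urqle1 urqle2
}.

Section UrquhartCategory.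
Implicit Types U V W : Urquhart_space.

Definition LU U : set (set (urqZ U)) := urq_L (@urqle1 U) (@urqle2 U).
Definition phi U (A : set (urqZ U)) : set (urqZ U) := urq_phi (@urqle2 U) A.

Record is_Urquhart_morphism U V (P Q : set (urqZ U * urqZ V)) : Prop :=
    IsUrquhartMorphism {
  urqm_box : forall C', LU C' -> LU (box P C') /\
    phi (box P C') = box Q (phi C');
  urqm_sepP : forall z z', ~ P (z, z') ->
    exists C', [/\ LU C', box P C' z & ~ C' z'];
  urqm_sepQ : forall z z', ~ Q (z, z') ->
    exists C', [/\ LU C', box Q (phi C') z & ~ phi C' z'];
  urqm_total : forall z, (fiber P z `&` fiber Q z) !=set0
}.

Definition Urq_hom U V :=
  {PQ : set (urqZ U * urqZ V) * set (urqZ U * urqZ V) |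
    is_Urquhart_morphism PQ.1 PQ.2}.

Lemma box_preorder (Z : Type) (le : Z -> Z -> Prop) (A : set Z) :
  Relation_Definitions.preorder Z le -> upset le A -> box (graph le) A = A.
Proof.
move=> [le_refl _] upA; apply/seteqP; split=> [x|x Ax y xy].
  by apply; exact: le_refl.
exact: upA xy Ax.
Qed.

Lemma LU_upset U C : LU C -> upset (@urqle1 U) C.
Proof. by case. Qed.

Lemma phi_upset U (C : set (urqZ U)) : upset (@urqle2 U) (phi C).
Proof.
move=> x y xy Cx [z Cz yz]; apply: Cx; exists z => //.
exact: (Relation_Definitions.preord_trans _ _ (urq_preorder2 (urqP U))) xy yz.
Qed.

Lemma is_Urquhart_morphism_id U :
  @is_Urquhart_morphism U U (graph (@urqle1 U)) (graph (@urqle2 U)).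
Proof.
have b1 C : LU C -> box (graph (@urqle1 U)) C = C.
  by move=> LC; exact: box_preorder (urq_preorder1 (urqP U)) (LU_upset LC).
have b2 C : box (graph (@urqle2 U)) (phi C) = phi C.
  exact: box_preorder (urq_preorder2 (urqP U)) (@phi_upset U C).
split.
- by move=> C LC; rewrite b1 // b2.
- by move=> z z' /(urq_sep1 (urqP U))[C [LC Cz Cz']]; exists C; rewrite b1.
- by move=> z z' /(urq_sep2 (urqP U))[C [LC Cz Cz']]; exists C; rewrite b2.
- move=> z; exists z; split.
    exact: (Relation_Definitions.preord_refl _ _ (urq_preorder1 (urqP U))).
  exact: (Relation_Definitions.preord_refl _ _ (urq_preorder2 (urqP U))).
Qed.

Lemma is_Urquhart_morphism_comp U V W (g : Urq_hom V W) (f : Urq_hom U V) :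
  is_Urquhart_morphism
    (star_box (@LU W) (sval g).1 (sval f).1)
    (star_box [set phi C | C in @LU W] (sval g).2 (sval f).2).
Proof.
case: g f => -[P2 Q2] [/= b2 sP2 sQ2 t2] [[P1 Q1] [/= b1 sP1 sQ1 t1]]; split.
- move=> C LC; have [L2 E2] := b2 _ LC; have [L1 E1] := b1 _ L2.
  by rewrite !box_star //; [rewrite E1 E2|exists C].
- move=> x z /existsNP[C /not_implyP[LC /not_implyP[xC zC]]].
  by exists C; rewrite box_star.
- move=> x z /existsNP[_ /not_implyP[[C LC <-] /not_implyP[xC zC]]].
  by exists C; rewrite box_star //; exists C.
- move=> x; have [y [Pxy Qxy]] := t1 x; have [z [Pyz Qyz]] := t2 y.
  by exists z; split=> C _ /=; [move=> /(_ _ Pxy _ Pyz)|move=> /(_ _ Qxy _ Qyz)].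
Qed.

Definition Urq_id U : Urq_hom U U :=
  exist _ (graph (@urqle1 U), graph (@urqle2 U)) (is_Urquhart_morphism_id U).

Definition Urq_comp U V W (g : Urq_hom V W) (f : Urq_hom U V) : Urq_hom U W :=
  exist _ (star_box (@LU W) (sval g).1 (sval f).1,
           star_box [set phi C | C in @LU W] (sval g).2 (sval f).2)
    (is_Urquhart_morphism_comp g f).

Lemma Urq_homP U V (f g : Urq_hom U V) :
  (forall C, LU C -> box (sval f).1 C = box (sval g).1 C) -> f = g.
Proof.
case: f g => -[P Q] [/= b sP sQ t] [[P' Q'] [/= b' sP' sQ' t']] eP.
have eQ C : LU C -> box Q (phi C) = box Q' (phi C).
  by move=> LC; rewrite -(b _ LC).2 -(b' _ LC).2 eP.
apply: eq_exist; congr (_, _); apply/seteqP; split=> -[x z] /= xz.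
- by apply: contrapT => /sP'[C [LC]]; rewrite -eP // => xC; apply; exact: xC.
- by apply: contrapT => /sP[C [LC]]; rewrite eP // => xC; apply; exact: xC.
- by apply: contrapT => /sQ'[C [LC]]; rewrite -eQ // => xC; apply; exact: xC.
- by apply: contrapT => /sQ[C [LC]]; rewrite eQ // => xC; apply; exact: xC.
Qed.

Lemma Urq_comp_idl U V (f : Urq_hom U V) : Urq_comp (Urq_id V) f = f.
Proof.
apply: Urq_homP => C LC /=; rewrite box_star // box_preorder //.
  exact: urq_preorder1 (urqP V).
exact: LU_upset.
Qed.

Lemma Urq_comp_idr U V (f : Urq_hom U V) : Urq_comp f (Urq_id U) = f.
Proof.
apply: Urq_homP => C LC /=; have [LfC _] := urqm_box (svalP f) LC.
rewrite box_star // box_preorder //; first exact: urq_preorder1 (urqP U).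
exact: LU_upset.
Qed.

Lemma Urq_compA U V W X (h : Urq_hom W X) (g : Urq_hom V W)
    (f : Urq_hom U V) : Urq_comp h (Urq_comp g f) = Urq_comp (Urq_comp h g) f.
Proof.
apply: Urq_homP => C LC /=; have [LhC _] := urqm_box (svalP h) LC.
by rewrite !box_star.
Qed.

Definition Urq : category := Category Urq_comp_idl Urq_comp_idr Urq_compA.
End UrquhartCategory.

(* Main.v *)
From HB Require Import structures.
From mathcomp Require Import all_boot all_order all_classical.
From mathcomp Require Import topology_structure compact product_topology.
From mathcomp Require Import order_topology subspace_topology.
Require Import Defs.

(** Each of the four categories is dually equivalent to the category of bounded
    lattices: every one of them is given a fully faithful and essentially
    surjective functor to the opposite category [lat_op], and two categories
    with such functors to a common target are equivalent
    ([equivalent_categories_common_target]).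

    All the functors have the same shape.  A space is regarded as a polarity
    between its two sides (an Urquhart space is a polarity between two copies of
    itself, a DH-space carries the principal filters of its compact elements),
    and it is sent to the lattice of its distinguished Galois stable sets, with
    meets given by intersections and joins by unions of images on the second
    side.  A morphism (S, T) acts by the box of S; that joins are preserved
    follows from the condition linking S to T ([box_map_hom]).

    Such a morphism is determined by its action, since both relations are
    recovered from separation by stable sets.  Conversely a homomorphism h
    determines candidate relations, and they form a morphism as soon as each
    disjoint pair of a filter and an ideal of stable sets is separated by a pair
    of related points ([hom_rel_morphism]).  This is where compactness enters:
    it is applied to the relation itself for Hartung and GvG-spaces
    ([compact_realizes_pairs]), to the space for Urquhart spaces, and for
    DH-spaces it is replaced by convergence of directed joins in the Lawson
    topology ([dh_realizes]).  For DH-spaces one also has to turn relations into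
    functions: x is sent to the join of the compact elements k such that the box
    of the principal filter of k contains x ([cohlat_extension]).

    For essential surjectivity, a lattice L is represented by points that are
    filters and ideals of L, related when they are disjoint: all filters and
    ideals for DH, the two components of maximal disjoint pairs for Hg, the
    maximal disjoint pairs themselves for Urq, and the filters and ideals that
    are prime for admissible finite joins and meets for GvG.  In each case there
    are enough points for the sets of points containing a given element of L to
    form a copy of L among the stable sets.  What remains is that the topology
    singles out exactly these sets: for Hg and Urq this is [stable_members],
    for GvG it follows from the form of clopen upsets ([gvg_clopen_upset]), and
    for DH the compact elements of the lattice of filters are the principal
    ones ([compact_filterP]). *)

Set Implicit Arguments.
Unset Strict Implicit.
Unset Printing Implicit Defensive.

Import Order.TTheory.
Local Open Scope classical_set_scope.


(** * Equivalences of categories with a common target *)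

Definition fully_faithful (C D : category) (F : functor C D) : Prop :=
  forall a b, (forall f g : hom a b, fmap F f = fmap F g -> f = g) /\
              (forall h : hom (F a) (F b), exists f, fmap F f = h).

Definition essentially_surjective (C D : category) (F : functor C D) : Prop :=
  forall d, exists (c : C) (i : hom (F c) d), is_iso i.

Section NaturalIsomorphisms.
Variables (B C D : category).
Implicit Types F G H : functor C D.

Lemma nat_iso_sym F G : naturally_isomorphic F G -> naturally_isomorphic G F.
Proof.
move=> [eta [eta_iso eta_nat]].
pose th a := projT1 (cid (eta_iso a)).
have thK a : comp (th a) (eta a) = idm (F a).
  by rewrite /th; case: cid => ? [].
have etaK a : comp (eta a) (th a) = idm (G a).
  by rewrite /th; case: cid => ? [].
exists th; split=> [a|a b f]; first by exists (eta a).
rewrite -[LHS]comp_idr -(etaK a) compA -(compA (th b)) -eta_nat.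
by rewrite compA thK comp_idl.
Qed.

Lemma nat_iso_trans F G H :
  naturally_isomorphic F G -> naturally_isomorphic G H ->
  naturally_isomorphic F H.
Proof.
move=> [eta [eta_iso eta_nat]] [th [th_iso th_nat]].
exists (fun a => comp (th a) (eta a)); split=> [a|a b f]; last first.
  by rewrite -compA eta_nat compA th_nat compA.
have [e [eK Ke]] := eta_iso a; have [t [tK Kt]] := th_iso a.
exists (comp e t); split.
  by rewrite -compA (compA t) tK comp_idl.
by rewrite -compA (compA (eta a)) Ke comp_idl.
Qed.

Lemma nat_iso_whisker F G (P : functor B C) :
  naturally_isomorphic F G ->
  naturally_isomorphic (comp_functor F P) (comp_functor G P).
Proof.
move=> [eta [eta_iso eta_nat]]; exists (fun a => eta (P a)).
by split=> [a|a b f] /=; [exact: eta_iso | exact: eta_nat].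
Qed.

Lemma nat_iso_reflect (G : functor C D) (H K : functor B C) :
  fully_faithful G ->
  naturally_isomorphic (comp_functor G H) (comp_functor G K) ->
  naturally_isomorphic H K.
Proof.
move=> Gff [eta [eta_iso eta_nat]].
pose th a := projT1 (cid ((Gff (H a) (K a)).2 (eta a))).
have thE a : fmap G (th a) = eta a by rewrite /th; case: cid.
exists th; split=> [a|a b f].
  have [e [eK Ke]] := eta_iso a; have [t tE] := (Gff _ _).2 e.
  exists t; split; apply: (Gff _ _).1.
    by rewrite fmap_comp thE tE eK fmap_id.
  by rewrite fmap_comp thE tE Ke fmap_id.
by apply: (Gff _ _).1; rewrite !fmap_comp !thE; exact: eta_nat.
Qed.
End NaturalIsomorphisms.

(** Essential surjectivity chooses the objects and fullness the arrows; the
    choices are functorial because G is faithful. *)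
Lemma functor_lift (C D E : category) (F : functor C E) (G : functor D E) :
  fully_faithful G -> essentially_surjective G ->
  exists P : functor C D, naturally_isomorphic (comp_functor G P) F.
Proof.
move=> Gff Ges.
pose P c : D := projT1 (cid (Ges (F c))).
have PE c : exists ij : hom (G (P c)) (F c) * hom (F c) (G (P c)),
    comp ij.2 ij.1 = idm _ /\ comp ij.1 ij.2 = idm _.
  by rewrite /P; case: cid => d [i [j ij]] /=; exists (i, j).
pose i c := (projT1 (cid (PE c))).1; pose j c := (projT1 (cid (PE c))).2.
have ji c : comp (j c) (i c) = idm _ by rewrite /i /j; case: cid => ? [].
have ij c : comp (i c) (j c) = idm _ by rewrite /i /j; case: cid => ? [].
pose lift a b (f : hom a b) := comp (j b) (comp (fmap F f) (i a)).
pose Pmap a b (f : hom a b) := projT1 (cid ((Gff _ _).2 (lift a b f))).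
have GP a b f : fmap G (Pmap a b f) = lift a b f by rewrite /Pmap; case: cid.
have Pid a : Pmap a a (idm a) = idm (P a).
  by apply: (Gff _ _).1; rewrite GP /lift !fmap_id comp_idl ji.
have Pcomp a b c (g : hom b c) (f : hom a b) :
    Pmap _ _ (comp g f) = comp (Pmap _ _ g) (Pmap _ _ f).
  apply: (Gff _ _).1; rewrite fmap_comp !GP /lift fmap_comp.
  by rewrite -!compA (compA (i b)) ij comp_idl.
exists (Functor Pid Pcomp), i; split=> [c|a b f].
  by exists (j c); rewrite ij ji.
by rewrite /= GP /lift compA ij comp_idl.
Qed.

(** Lifting each functor along the other gives quasi-inverse functors: the
    composites become isomorphic to the identity after applying a fully faithful
    functor, hence already before. *)
Lemma equivalent_categories_common_target (C D E : category)
    (F : functor C E) (G : functor D E) :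
  fully_faithful F -> essentially_surjective F ->
  fully_faithful G -> essentially_surjective G -> equivalent_categories C D.
Proof.
move=> Fff Fes Gff Ges.
have [P GP] := functor_lift F Gff Ges; have [Q FQ] := functor_lift G Fff Fes.
have FQP := nat_iso_trans (nat_iso_whisker P FQ) GP.
have GPQ := nat_iso_trans (nat_iso_whisker Q GP) FQ.
exists P, Q; split.
  by apply: (nat_iso_reflect (H := id_functor C) Fff); exact: nat_iso_sym FQP.
by apply: (nat_iso_reflect (K := id_functor D) Gff); exact: GPQ.
Qed.

Lemma fully_faithful_comp (C D E : category) (G : functor D E)
    (F : functor C D) :
  fully_faithful G -> fully_faithful F -> fully_faithful (comp_functor G F).
Proof.
move=> Gff Fff a b; split=> [f g /(Gff _ _).1 /(Fff _ _).1 //|h].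
by have [k <-] := (Gff _ _).2 h; have [f <-] := (Fff _ _).2 k; exists f.
Qed.


(** * Bounded lattices and the stable sets of a polarity *)

Record is_lattice_hom d1 d2 (K : tbLatticeType d1) (L : tbLatticeType d2)
    (h : K -> L) : Prop := IsLatticeHom {
  lhom_top : h \top%O = \top%O;
  lhom_bot : h \bot%O = \bot%O;
  lhom_meet : {morph h : x y / (x `&` y)%O};
  lhom_join : {morph h : x y / (x `|` y)%O}
}.

Lemma is_lattice_hom_comp d1 d2 d3 (K : tbLatticeType d1)
    (L : tbLatticeType d2) (M : tbLatticeType d3) (g : L -> M) (h : K -> L) :
  is_lattice_hom g -> is_lattice_hom h -> is_lattice_hom (g \o h).
Proof.
move=> [gt gb gm gj] [ht hb hm hj].
by split=> [||x y|x y] /=; rewrite ?ht ?hb ?hm ?hj.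
Qed.

Lemma order_iso_lattice_hom d1 d2 (K : tbLatticeType d1)
    (L : tbLatticeType d2) (h : K -> L) :
  {mono h : x y / (x <= y)%O} -> (forall z, exists x, h x = z) ->
  is_lattice_hom h.
Proof.
move=> hle hsurj; split=> [||x y|x y]; apply/le_anti/andP; split.
- exact: lex1.
- by have [t <-] := hsurj \top%O; rewrite hle lex1.
- by have [t <-] := hsurj \bot%O; rewrite hle le0x.
- exact: le0x.
- by rewrite lexI !hle leIl leIr.
- have [z hz] := hsurj (h x `&` h y)%O.
  by rewrite -hz hle lexI -!hle hz leIl leIr.
- have [z hz] := hsurj (h x `|` h y)%O.
  by rewrite -hz hle leUx -!hle hz leUl leUr.
- by rewrite leUx !hle leUl leUr.
Qed.

Section LatticeCategory.
Implicit Types a b c : tbLatticeType dual_space_display.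

Definition lat_op_hom a b := {h : b -> a | is_lattice_hom h}.

Definition lat_op_id a : lat_op_hom a a :=
  exist _ id (IsLatticeHom erefl erefl (fun _ _ => erefl) (fun _ _ => erefl)).

Definition lat_op_comp a b c (g : lat_op_hom b c) (f : lat_op_hom a b) :
    lat_op_hom a c :=
  exist _ (sval f \o sval g) (is_lattice_hom_comp (svalP f) (svalP g)).

Lemma lat_op_idl a b (f : lat_op_hom a b) : lat_op_comp (lat_op_id b) f = f.
Proof. by case: f => f fP; exact: eq_exist. Qed.

Lemma lat_op_idr a b (f : lat_op_hom a b) : lat_op_comp f (lat_op_id a) = f.
Proof. by case: f => f fP; exact: eq_exist. Qed.

Lemma lat_op_compA a b c d (h : lat_op_hom c d) (g : lat_op_hom b c)
    (f : lat_op_hom a b) :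
  lat_op_comp h (lat_op_comp g f) = lat_op_comp (lat_op_comp h g) f.
Proof. exact: eq_exist. Qed.

(** The opposite of the category of bounded lattices, so that the functors
    from the four categories of spaces become covariant. *)
Definition lat_op : category := Category lat_op_idl lat_op_idr lat_op_compA.
End LatticeCategory.

Definition pl_closure (A : polarity) (U : set (plX A)) : set (plX A) :=
  box (@plR A) (image_rel (@plR A) U).

Lemma image_relU X Y (R : set (X * Y)) (U V : set X) :
  image_rel R (U `|` V) = image_rel R U `|` image_rel R V.
Proof.
apply/seteqP; split=> y.
  by move=> [x [Ux|Vx] Rxy]; [left|right]; exists x.
by move=> [|] [x xU Rxy]; exists x => //; [left|right].
Qed.

Lemma image_relS X Y (R : set (X * Y)) (U V : set X) :
  U `<=` V -> image_rel R U `<=` image_rel R V.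
Proof. by move=> UV y [x /UV Vx Rxy]; exists x. Qed.

Lemma image_rel0 X Y (R : set (X * Y)) : image_rel R set0 = set0.
Proof. by apply/seteqP; split=> // y []. Qed.

Lemma preimage_relU X Y (R : set (X * Y)) (U V : set Y) :
  preimage_rel R (U `|` V) = preimage_rel R U `|` preimage_rel R V.
Proof.
apply/seteqP; split=> x.
  by move=> [y [Uy|Vy] Rxy]; [left|right]; exists y.
by move=> [|] [y yU Rxy]; exists y => //; [left|right].
Qed.

Lemma preimage_rel0 X Y (R : set (X * Y)) : preimage_rel R set0 = set0.
Proof. by apply/seteqP; split=> // x []. Qed.

Lemma boxI X Y (R : set (X * Y)) (U V : set Y) :
  box R (U `&` V) = box R U `&` box R V.
Proof.
apply/seteqP; split=> x; first by move=> UV; split=> y /UV[].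
by move=> [xU xV] y Rxy; split; [exact: xU|exact: xV].
Qed.

Lemma boxS X Y (R : set (X * Y)) (U V : set Y) :
  U `<=` V -> box R U `<=` box R V.
Proof. by move=> UV x xU y /xU /UV. Qed.

Lemma boxT X Y (R : set (X * Y)) : box R setT = setT.
Proof. by apply/seteqP; split. Qed.

Lemma sub_box_image X Y (R : set (X * Y)) (U : set X) :
  U `<=` box R (image_rel R U).
Proof. by move=> x Ux y Rxy; exists x. Qed.

Lemma image_box_image X Y (R : set (X * Y)) (U : set X) :
  image_rel R (box R (image_rel R U)) = image_rel R U.
Proof.
apply/seteqP; split=> [y [x xU Rxy]|]; first exact: xU.
exact: image_relS (@sub_box_image _ _ R U).
Qed.

Lemma stable_setI X Y (R : set (X * Y)) (U V : set X) :
  U = box R (image_rel R U) -> V = box R (image_rel R V) ->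
  U `&` V = box R (image_rel R (U `&` V)).
Proof.
move=> UE VE; apply/seteqP; split; first exact: sub_box_image.
rewrite {2}UE {2}VE -boxI; apply: boxS => y [x [Ux Vx] Rxy].
by split; exists x.
Qed.

(** The closure conditions make the distinguished stable sets a bounded
    sublattice of the complete lattice of all stable sets, where the join is the
    closure of the union. *)
Record lattice_polarity := LatticePolarity {
  lp_pl :> polarity;
  lp_stable : forall U, @plL lp_pl U -> pl_closure U = U;
  lp_top : @plL lp_pl setT;
  lp_bot : @plL lp_pl (@pl_closure lp_pl set0);
  lp_meet : forall U V, @plL lp_pl U -> plL V -> plL (U `&` V);
  lp_join : forall U V, @plL lp_pl U -> plL V -> plL (pl_closure (U `|` V))
}.

Definition stable_set (A : lattice_polarity) : Type :=
  {U : set (plX A) | plL U}.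

Lemma stable_set_inj (A : lattice_polarity) (U V : stable_set A) :
  sval U = sval V -> U = V.
Proof. by case: U V => U LU [V LV] /= UV; exact: eq_exist. Qed.

Section StableSetLattice.
Variable A : lattice_polarity.
Implicit Types U V W : stable_set A.

HB.instance Definition _ := gen_eqMixin (stable_set A).
HB.instance Definition _ := gen_choiceMixin (stable_set A).

Definition stable_le U V : bool := `[< sval U `<=` sval V >].

Lemma stable_le_refl : reflexive stable_le.
Proof. by move=> U; apply/asboolP. Qed.

Lemma stable_le_anti : antisymmetric stable_le.
Proof.
move=> [U LU] [V LV] /andP[/asboolP/= UV /asboolP/= VU].
by apply: eq_exist; exact/seteqP.
Qed.

Lemma stable_le_trans : transitive stable_le.
Proof.
by move=> V U W /asboolP UV /asboolP VW; apply/asboolP; exact: subset_trans VW.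
Qed.

HB.instance Definition _ := Order.Le_isPOrder.Build dual_space_display
  (stable_set A) stable_le_refl stable_le_anti stable_le_trans.

Definition stable_meet U V : stable_set A :=
  exist _ (sval U `&` sval V) (lp_meet (svalP U) (svalP V)).
Definition stable_join U V : stable_set A :=
  exist _ (pl_closure (sval U `|` sval V)) (lp_join (svalP U) (svalP V)).
Definition stable_top : stable_set A := exist _ setT (lp_top A).
Definition stable_bot : stable_set A := exist _ (pl_closure set0) (lp_bot A).

Lemma stable_leP U V : reflect (sval U `<=` sval V) (U <= V)%O.
Proof. exact: asboolP. Qed.

Lemma pl_closure_min (D : set (plX A)) U :
  D `<=` sval U -> pl_closure D `<=` sval U.
Proof.
move=> DU; rewrite -(lp_stable (svalP U)).
by apply: boxS; exact: image_relS.
Qed.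

Lemma stable_meetP U V W :
  (U <= stable_meet V W)%O = (U <= V)%O && (U <= W)%O.
Proof.
apply/stable_leP/andP => /= [UVW|[/stable_leP UV /stable_leP UW]].
  by split; apply/stable_leP => x /UVW[].
by move=> x Ux; split; [exact: UV|exact: UW].
Qed.

Lemma stable_joinP U V W :
  (stable_join U V <= W)%O = (U <= W)%O && (V <= W)%O.
Proof.
apply/stable_leP/andP => /= [UVW|[/stable_leP UW /stable_leP VW]].
  split; apply/stable_leP => x xU; apply: UVW; apply: sub_box_image.
    by left.
  by right.
by apply: pl_closure_min => x [/UW|/VW].
Qed.

HB.instance Definition _ := Order.POrder_MeetJoin_isLattice.Build
  dual_space_display (stable_set A) stable_meetP stable_joinP.

Lemma stable_le0x U : (stable_bot <= U)%O.
Proof. by apply/stable_leP; exact: pl_closure_min. Qed.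

Lemma stable_lex1 U : (U <= stable_top)%O.
Proof. exact/stable_leP. Qed.

HB.instance Definition _ := Order.hasBottom.Build dual_space_display
  (stable_set A) stable_le0x.
HB.instance Definition _ := Order.hasTop.Build dual_space_display
  (stable_set A) stable_lex1.
End StableSetLattice.

Definition stable_lattice (A : lattice_polarity) :
  tbLatticeType dual_space_display := stable_set A.

Lemma image_stable_join (A : lattice_polarity) (U V : stable_set A) :
  image_rel (@plR A) (sval (U `|` V)%O) =
  image_rel (@plR A) (sval U) `|` image_rel (@plR A) (sval V).
Proof. by rewrite /= image_box_image image_relU. Qed.

Lemma image_stable_bot (A : lattice_polarity) :
  image_rel (@plR A) (sval (\bot%O : stable_set A)) = set0.
Proof. by rewrite /= image_box_image image_rel0. Qed.

Lemma stable_set_imageP (A : lattice_polarity) (U V : stable_set A) :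
  image_rel (@plR A) (sval U) = image_rel (@plR A) (sval V) -> U = V.
Proof.
case: U V => U LU [V LV] /= UV; apply: eq_exist.
by rewrite -(lp_stable LU) -(lp_stable LV) /pl_closure UV.
Qed.

Section BoxHom.
Variables (A B : lattice_polarity) (f : pl_hom A B).

Definition box_map (U : stable_set B) : stable_set A :=
  exist _ (box (sval f).1 (sval U)) (relm_box (svalP f) (svalP U)).1.

Lemma image_box_map (U : stable_set B) :
  image_rel (@plR A) (sval (box_map U)) =
  preimage_rel (sval f).2 (image_rel (@plR B) (sval U)).
Proof. by have [_ ->] := relm_box (svalP f) (svalP U). Qed.

(** Boxes preserve intersections, and joins are unions on the other side of the
    polarity, where the inverse image under the second relation acts. *)
Lemma box_map_hom : is_lattice_hom box_map.
Proof.
split=> [||U V|U V].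
- by apply: eq_exist => /=; rewrite boxT.
- apply: stable_set_imageP.
  by rewrite image_box_map !image_stable_bot preimage_rel0.
- by apply: eq_exist => /=; rewrite boxI.
- apply: stable_set_imageP.
  by rewrite image_box_map !image_stable_join !image_box_map preimage_relU.
Qed.
End BoxHom.

(** The form of compactness that makes the functor to lattices full: applied to
    the filter and the ideal that a homomorphism attaches to two related points,
    it provides their images. *)
Definition realizes_pairs (A : lattice_polarity) : Prop :=
  forall F J : set (stable_lattice A),
    lattice_filter F -> lattice_filter (J : set (stable_lattice A)^d) ->
    (forall U, F U -> ~ J U) ->
    exists x y, [/\ plR (x, y), forall U, F U -> sval U x
                  & forall U, J U -> ~ image_rel (@plR A) (sval U) y].

Section RelationOfHom.
Variables (A B : lattice_polarity).
Variables (h : stable_lattice B -> stable_lattice A) (hP : is_lattice_hom h).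
Hypothesis Breal : realizes_pairs B.

Let image_mono (U V : stable_set A) : (U <= V)%O ->
  image_rel (@plR A) (sval U) `<=` image_rel (@plR A) (sval V).
Proof. by move=> /stable_leP; exact: image_relS. Qed.

Let h_mono (U V : stable_set B) : (U <= V)%O -> (h U <= h V)%O.
Proof. by rewrite !leEmeet -(lhom_meet hP) => /eqP ->. Qed.

(** The largest relations that could act on stable sets as h does. *)
Definition hom_relX : set (plX A * plX B) :=
  [set p | forall U, sval (h U) p.1 -> sval U p.2].
Definition hom_relY : set (plY A * plY B) :=
  [set p | forall U, image_rel (@plR B) (sval U) p.2 ->
     image_rel (@plR A) (sval (h U)) p.1].

Lemma filter_at x : lattice_filter [set U | sval (h U) x].
Proof.
split=> [|U V hU hV|U V /h_mono/stable_leP UV /UV //] /=.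
  by rewrite (lhom_top hP).
by rewrite (lhom_meet hP).
Qed.

Lemma ideal_at y : lattice_filter
  ([set U | ~ image_rel (@plR A) (sval (h U)) y] : set (stable_lattice B)^d).
Proof.
split=> [|U V hU hV|U V UV hU hV].
- change (~ image_rel (@plR A) (sval (h \bot%O)) y).
  by rewrite (lhom_bot hP) image_stable_bot.
- change (~ image_rel (@plR A) 
      (sval (h (@Order.join _ (stable_lattice B) U V))) y).
  by rewrite (lhom_join hP) image_stable_join => -[].
- exact/hU/(image_mono (h_mono UV)).
Qed.

(** For related x and y, the stable sets that h sends around x are disjoint from
    those whose image under h does not reach y. *)
Lemma hom_rel_total x y : plR (x, y) ->
  exists x' y', [/\ hom_relX (x, x'), hom_relY (y, y') & plR (x', y')].
Proof.
move=> Rxy; have [|x' [y' [Rxy' Fx' Jy']]] :=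
  Breal (filter_at x) (ideal_at y).
  by move=> U Ux; apply; exists x.
exists x', y'; split=> // U Uy'; apply: contrapT => /Jy'; exact.
Qed.

(** If h U does not contain x, the filter of the stable sets that h sends around
    x is disjoint from the ideal generated by U. *)
Lemma box_hom_relX (U : stable_set B) : box hom_relX (sval U) = sval (h U).
Proof.
apply/seteqP; split=> [x xU|x Ux x' xx']; last exact: xx'.
apply: contrapT => hUx.
have upU : lattice_filter ([set V | (V <= U)%O] : set (stable_lattice B)^d).
  split=> [|V W /= VU WU|V W /= WV VU]; first exact: le0x.
    by rewrite [(_ <= _)%O]leUx VU.
  exact: (@le_trans _ (stable_lattice B) V W U WV VU).
have [|x' [y' [Rxy' Fx' Jy']]] := Breal (filter_at x) upU.
  by move=> V /= Vx /h_mono/stable_leP VU; apply: hUx; exact: VU.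
apply: (Jy' U); first exact: lexx.
by exists x' => //; apply: xU => V; exact: Fx'.
Qed.

Lemma preimage_hom_relY (U : stable_set B) :
  preimage_rel hom_relY (image_rel (@plR B) (sval U)) =
  image_rel (@plR A) (sval (h U)).
Proof.
apply/seteqP; split=> [y [y' Uy' yy']|y [x Ux Rxy]]; first exact: yy'.
have [x' [y' [xx' yy' Rxy']]] := hom_rel_total Rxy.
by exists y' => //; exists x' => //; exact: xx'.
Qed.

Lemma hom_rel_morphism :
  is_rel_morphism (@plR A) (@plL A) (@plR B) (@plL B) hom_relX hom_relY.
Proof.
split.
- move=> U LU; have := box_hom_relX (exist _ U LU).
  have /= -> := preimage_hom_relY (exist _ U LU); move=> /= ->.
  by split=> //; exact: svalP.
- move=> x x' /existsNP[U /not_implyP[/= Ux Ux']].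
  by exists (sval U); rewrite box_hom_relX; split=> //; exact: svalP.
- move=> y y' /existsNP[U /not_implyP[/= Uy' Uy]].
  by exists (sval U); rewrite preimage_hom_relY; split=> //; exact: svalP.
- exact: hom_rel_total.
Qed.
End RelationOfHom.

Section StableFunctor.
Variables (T : Type) (pl : T -> lattice_polarity).

Let C := rel_category (fun t => lp_pl (pl t)).

Definition stable_map (a b : C) (f : hom a b) :
    @hom lat_op (stable_lattice (pl a)) (stable_lattice (pl b)) :=
  exist _ (box_map f) (box_map_hom f).

Lemma stable_map_id (a : C) : stable_map (idm a) = idm _.
Proof.
apply: eq_exist; apply/funext => -[U LU]; apply: eq_exist => /=.
exact: box_graph.
Qed.

Lemma stable_map_comp (a b c : C) (g : hom b c) (f : hom a b) :
  stable_map (comp g f) = comp (stable_map g) (stable_map f).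
Proof.
apply: eq_exist; apply/funext => -[U LU]; apply: eq_exist => /=.
exact: box_star.
Qed.

Definition stable_functor : functor C lat_op :=
  @Functor C lat_op (fun t => stable_lattice (pl t)) stable_map
    stable_map_id stable_map_comp.

Lemma stable_functor_ff :
  (forall t, realizes_pairs (pl t)) -> fully_faithful stable_functor.
Proof.
move=> plreal a b; split=> [f g fg|[h hP]].
  have fgU (U : stable_set (pl b)) : box_map f U = box_map g U.
    by have /(congr1 (fun k => sval k U)) := fg.
  apply: pl_homP => U LU.
    by have /(congr1 sval) := fgU (exist _ U LU).
  have := image_box_map f (exist _ U LU); rewrite fgU => /= <-.
  exact: (image_box_map g (exist _ U LU)).
exists (exist _ (hom_relX h, hom_relY h) (hom_rel_morphism hP (plreal b))).
apply: eq_exist; apply/funext => -[U LU]; apply: stable_set_inj.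
exact: (box_hom_relX hP (plreal b) (exist _ U LU)).
Qed.

Lemma stable_lattice_iso (L : tbLatticeType dual_space_display) (t : T)
    (C_ : L -> set (plX (pl t))) :
  (forall U, plL U <-> exists a, U = C_ a) ->
  (forall a b, C_ a `<=` C_ b <-> (a <= b)%O) ->
  exists i : hom (stable_functor t) (L : lat_op), is_iso i.
Proof.
move=> CL Cle.
have LC a : plL (C_ a) by apply/CL; exists a.
pose f (a : L) : stable_lattice (pl t) := exist _ (C_ a) (LC a).
have fle : {mono f : a b / (a <= b)%O}.
  by move=> a b; apply/stable_leP/idP => /Cle.
have fsurj U : exists a, f a = U.
  by case: U => U LU; have /CL[a Ua] := LU; exists a; exact: eq_exist.
pose g U := projT1 (cid (fsurj U)).
have gK U : f (g U) = U by rewrite /g; case: cid.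
have fK a : g (f a) = a by apply: (inc_inj fle); rewrite gK.
have gle : {mono g : U V / (U <= V)%O} by move=> U V; rewrite -fle !gK.
exists (exist _ f (order_iso_lattice_hom fle fsurj)).
have gsurj a : exists U, g U = a by exists (f a).
exists (exist _ g (order_iso_lattice_hom gle gsurj)).
by split; apply: eq_exist; apply/funext => x /=; rewrite ?fK ?gK.
Qed.
End StableFunctor.


(** * Topologies generated by a subbase *)

(** Neighbourhoods are described by finite sequences of members of the subbase
    all containing the given point, which suits arguments by induction. *)
Definition subbase (T : topologicalType) (D : set (set T)) : Prop :=
  D `<=` open /\
  forall (U : set T) x, open U -> U x ->
    exists s : seq (set T), [/\ forall V, V \in s -> D V,
      forall V, V \in s -> V x
    & forall y, (forall V, V \in s -> V y) -> U y].

Definition subbase_space (T : Type) (D : set (set T)) : Type := T.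

HB.instance Definition _ (T : Type) (D : set (set T)) :=
  gen_eqMixin (subbase_space D).
HB.instance Definition _ (T : Type) (D : set (set T)) :=
  gen_choiceMixin (subbase_space D).
HB.instance Definition _ (T : Type) (D : set (set T)) :=
  isSubBaseTopological.Build (subbase_space D) D id.

Lemma subbase_spaceP (T : Type) (D : set (set T)) :
  @subbase (subbase_space D) D.
Proof.
split=> [V DV|U x].
  exists [set V]; last by rewrite bigcup_set1.
  by move=> _ ->; exact: (@finI_from1 _ _ D id).
move=> [E Efin <-] [V EV Vx].
have [s sD sV] := Efin _ EV; exists (finmap.enum_fset s); split.
- by move=> W /sD; rewrite inE.
- by move=> W Ws; move: Vx; rewrite -sV; exact.
- move=> y sW; have Vy : V y by rewrite -sV => i /sW.
  by exists V; [exact: EV|exact: Vy].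
Qed.

Lemma lawson_subbaseP d (L : tbLatticeType d) :
  @subbase (lawson L) (@lawson_subbasis d L).
Proof. exact: (@subbase_spaceP L (@lawson_subbasis d L)). Qed.

Lemma subbase_cvg (T : topologicalType) (D : set (set T)) (F : set_system T)
    (p : T) :
  subbase D -> Filter F -> (forall V, D V -> V p -> F V) -> F --> p.
Proof.
move=> [_ Dsub] FF FD A; rewrite /= nbhsE => -[U [oU Up] UA].
have [s [sD sp sU]] := Dsub _ _ oU Up.
apply: (@filterS _ _ _ (fun y => forall V, V \in s -> V y)) => [y /sU/UA//|].
elim: s sD sp {sU} => [|V s IHs] sD sp.
  by apply: filterS filterT => y _ V.
have FV : F V by apply: FD; [apply: sD|apply: sp]; rewrite inE eqxx.
have Fs : F (fun y => forall V, V \in s -> V y).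
  apply: IHs => W Ws; first by apply: sD; rewrite inE Ws orbT.
  by apply: sp; rewrite inE Ws orbT.
apply: filterS (filterI FV Fs) => y [Vy sy] W.
by rewrite inE => /orP[/eqP ->|/sy].
Qed.

Lemma compact_directed (T : topologicalType) (K : set T) (I : Type)
    (i0 : I) (f : I -> set T) :
  compact K -> (forall i, closed (f i)) ->
  (forall i j, exists k, f k `<=` f i `&` f j) ->
  (forall i, exists2 x, K x & f i x) ->
  exists2 x, K x & forall i, f i x.
Proof.
move=> Kc fcl fdir fne.
pose F := filter_from [set: I] (fun i => K `&` f i).
have FF : ProperFilter F.
  apply: filter_from_proper; last first.
    by move=> i _; have [x Kx fx] := fne i; exists x.
  apply: filter_from_filter => [|i j _ _]; first by exists i0.
  have [k fk] := fdir i j; exists k => // x [Kx /fk[fi fj]]; split=> //.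
have FK : F K by exists i0 => // x [].
have [x [Kx Fx]] := Kc _ FF FK; exists x => // i; apply: fcl => B xB.
have Ffi : F (f i) by exists i => // y [].
exact: Fx _ _ Ffi xB.
Qed.

Lemma closed_sub_inter (T : topologicalType) (s : seq (set T)) :
  (forall V, V \in s -> closed V) -> closed [set x | exists2 V, V \in s & V x].
Proof.
elim: s => [|V s IHs] sc.
  by rewrite (_ : mkset _ = set0); [exact: closed0|apply/seteqP; split=> x [] ].
rewrite (_ : mkset _ = V `|` [set x | exists2 V, V \in s & V x]).
  apply: closedU; first by apply: sc; rewrite inE eqxx.
  by apply: IHs => W Ws; apply: sc; rewrite inE Ws orbT.
apply/seteqP; split=> x [].
- by move=> W; rewrite inE => /orP[/eqP ->|Ws Wx]; [left|right; exists W].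
- by move=> Vx; exists V => //; rewrite inE eqxx.
- by move=> [W Ws Wx]; exists W => //; rewrite inE Ws orbT.
Qed.

Lemma compact_finite_cover (T : topologicalType) (K : set T) (I : eqType)
    (C : I -> set T) (good : I -> Prop) :
  compact K -> (forall i, open (C i)) ->
  (forall x, K x -> exists2 i, good i & C i x) ->
  exists2 s : seq I, (forall i, i \in s -> good i)
    & forall x, K x -> exists2 i, i \in s & C i x.
Proof.
move=> Kc oC KC; apply: contrapT => nos.
pose J := {s : seq I | forall i, i \in s -> good i}.
pose j0 : J := exist (fun s : seq I => forall i, i \in s -> good i) [::]
  (fun i (i0 : i \in [::]) => False_ind _ (notF i0)).
have [j|[s sg] [t tg]|[s sg]|x Kx xC] := @compact_directed T K J j0
  (fun s => ~` [set x | exists2 V, V \in [seq C i | i <- sval s] & V x]) Kc.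
- rewrite (_ : ~` _ = \bigcap_(V in [set` [seq C i | i <- sval j]]) ~` V).
    by apply: closed_bigI => _ /mapP[i _ ->]; exact: open_closedC.
  apply/seteqP; split=> x xC; first by move=> V Vs Vx; apply: xC; exists V.
  by move=> [V Vs Vx]; exact: xC Vs Vx.
- have stg i : i \in s ++ t -> good i by rewrite mem_cat => /orP[/sg|/tg].
  exists (exist _ _ stg) => x /= xst.
  split=> -[V Vs Vx]; apply: xst; exists V => //.
    by rewrite map_cat mem_cat Vs.
  by rewrite map_cat mem_cat Vs orbT.
- apply: contrapT => sC; apply: nos; exists s => // x Kx; apply: contrapT => nx.
  apply: sC; exists x => // -[_ /mapP[i is_ ->] Cix]; apply: nx; exists i => //.
have [i gi Cix] := KC x Kx.
have gi1 j : j \in [:: i] -> good j by rewrite inE => /eqP ->.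
by apply: (xC (exist _ [:: i] gi1)); exists (C i); rewrite ?inE.
Qed.

Lemma subbase_closed_subbasis (T : topologicalType) (B : set (set T)) :
  subbase [set ~` C | C in B] -> closed_subbasis B.
Proof.
move=> [Bop Bsub] A; split=> [clA|[F [FB ->]]].
  exists [set C | A `<=` C /\ exists s : set (set T),
      [/\ finite_set s, s `<=` B & C = \bigcup_(D in s) D]].
  split=> [C []//|]; apply/seteqP; split=> [x Ax C [sAC _]|x xC].
    exact: sAC.
  apply: contrapT => nAx.
  have [s [sB sx sA]] := Bsub _ _ (closed_openC clA) nAx.
  have: (\bigcup_(D in [set ~` V | V in [set` s]]) D) x.
    apply: (xC); split.
      move=> y Ay; apply: contrapT => yD; apply: (sA y) => // V Vs.
      by apply: contrapT => nVy; apply: yD; exists (~` V) => //; exists V.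
    exists [set ~` V | V in [set` s]]; split=> //.
      exact/finite_image/finite_seq.
    by move=> _ [V /= Vs <-]; have [C BC <-] := sB _ Vs; rewrite setCK.
  by move=> [_ [V /= Vs <-]]; apply; exact: sx.
apply: closed_bigI => C /FB[s [/finite_seqP[r ->] rB ->]].
have -> : \bigcup_(D in [set` r]) D = [set x | exists2 V, V \in r & V x] by [].
apply: closed_sub_inter => V /rB BV; rewrite -[V]setCK; apply: open_closedC.
by apply: Bop; exists V.
Qed.

Lemma open_sub_union (T : topologicalType) (A : set T) :
  (forall x, A x -> exists U, [/\ open U, U x & U `<=` A]) -> open A.
Proof.
move=> AU; rewrite openE => x /AU[U [oU Ux UA]]; apply: filterS UA _.
exact: open_nbhs_nbhs.
Qed.

(** * Disjoint filters and ideals *)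

Section FiltersAndIdeals.
Variables (d : Order.disp_t) (L : tbLatticeType d).
Implicit Types (F G I J : set L) (a b : L).

Definition lattice_ideal I := lattice_filter (I : set L^d).

Lemma lattice_idealP I : lattice_ideal I <->
  [/\ I \bot%O, (forall a b, I a -> I b -> I (a `|` b)%O)
     & forall a b, (a <= b)%O -> I b -> I a].
Proof.
split=> [[I0 IU Id]|[I0 IU Id]].
  by split=> [//|a b|a b]; [exact: IU|exact: Id].
by split=> [//|a b|a b]; [exact: IU|exact: Id].
Qed.

Lemma filter_up a : lattice_filter [set x | (a <= x)%O].
Proof.
split=> [|x y ax ay|x y xy ax] /=; first exact: lex1.
  by rewrite lexI ax.
exact: le_trans ax xy.
Qed.

Lemma ideal_down a : lattice_ideal [set x | (x <= a)%O].
Proof.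
apply/lattice_idealP; split=> [|x y xa ya|x y xy ya] /=; first exact: le0x.
  by rewrite leUx xa.
exact: le_trans xy ya.
Qed.

Lemma filter_sup F a : lattice_filter F ->
  lattice_filter [set x | exists2 f, F f & (f `&` a <= x)%O].
Proof.
move=> [F1 FI Fup]; split=> [|x y [f Ff fx] [g Fg gy]|x y xy [f Ff fx]] /=.
- by exists \top%O => //; exact: lex1.
- exists (f `&` g)%O; first exact: FI.
  rewrite lexI (le_trans _ fx) ?(le_trans _ gy) //.
    by rewrite leI2 // leIr.
  by rewrite leI2 // leIl.
- by exists f => //; exact: le_trans fx xy.
Qed.

(** The empty set is admitted in the family to which Zorn's lemma is applied, so
    that the union of the empty chain belongs to it. *)
Lemma maximal_filter F J : lattice_filter F -> (forall a, F a -> ~ J a) ->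
  exists G, [/\ lattice_filter G, F `<=` G, forall a, G a -> ~ J a
    & forall H, lattice_filter H -> G `<=` H -> (forall a, H a -> ~ J a) ->
        H `<=` G].
Proof.
move=> FF FJ.
pose Q G := [/\ lattice_filter G, F `<=` G & forall a, G a -> ~ J a].
have [|G [[->|[GF FG GJ]] Gmax]] := @Zorn_bigcup _ [set G | G = set0 \/ Q G].
- move=> C CQ Ctot; have [C0|] := pselect (forall G, C G -> G = set0).
    left; apply/seteqP; split=> // x [G CG Gx].
    by rewrite (C0 _ CG) in Gx.
  move=> /existsNP[G0 /not_implyP[CG0 G0n0]]; right.
  have QC G x : C G -> G x -> Q G.
    by move=> CG Gx; case: (CQ _ CG) => // GE; rewrite GE in Gx.
  have QG0 : Q G0 by case: (CQ _ CG0).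
  split=> [|x Fx|x [G CG Gx]]; last 2 first.
  + by exists G0 => //; case: QG0 => _ FG0 _; exact: FG0.
  + by have [_ _] := QC _ _ CG Gx; apply.
  split=> [|x y [G CG Gx] [H CH Hy]|x y xy [G CG Gx]].
  + by exists G0 => //; have [[]] := QG0.
  + have [[_ GI _] _ _] := QC _ _ CG Gx; have [[_ HI _] _ _] := QC _ _ CH Hy.
    have [GH|HG] := Ctot _ _ CG CH.
      by exists H => //; apply: HI => //; exact: GH.
    by exists G => //; apply: GI => //; exact: HG.
  + by exists G => //; have [[_ _ Gup] _ _] := QC _ _ CG Gx; exact: Gup Gx.
- exfalso; apply: (Gmax F); last first.
    by rewrite /=; right; split.
  by split=> [//|F0]; case: FF => F1 _ _; exact: F0 F1.
- exists G; split=> // H HF GH HJ; apply: contrapT => HG.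
  by apply: (Gmax H); [split|right; split=> //; exact: subset_trans GH].
Qed.

Record max_pair F I : Prop := MaxPair {
  mp_filter : lattice_filter F;
  mp_ideal : lattice_ideal I;
  mp_disjoint : forall a, F a -> ~ I a;
  mp_maxF : forall G, lattice_filter G -> F `<=` G ->
    (forall a, G a -> ~ I a) -> G `<=` F;
  mp_maxI : forall J, lattice_ideal J -> I `<=` J ->
    (forall a, F a -> ~ J a) -> J `<=` I
}.
End FiltersAndIdeals.

(** Enlarging the filter first and the ideal second gives a maximal pair: a
    filter maximal among those disjoint from an ideal remains maximal for a
    larger ideal still disjoint from it. *)
Lemma max_pair_ext d (L : tbLatticeType d) (F I : set L) :
  lattice_filter F -> lattice_ideal I -> (forall a, F a -> ~ I a) ->
  exists G J, [/\ max_pair G J, F `<=` G & I `<=` J].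
Proof.
move=> FF II FI.
have [G [GF FG GI Gmax]] := maximal_filter FF FI.
have [|J [JI IJ JG Jmax]] := @maximal_filter _ L^d I G II.
  by move=> a Ia /GI.
exists G, J; split=> //; split=> //.
- by move=> a Ga /JG.
- by move=> H HF GH HJ; apply: Gmax => // a Ha Ia; apply: (HJ _ Ha); exact: IJ.
- by move=> K KI JK KG; apply: Jmax => // a Ka /KG.
Qed.

Lemma max_pair_dual d (L : tbLatticeType d) (F I : set L) :
  @max_pair _ L^d I F <-> max_pair F I.
Proof.
split=> -[P1 P2 P3 P4 P5]; split=> //.
- by move=> a Ia /P3.
- by move=> J JI IJ JF; apply: P5 => // a Fa /JF.
- by move=> G GF FG GI; apply: P4 => // a Ga /GI.
- by move=> a Ia /P3.
- by move=> J JI IJ JF; apply: P5 => // a Fa /JF.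
- by move=> G GF FG GI; apply: P4 => // a Ga /GI.
Qed.

(** * Polarities built from a lattice *)

Definition swap_rel X Y (R : set (X * Y)) : set (Y * X) :=
  [set p | R (p.2, p.1)].

(** The common shape of the four spaces built from a lattice.  Points need not
    realize every filter or ideal, but [cp_ext] lets them stand for arbitrary
    disjoint pairs. *)
Record canonical_polarity d (L : tbLatticeType d) X Y (R : set (X * Y))
    (Fl : X -> set L) (Id : Y -> set L) : Prop := CanonicalPolarity {
  cp_filter : forall x, lattice_filter (Fl x);
  cp_ideal : forall y, lattice_ideal (Id y);
  cp_rel : forall x y, R (x, y) <-> forall a, Fl x a -> ~ Id y a;
  cp_ext : forall F I : set L, lattice_filter F -> lattice_ideal I ->
    (forall a, F a -> ~ I a) ->
    exists x y, [/\ F `<=` Fl x, I `<=` Id y & R (x, y)]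
}.

Lemma canonical_polarity_dual d (L : tbLatticeType d) X Y (R : set (X * Y))
    (Fl : X -> set L) (Id : Y -> set L) :
  canonical_polarity R Fl Id ->
  @canonical_polarity _ L^d _ _ (swap_rel R) Id Fl.
Proof.
move=> [FlF IdI RE ext]; split=> //.
- by move=> y x; split=> [/RE RE' a ya /RE'//|yx]; apply/RE => a xa /yx.
- move=> I F II FF FI; have [|x [y [Fx Iy Rxy]]] := ext F I FF II.
    by move=> a Fa /FI.
  by exists y, x.
Qed.

Section CanonicalPolarity.
Variables (d : Order.disp_t) (L : tbLatticeType d) (X Y : Type).
Variables (R : set (X * Y)) (Fl : X -> set L) (Id : Y -> set L).
Hypothesis can : canonical_polarity R Fl Id.

Definition members Z (E : Z -> set L) (a : L) : set Z := [set z | E z a].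

Let C := members Fl.
Let D := members Id.

Lemma fl_up x a b : (a <= b)%O -> Fl x a -> Fl x b.
Proof. by have [_ _ up] := cp_filter can x; exact: up. Qed.

Lemma id_down y a b : (a <= b)%O -> Id y b -> Id y a.
Proof. by have /lattice_idealP[_ _ dn] := cp_ideal can y; exact: dn. Qed.

Lemma rel_disjoint x y a : R (x, y) -> Fl x a -> ~ Id y a.
Proof. by move/(cp_rel can); apply. Qed.

Lemma extend_ideal_down x a : ~ Fl x a ->
  exists x' y, [/\ Fl x `<=` Fl x', R (x', y), R (x, y) & Id y a].
Proof.
move=> nxa; have [|x' [y [xx' ay Rxy]]] :=
  cp_ext can (cp_filter can x) (ideal_down a).
  by move=> b xb /= ba; apply: nxa; exact: fl_up ba xb.
exists x', y; split=> //; last by apply: ay => /=.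
by apply/(cp_rel can) => b /xx'; exact: rel_disjoint.
Qed.

Lemma extend_filter_up y a : ~ Id y a ->
  exists x y', [/\ Id y `<=` Id y', R (x, y'), R (x, y) & Fl x a].
Proof.
move=> nya; have [|x [y' [ax yy' Rxy]]] :=
  cp_ext can (filter_up a) (cp_ideal can y).
  by move=> b /= ab yb; apply: nya; exact: id_down yb.
exists x, y'; split=> //; last by apply: ax => /=.
by apply/(cp_rel can) => b xb /yy'; exact: rel_disjoint xb.
Qed.

Lemma image_members a : image_rel R (C a) = ~` D a.
Proof.
apply/seteqP; split=> y; first by move=> [x xa Rxy]; exact: rel_disjoint xa.
by move=> /extend_filter_up[x [_ [_ _ Rxy xa]]]; exists x.
Qed.

Lemma box_members a : box R (~` D a) = C a.
Proof.
apply/seteqP; split=> [x xD|x xa y Rxy]; last exact: rel_disjoint xa.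
apply: contrapT => /extend_ideal_down[_ [y [_ _ Rxy ya]]].
exact: (xD y).
Qed.

Lemma members_stable a : box R (image_rel R (C a)) = C a.
Proof. by rewrite image_members box_members. Qed.

Lemma members_le a b : C a `<=` C b <-> (a <= b)%O.
Proof.
split=> [ab|ab x]; last exact: fl_up.
apply: contrapT => nab; have [|x [y [ax yb Rxy]]] :=
  cp_ext can (filter_up a) (ideal_down b).
  by move=> c /= ac cb; apply: nab; exact: le_trans ac cb.
have /ab xb : C a x by apply: ax => /=.
by apply: (rel_disjoint Rxy xb); apply: yb => /=.
Qed.

Lemma members_meet a b : C a `&` C b = C (a `&` b)%O.
Proof.
apply/seteqP; split=> x; last first.
  by move=> xab; split; apply: fl_up xab; rewrite ?leIl ?leIr.
by move=> [xa xb]; have [_ xI _] := cp_filter can x; exact: xI.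
Qed.

Lemma fiber_sub x x' : fiber R x' `<=` fiber R x <-> Fl x `<=` Fl x'.
Proof.
split=> [x'x a xa|xx' y]; last first.
  by move=> Rxy; apply/(cp_rel can) => a /xx'; exact: rel_disjoint.
apply: contrapT => /extend_ideal_down[_ [y [_ _ /x'x Rxy ya]]].
exact: rel_disjoint Rxy xa ya.
Qed.

(** Member sets are closed but not open, so the compactness of A cannot be used
    on covers by them; it is used through witnesses w on the other side, whose
    ideals are enlarged until they contain J. *)
Definition ideal_compact (A : set X) : Prop :=
  forall J : set L, lattice_ideal J ->
    (forall a, J a -> exists x w, [/\ A x, R (x, w) & Id w a]) ->
    exists x w, [/\ A x, R (x, w) & J `<=` Id w].

(** If no member set including A omits x, then each element of the ideal of y is
    avoided by a point of A; compactness yields one point of A related to y. *)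
Lemma ideal_compact_closure (A : set X) x : ideal_compact A ->
  ~ box R (image_rel R A) x -> exists2 a, A `<=` C a & ~ C a x.
Proof.
move=> Ac /existsNP[y /not_implyP[Rxy nAy]]; apply: contrapT => noa.
have [|a ya|z [w [Az Rzw yw]]] := Ac (Id y); first exact: cp_ideal can y.
  have /existsNP[z /not_implyP[Az nza]] : ~ A `<=` C a.
    by move=> Aa; apply: noa; exists a => // xa; exact: rel_disjoint Rxy xa ya.
  by have [_ [w [_ _ Rzw wa]]] := extend_ideal_down nza; exists z, w.
apply: nAy; exists z => //.
by apply/(cp_rel can) => a za /yw; exact: rel_disjoint za.
Qed.
End CanonicalPolarity.

Section StableMembers.
Variables (d : Order.disp_t) (L : tbLatticeType d) (X Y : Type).
Variables (R : set (X * Y)) (Fl : X -> set L) (Id : Y -> set L).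
Hypothesis can : canonical_polarity R Fl Id.
Let can' := canonical_polarity_dual can.

Lemma cofiber_sub y y' : cofiber R y' `<=` cofiber R y <-> Id y `<=` Id y'.
Proof. exact: (fiber_sub can'). Qed.

Lemma members_join a b :
  members Id a `&` members Id b = members Id (a `|` b)%O.
Proof. exact: (members_meet can'). Qed.

(** The elements whose member sets include A form a filter, and those whose
    member sets include the complement of the image of A form an ideal.  Were
    they disjoint, they would extend to related points x and y; compactness puts
    x in A and y outside the image of A, which is absurd.  A common element of
    the two has A as its member set. *)
Lemma stable_members (A : set X) :
  A = box R (image_rel R A) -> ideal_compact R Id A ->
  @ideal_compact _ L^d _ _ (swap_rel R) Fl (~` image_rel R A) ->
  exists a, A = members Fl a.
Proof.
move=> AE Ac Bc; set B := ~` image_rel R A in Bc.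
have [|] := pselect (exists2 a, A `<=` members Fl a & B `<=` members Id a).
  move=> [a Aa Ba]; exists a; apply/seteqP; split=> //.
  rewrite AE -(box_members can); apply: boxS => y nya.
  by apply: contrapT => /Ba.
move=> noa; exfalso.
have [|||x [y [xF yI Rxy]]] :=
  cp_ext can (F := [set a | A `<=` members Fl a])
    (I := [set a | B `<=` members Id a]).
- split=> [x _|a b Aa Ab x Ax|a b ab Aa x /Aa].
  + by have [] := cp_filter can x.
  + have [_ xI _] := cp_filter can x.
    by apply: xI; [exact: Aa|exact: Ab].
  + exact: (fl_up can).
- apply/lattice_idealP; split=> [y _|a b Ba Bb y By|a b ab Bb y /Bb].
  + by have /lattice_idealP[] := cp_ideal can y.
  + have /lattice_idealP[_ yU _] := cp_ideal can y.
    by apply: yU; [exact: Ba|exact: Bb].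
  + exact: (id_down can).
- by move=> a Aa Ba; apply: noa; exists a.
have Ax : A x.
  rewrite AE; apply: contrapT => /(ideal_compact_closure can Ac)[a Aa].
  by apply; exact: xF.
have [|b Bb] := @ideal_compact_closure _ _ _ _ _ _ _ can' B y Bc.
  move=> yB; have [z Bz Rxz] := yB x Rxy.
  by move: Ax; rewrite AE => xA; exact: Bz (xA _ Rxz).
by apply; exact: yI.
Qed.
End StableMembers.


(** * Separating a filter from an ideal by compactness *)

Lemma stable_nle (A : lattice_polarity) (U V : stable_lattice A) :
  ~ (U <= V)%O -> exists x y, [/\ plR (x, y), sval U x
    & ~ image_rel (@plR A) (sval V) y].
Proof.
move=> UV; apply: contrapT => noxy; apply: UV; apply/stable_leP => x Ux.
rewrite -(lp_stable (svalP V)) => y Rxy; apply: contrapT => Vy.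
by apply: noxy; exists x, y.
Qed.

(** A filter and an ideal are handled as one directed family, so that
    compactness can be applied in a single step. *)
Lemma realizes_pairs_directed (A : lattice_polarity) :
  (forall (I : Type) (i0 : I) (f g : I -> stable_lattice A),
     (forall i j, exists k, [/\ (f k <= f i)%O, (f k <= f j)%O,
        (g i <= g k)%O & (g j <= g k)%O]) ->
     (forall i, ~ (f i <= g i)%O) ->
     exists x y, [/\ plR (x, y), forall i, sval (f i) x
                   & forall i, ~ image_rel (@plR A) (sval (g i)) y]) ->
  realizes_pairs A.
Proof.
move=> Adir F J [F1 FI Fup] /lattice_idealP[J0 JU Jdown] FJ.
pose I := ({U | F U} * {V | J V})%type.
have [|i|x [y [Rxy xF yJ]]] := Adir I (exist _ _ F1, exist _ _ J0)
  (fun i => sval i.1) (fun i => sval i.2).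
- move=> [[U FU] [V JV]] [[U' FU'] [V' JV']].
  exists (exist _ _ (FI _ _ FU FU'), exist _ _ (JU _ _ JV JV')) => /=.
  by rewrite leIl leIr leUl leUr.
- case: i => -[U FU] [V JV] /= /Fup FV; apply: FJ JV; exact: FV.
exists x, y; split=> // [U FU|V JV].
  exact: (xF (exist _ U FU, exist _ _ J0)).
exact: (yJ (exist _ _ F1, exist _ V JV)).
Qed.

Lemma closed_preimage_fst (X Y : topologicalType) (A : set X) :
  closed A -> closed [set p : X * Y | A p.1].
Proof.
by move=> cA; apply: (@closed_comp _ _ fst) => // p _; exact: cvg_fst.
Qed.

Lemma closed_preimage_snd (X Y : topologicalType) (B : set Y) :
  closed B -> closed [set p : X * Y | B p.2].
Proof.
by move=> cB; apply: (@closed_comp _ _ snd) => // p _; exact: cvg_snd.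
Qed.

Lemma compact_rel_directed (X Y : topologicalType) (R : set (X * Y))
    (I : Type) (i0 : I) (f : I -> set X) (g : I -> set Y) :
  compact R -> (forall i, closed (f i)) -> (forall i, closed (g i)) ->
  (forall i j, exists k, f k `<=` f i `&` f j /\ g k `<=` g i `&` g j) ->
  (forall i, exists x y, [/\ R (x, y), f i x & g i y]) ->
  exists x y, [/\ R (x, y), forall i, f i x & forall i, g i y].
Proof.
move=> Rc fc gc fgdir fg.
have [|i j|i|[x y] Rxy xy] := @compact_directed _ _ _ i0
  (fun i => [set p | f i p.1] `&` [set p | g i p.2]) Rc.
- move=> i; apply: closedI; first exact: closed_preimage_fst.
  exact: closed_preimage_snd.
- have [k [fk gk]] := fgdir i j; exists k => -[x y] [/= /fk[fi fj] /gk[gi gj]].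
  by do !split.
- by have [x [y [Rxy fx gy]]] := fg i; exists (x, y).
by exists x, y; split=> // i; have [] := xy i.
Qed.

Lemma compact_realizes_pairs (X Y : topologicalType) (A : lattice_polarity)
    (R : set (X * Y)) (phiX : X -> plX A) (phiY : Y -> plY A) :
  compact R -> (forall x y, R (x, y) -> plR (phiX x, phiY y)) ->
  (forall x y, plR (x, y) -> exists x' y',
     [/\ R (x', y'), phiX x' = x & phiY y' = y]) ->
  (forall U, plL U -> closed (phiX @^-1` U)) ->
  (forall U, plL U -> closed (phiY @^-1` (~` image_rel (@plR A) U))) ->
  realizes_pairs A.
Proof.
move=> Rc Rphi phiR cX cY; apply: realizes_pairs_directed => I i0 f g dir fg.
have [i|i|i j|i|x [y [Rxy xf yg]]] := @compact_rel_directed X Y R I i0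
  (fun i => phiX @^-1` (sval (f i)))
  (fun i => phiY @^-1` (~` image_rel (@plR A) (sval (g i)))) Rc.
- exact: cX (svalP (f i)).
- exact: cY (svalP (g i)).
- have [k [/stable_leP ki /stable_leP kj /stable_leP ik /stable_leP jk]] :=
    dir i j.
  exists k; split=> z; first by move=> /= zk; split; [exact: ki|exact: kj].
  by move=> /= zk; split=> // zi; apply: zk; apply: image_relS zi.
- have [x [y [/phiR[x' [y' [Rxy <- <-]]] fx gy]]] := stable_nle (fg i).
  by exists x', y'.
by exists (phiX x), (phiY y); split=> //; exact: Rphi.
Qed.

Lemma complement_image X Y (R : set (X * Y)) (U : set X) :
  ~` image_rel R (~` U) = box (swap_rel R) U.
Proof.
apply/seteqP; split=> y yU.
  by move=> x Rxy; apply: contrapT => nUx; apply: yU; exists x.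
by move=> [x nUx Rxy]; exact: nUx (yU _ Rxy).
Qed.

Lemma complement_preimage X Y (R : set (X * Y)) (V : set Y) :
  ~` preimage_rel R (~` V) = box R V.
Proof. exact: (complement_image (swap_rel R)). Qed.

(** * Hartung spaces *)

Section HartungLattice.
Variable H : Hartung_space.
Let R := @hgR H.

Lemma hg_L_stable U : hg_L R U -> box R (image_rel R U) = U.
Proof. by move=> [<-]. Qed.

Lemma hg_L_top : hg_L R setT.
Proof.
split; first by apply/seteqP; split=> // x _ y Rxy; exists x.
  exact: closedT.
have -> : image_rel R setT = setT.
  apply/seteqP; split=> // y _.
  by have [x [Rxy _]] := hg_maxY (hgP H) y; exists x.
by rewrite setCT; exact: closed0.
Qed.

Lemma hg_L_bot : hg_L R (box R (image_rel R set0)).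
Proof.
rewrite image_rel0; have -> : box R set0 = set0.
  apply/seteqP; split=> // x x0.
  by have [y [Rxy _]] := hg_maxX (hgP H) x; exact: x0 Rxy.
split; [|exact: closed0|by rewrite image_rel0 setC0; exact: closedT].
rewrite image_rel0; apply/seteqP; split=> // x x0.
by have [y [Rxy _]] := hg_maxX (hgP H) x; exact: x0 Rxy.
Qed.

Lemma hg_L_meet U V : hg_L R U -> hg_L R V -> hg_L R (U `&` V).
Proof.
move=> [UE cU cU'] [VE cV cV']; split; last 2 first.
- exact: closedI.
- have := hg_closedY (hgP H) (closedU cU' cV').
  by rewrite -setCI complement_preimage boxI -UE -VE.
exact: stable_setI.
Qed.

Lemma hg_L_join U V : hg_L R U -> hg_L R V ->
  hg_L R (box R (image_rel R (U `|` V))).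
Proof.
move=> [UE cU cU'] [VE cV cV']; split; first by rewrite image_box_image.
  by apply: (hg_closedX (hgP H)); exact: closedU.
by rewrite image_box_image image_relU setCU; exact: closedI.
Qed.

Definition hg_lattice : lattice_polarity :=
  @LatticePolarity (hg_polarity H) hg_L_stable hg_L_top hg_L_bot
    hg_L_meet hg_L_join.

Lemma hg_realizes : realizes_pairs hg_lattice.
Proof.
apply: (@compact_realizes_pairs (hgX H) (hgY H) hg_lattice R id id) => //.
- exact: hg_compact (hgP H).
- by move=> x y Rxy; exists x, y.
- by move=> U [].
- by move=> U [].
Qed.
End HartungLattice.

Lemma compact_ideal_compact d (L : tbLatticeType d) (X Y : topologicalType)
    (R : set (X * Y)) (Id : Y -> set L) (A : set X) :
  (forall y, lattice_ideal (Id y)) -> compact R ->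
  (forall a, closed (members Id a)) -> closed A -> ideal_compact R Id A.
Proof.
move=> IdI Rc IdC cA J /lattice_idealP[J0 JU _] JA.
have [//|i|i j|i|x [w [Rxw xA wJ]]] := @compact_rel_directed X Y R {a | J a}
  (exist _ _ J0) (fun=> A) (fun i => members Id (sval i)) Rc.
- exact: IdC.
- case: i j => a Ja [b Jb]; exists (exist _ _ (JU _ _ Ja Jb)).
  split=> // y; rewrite /members /= => yab.
  have /lattice_idealP[_ _ ydown] := IdI y.
  by split; apply: ydown yab; rewrite ?leUl ?leUr.
- by case: i => a Ja; have [x [w [Ax Rxw wa]]] := JA _ Ja; exists x, w.
exists x, w; split=> // [|a Ja]; first exact: xA (exist _ _ J0).
exact: wJ (exist _ a Ja).
Qed.

Section CanonicalTopology.
Variables (d : Order.disp_t) (L : tbLatticeType d) (X Y : topologicalType).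
Variables (R : set (X * Y)) (Fl : X -> set L) (Id : Y -> set L).
Hypothesis can : canonical_polarity R Fl Id.

Definition members_subbase Z (E : Z -> set L) : set (set Z) :=
  [set ~` C | C in range (members E)].

Lemma members_closed (Z : topologicalType) (E : Z -> set L) a :
  subbase (members_subbase E) -> closed (members E a).
Proof.
move=> [Eop _]; rewrite -[members E a]setCK; apply: open_closedC; apply: Eop.
by exists (members E a) => //; exists a.
Qed.

Hypothesis subX : subbase (members_subbase Fl).
Hypothesis subY : subbase (members_subbase Id).

(** An ultrafilter on R yields the filter of those a whose member sets it
    contains on the first side and, disjoint from it, the ideal obtained
    likewise on the second side; any pair of points extending these is a
    limit. *)
Lemma canonical_compact : compact R.
Proof.
rewrite compact_ultra => U UU UR.
have UF : ProperFilter U := @ultra_proper _ _ UU.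
pose F := [set a | U [set p | Fl p.1 a]].
pose I := [set a | U [set p | Id p.2 a]].
have [||a Fa Ia|x [y [Fx Iy Rxy]]] := cp_ext can (F := F) (I := I).
- split=> [|a b Fa Fb|a b ab Fa].
  + by apply: filterS filterT => p _; have [] := cp_filter can p.1.
  + apply: filterS (filterI Fa Fb) => p [pa pb].
    by have [_ pI _] := cp_filter can p.1; exact: pI.
  + by apply: filterS Fa => p; exact: (fl_up can ab).
- apply/lattice_idealP; split=> [|a b Ia Ib|a b ab Ib].
  + apply: filterS filterT => p _.
    by have /lattice_idealP[] := cp_ideal can p.2.
  + apply: filterS (filterI Ia Ib) => p [pa pb].
    by have /lattice_idealP[_ pU _] := cp_ideal can p.2; exact: pU.
  + by apply: filterS Ib => p; exact: (id_down can ab).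
- have [[x y] [[Rxy xa] ya]] := filter_ex (filterI (filterI UR Fa) Ia).
  exact: (rel_disjoint can Rxy xa ya).
exists (x, y); split=> //.
have cvgx : fst @ U --> x.
  apply: subbase_cvg subX _ _ => _ [_ [a _ <-] <-] nxa.
  have [Ua|//] := in_ultra_setVsetC [set p | Fl p.1 a] UU.
  by exfalso; apply: nxa; exact: Fx.
have cvgy : snd @ U --> y.
  apply: subbase_cvg subY _ _ => _ [_ [a _ <-] <-] nya.
  have [Ua|//] := in_ultra_setVsetC [set p | Id p.2 a] UU.
  by exfalso; apply: nya; exact: Iy.
move=> A [[P Q] [/= xP yQ] PQA].
have UP : U (fst @^-1` P) by exact: cvgx.
have UQ : U (snd @^-1` Q) by exact: cvgy.
by apply: filterS (filterI UP UQ) => -[p q] [/= Pp Qq]; exact: PQA.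
Qed.

(** The closure of a closed set is an intersection of member sets. *)
Lemma canonical_box_image_closed (A : set X) :
  closed A -> closed (box R (image_rel R A)).
Proof.
move=> cA; have Ac : ideal_compact R Id A.
  apply: compact_ideal_compact => //; first exact: cp_ideal can.
    exact: canonical_compact.
  by move=> a; exact: members_closed.
have -> : box R (image_rel R A) =
    \bigcap_(a in [set a | A `<=` members Fl a]) members Fl a.
  apply/seteqP; split=> [x xA a /= Aa|x xA].
    rewrite -(members_stable can); move: xA; apply: boxS.
    exact: image_relS.
  by apply: contrapT => /(ideal_compact_closure can Ac)[a Aa]; apply; exact: xA.
by apply: closed_bigI => a _; exact: members_closed.
Qed.
End CanonicalTopology.

Lemma swap_rel_compact (X Y : topologicalType) (R : set (X * Y)) :
  compact R -> compact (swap_rel R).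
Proof.
move=> Rc; have -> : swap_rel R = (fun p => (p.2, p.1)) @` R.
  apply/seteqP; split=> [[y x] /= Rxy|_ [[x y] Rxy <-] //].
  by exists (x, y).
apply: continuous_compact Rc; apply: continuous_subspaceT.
exact: swap_continuous.
Qed.

Section CanonicalHartung.
Variables (d : Order.disp_t) (L : tbLatticeType d) (X Y : topologicalType).
Variables (R : set (X * Y)) (Fl : X -> set L) (Id : Y -> set L).
Hypothesis can : canonical_polarity R Fl Id.
Hypothesis subX : subbase (members_subbase Fl).
Hypothesis subY : subbase (members_subbase Id).
Let can' := canonical_polarity_dual can.
Let Rc := canonical_compact can subX subY.

Lemma canonical_hg_L A : hg_L R A <-> exists a, A = members Fl a.
Proof.
split=> [[AE cA cB]|[a ->]].
  apply: (stable_members can) => //.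
    apply: compact_ideal_compact => //; first exact: cp_ideal can.
    by move=> a; exact: members_closed.
  apply: (@compact_ideal_compact _ L^d) => //; first exact: cp_filter can.
    exact: swap_rel_compact.
  by move=> a; exact: members_closed.
rewrite /hg_L /= (members_stable can) (image_members can) setCK.
by split=> //; exact: members_closed.
Qed.

Lemma canonical_hg_closedY B :
  closed B -> closed (~` image_rel R (~` preimage_rel R B)).
Proof.
move=> cB; rewrite complement_image.
exact: (canonical_box_image_closed can').
Qed.
End CanonicalHartung.


(** * The Hartung space of a lattice *)

(** The second side of the space of L consists of the points of the order dual
    of L, filters of the dual being ideals of L. *)
Definition hartung_point d (L : tbLatticeType d) : Type :=
  {F : set L | exists I, max_pair F I}.

Definition hartung_points d (L : tbLatticeType d) : topologicalType :=
  subbase_space (members_subbase (fun x : hartung_point L => sval x)).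

Definition point_filter d (L : tbLatticeType d) (x : hartung_points L) :
  set L := sval x.

Lemma hartung_points_subbase d (L : tbLatticeType d) :
  subbase (members_subbase (@point_filter d L)).
Proof. exact: subbase_spaceP. Qed.

Section HartungOfLattice.
Variables (d : Order.disp_t) (L : tbLatticeType d).

Definition disjoint_rel X Y (Fl : X -> set L) (Id : Y -> set L) :
    set (X * Y) :=
  [set p | forall a, Fl p.1 a -> ~ Id p.2 a].

Let X := hartung_points L.
Let Y := hartung_points L^d.
Let Fl : X -> set L := @point_filter _ L.
Let Id : Y -> set L := @point_filter _ L^d.
Let R := disjoint_rel Fl Id.

Lemma point_filter_inj : injective (@point_filter _ L).
Proof. by move=> [F FP] [G GP] /= FG; exact: eq_exist. Qed.

Lemma hartung_canonical : canonical_polarity R Fl Id.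
Proof.
split=> [[F [I []]] //|[I [F []]] //|//|F I FF II FI].
have [G [J [GJ FG IJ]]] := max_pair_ext FF II FI.
exists (exist _ G (ex_intro _ J GJ)).
exists (exist _ J (ex_intro _ G ((max_pair_dual G J).2 GJ))).
by split=> //; exact: mp_disjoint GJ.
Qed.

Lemma hartung_leX x x' : hg_leX R x x' <-> Fl x `<=` Fl x'.
Proof. exact: (fiber_sub hartung_canonical). Qed.

Lemma hartung_leY y y' : hg_leY R y y' <-> Id y `<=` Id y'.
Proof. exact: (cofiber_sub hartung_canonical). Qed.

Lemma hartung_maxX x : exists y, hg_maximalX R x y.
Proof.
case: x => F [I FI].
exists (exist _ I (ex_intro _ F ((max_pair_dual F I).2 FI))).
split=> [|x' /hartung_leX Fx' x'I]; first exact: mp_disjoint FI.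
apply: point_filter_inj; apply/seteqP; split=> //.
by apply: (mp_maxF FI) => //; exact: (cp_filter hartung_canonical).
Qed.
End HartungOfLattice.

Section HartungSpaceOfLattice.
Variable L : tbLatticeType dual_space_display.

Let X := hartung_points L.
Let Y := hartung_points L^d.
Let Fl : X -> set L := @point_filter _ L.
Let Id : Y -> set L := @point_filter _ L^d.
Let R := disjoint_rel Fl Id.
Let can : canonical_polarity R Fl Id := hartung_canonical L.
Let subX := @hartung_points_subbase _ L.
Let subY := @hartung_points_subbase _ L^d.

Lemma hartung_maxY (y : Y) : exists x : X, hg_maximalY R y x.
Proof.
case: y => I [F IF]; have FI := (@max_pair_dual _ L F I).1 IF.
exists (exist _ F (ex_intro _ I FI)).
split=> [|y' /hartung_leY Iy' Fy']; first exact: mp_disjoint FI.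
apply: point_filter_inj; apply/seteqP; split=> //.
by apply: (mp_maxI FI) => //; exact: (cp_ideal can).
Qed.

Lemma hartung_space : is_Hartung_space R.
Proof.
split.
- split=> [x y //|x y z xy yz u /yz /xy //|x y].
  move=> /hartung_leX xy /hartung_leX yx.
  by apply: point_filter_inj; exact/seteqP.
- split=> [x y //|x y z xy yz u /yz /xy //|x y].
  move=> /hartung_leY xy /hartung_leY yx.
  by apply: point_filter_inj; exact/seteqP.
- exact: canonical_compact can subX subY.
- have -> : hg_L R = range (members Fl).
    apply/seteqP; split=> A; rewrite (canonical_hg_L can subX subY).
      by move=> [a ->]; exists a.
    by move=> [a _ <-]; exists a.
  exact: subbase_closed_subbasis.
- have -> : [set ~` image_rel R A | A in hg_L R] = range (members Id).
    apply/seteqP; split=> B.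
      move=> [A + <-]; rewrite (canonical_hg_L can subX subY) => -[a ->].
      by exists a; rewrite // (image_members can) setCK.
    move=> [a _ <-]; exists (members Fl a).
      by apply/(canonical_hg_L can subX subY); exists a.
    by rewrite (image_members can) setCK.
  exact: subbase_closed_subbasis.
- by move=> A; exact: (canonical_box_image_closed can subX subY).
- by move=> B; exact: (canonical_hg_closedY can subX subY).
- exact: hartung_maxX.
- exact: hartung_maxY.
- move=> x y /existsNP[a /not_implyP[xa /contrapT ya]].
  exists (members Fl a); split=> //.
    by apply/(canonical_hg_L can subX subY); exists a.
  by rewrite (image_members can); exact.
Qed.
End HartungSpaceOfLattice.

Lemma hartung_essentially_surjective :
  essentially_surjective (stable_functor hg_lattice).
Proof.
move=> L; pose H := HartungSpace (hartung_space L); exists H.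
have can := hartung_canonical (L : tbLatticeType _).
apply: (@stable_lattice_iso _ hg_lattice L H
          (members (@point_filter _ L))) => [U|a b].
  exact: (canonical_hg_L can (@hartung_points_subbase _ _)
            (@hartung_points_subbase _ _)).
exact: (members_le can).
Qed.


(** * Urquhart spaces as polarities *)

Section UrquhartRelation.
Variables (Z : topologicalType) (le1 le2 : Z -> Z -> Prop).

(** With this relation, phi is the complement of the image and psi the box of
    the complement, so that the stable sets of an Urquhart space are those of
    a polarity. *)
Definition urq_rel : set (Z * Z) := [set p | exists v, le1 p.1 v /\ le2 p.2 v].

Hypothesis le1P : Relation_Definitions.preorder Z le1.
Hypothesis le2P : Relation_Definitions.preorder Z le2.
Let refl1 := Relation_Definitions.preord_refl _ _ le1P.
Let refl2 := Relation_Definitions.preord_refl _ _ le2P.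
Let trans1 := Relation_Definitions.preord_trans _ _ le1P.
Let trans2 := Relation_Definitions.preord_trans _ _ le2P.

Lemma urq_rel_refl z : urq_rel (z, z).
Proof. by exists z; split; [exact: refl1|exact: refl2]. Qed.

Lemma urq_phiE C : upset le1 C -> urq_phi le2 C = ~` image_rel urq_rel C.
Proof.
move=> upC; congr (~` _); apply/seteqP; split=> w.
  by move=> [z Cz wz]; exists z => //; exists z; split; [exact: refl1|].
by move=> [z Cz [v [zv wv]]]; exists v => //; exact: upC zv Cz.
Qed.

Lemma urq_psiE B : upset le2 B -> urq_psi le1 B = box urq_rel (~` B).
Proof.
move=> upB; apply/seteqP; split=> z zB.
  by move=> w [v [zv wv]] Bw; apply: zB; exists v => //; exact: upB wv Bw.
move=> [w Bw zw]; apply: (zB w) Bw; exists w; split=> //; exact: refl2.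
Qed.

Lemma urq_phi_upset C : upset le2 (urq_phi le2 C).
Proof.
by move=> x y xy Cx [z Cz yz]; apply: Cx; exists z => //; exact: trans2 xy yz.
Qed.

Lemma urq_psiphiE C : upset le1 C ->
  urq_psi le1 (urq_phi le2 C) = box urq_rel (image_rel urq_rel C).
Proof.
move=> upC; rewrite urq_psiE; last exact: urq_phi_upset.
by rewrite urq_phiE // setCK.
Qed.

Lemma box_urq_rel_upset V : upset le1 (box urq_rel V).
Proof.
move=> x y xy xV w [v [yv wv]]; apply: xV; exists v; split=> //.
exact: trans1 xy yv.
Qed.
End UrquhartRelation.

Section UrquhartLattice.
Variable U : Urquhart_space.
Let Z := urqZ U.
Let le1 := @urqle1 U.
Let le2 := @urqle2 U.
Let R : set (Z * Z) := urq_rel le1 le2.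
Let P1 := urq_preorder1 (urqP U).
Let P2 := urq_preorder2 (urqP U).

Let phiE C : upset le1 C -> urq_phi le2 C = ~` image_rel R C.
Proof. exact: urq_phiE. Qed.

Let psiphiE C : upset le1 C ->
  urq_psi le1 (urq_phi le2 C) = box R (image_rel R C).
Proof. exact: urq_psiphiE. Qed.

Lemma LU_relP C : LU C <->
  [/\ upset le1 C, C = box R (image_rel R C), closed C
    & closed (~` image_rel R C)].
Proof.
split=> -[upC CE cC cD]; split=> //.
- by rewrite -psiphiE.
- by rewrite -phiE.
- by rewrite psiphiE.
- by rewrite phiE.
Qed.

Lemma urq_downY C : LU C -> downset le2 (image_rel R C).
Proof.
move=> _ x y xy [z Cz [v [zv yv]]]; exists z => //; exists v; split=> //.
exact: (Relation_Definitions.preord_trans _ _ P2) xy yv.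
Qed.

Lemma urq_sepY z z' : ~ le2 z z' ->
  exists C, [/\ LU C, ~ image_rel R C z & image_rel R C z'].
Proof.
move=> /(urq_sep2 (urqP U))[C [LC]]; have [upC _ _ _] := LC.
by rewrite phiE // => Cz /contrapT Cz'; exists C.
Qed.

Definition urq_polarity : polarity :=
  @Polarity Z Z R (@LU U) le1 le2
    (Relation_Definitions.preord_refl _ _ P1)
    (Relation_Definitions.preord_refl _ _ P2)
    (@LU_upset U) urq_downY (urq_sep1 (urqP U)) urq_sepY.

Lemma urq_stable C : LU C -> box R (image_rel R C) = C.
Proof. by move=> /LU_relP[_ <-]. Qed.

Lemma urq_rel_total z : R (z, z).
Proof. exact: urq_rel_refl. Qed.

Lemma urq_top : @LU U setT.
Proof.
apply/LU_relP; have RT : image_rel R setT = setT.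
  by apply/seteqP; split=> // z _; exists z => //; exact: urq_rel_total.
split=> [//|||]; first by rewrite RT boxT.
  exact: closedT.
by rewrite RT setCT; exact: closed0.
Qed.

Lemma urq_bot : @LU U (box R (image_rel R set0)).
Proof.
have R0 : box R set0 = set0.
  by apply/seteqP; split=> // z /(_ _ (urq_rel_total z)).
rewrite image_rel0 R0; apply/LU_relP.
rewrite image_rel0 R0 setC0; split=> [//|//||]; [exact: closed0|exact: closedT].
Qed.

Lemma urq_meet C D : @LU U C -> @LU U D -> @LU U (C `&` D).
Proof.
move=> LC LD; have := urq_phi_closed (urqP U) LC LD.
have /LU_relP[upC CE cC _] := LC; have /LU_relP[upD DE cD _] := LD.
have up : upset le1 (C `&` D).
  by move=> x y xy [Cx Dx]; split; [exact: upC xy Cx|exact: upD xy Dx].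
rewrite phiE // => cphi; apply/LU_relP; split=> //.
  exact: stable_setI.
exact: closedI.
Qed.

Lemma urq_join C D : @LU U C -> @LU U D ->
  @LU U (box R (image_rel R (C `|` D))).
Proof.
move=> LC LD; have := urq_psi_closed (urqP U) LC LD.
have /LU_relP[upC CE cC cC'] := LC; have /LU_relP[upD DE cD cD'] := LD.
have up2 : upset le2 (urq_phi le2 C `&` urq_phi le2 D).
  move=> x y xy [Cx Dx].
  by split; [exact: (urq_phi_upset P2) xy Cx|exact: (urq_phi_upset P2) xy Dx].
rewrite -/le1 -/le2 (@urq_psiE _ le1 le2 P2 _ up2) !phiE // setCI !setCK.
move=> cpsi; apply/LU_relP; split.
- exact: box_urq_rel_upset.
- by rewrite image_box_image.
- by rewrite image_relU.
- by rewrite image_box_image image_relU setCU; exact: closedI.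
Qed.

Definition urq_lattice : lattice_polarity :=
  @LatticePolarity urq_polarity urq_stable urq_top urq_bot urq_meet urq_join.

(** A point above both members of a related pair lies in the same upsets, so
    compactness of the space itself suffices. *)
Lemma urq_realizes : realizes_pairs urq_lattice.
Proof.
apply: realizes_pairs_directed => I i0 f g dir fg.
have [i|i j|i|v _ vfg] := @compact_directed Z setT I i0
  (fun i => sval (f i) `&` ~` image_rel R (sval (g i))) (urq_compact (urqP U)).
- have /LU_relP[_ _ cf _] := svalP (f i).
  by have /LU_relP[_ _ _ cg] := svalP (g i); exact: closedI.
- have [k [/stable_leP ki /stable_leP kj /stable_leP ik /stable_leP jk]] :=
    dir i j.
  exists k => v [vk nvk]; split; split; [exact: ki| |exact: kj|] => vg.
    by apply: nvk; exact: image_relS vg.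
  by apply: nvk; exact: image_relS vg.
- have [x [y [[v [xv yv]] xf yg]]] := stable_nle (fg i).
  exists v => //; split; first exact: LU_upset (svalP (f i)) _ _ xv xf.
  by move=> vg; apply: yg; exact: urq_downY (svalP (g i)) _ _ yv vg.
exists v, v; split=> [|i|i]; first exact: urq_rel_total.
  by have [] := vfg i.
by have [] := vfg i.
Qed.
End UrquhartLattice.

Lemma box_setC X Y (Q : set (X * Y)) (V : set Y) :
  box Q (~` V) = ~` preimage_rel Q V.
Proof. by rewrite -complement_preimage setCK. Qed.

(** The two forms of the last condition on morphisms agree because, by the
    separation conditions, P and Q are closed under the quasi-orders on both
    sides. *)
Lemma urquhart_rel_morphism (U V : Urquhart_space)
    (P Q : set (urqZ U * urqZ V)) :
  is_Urquhart_morphism P Q <->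
  is_rel_morphism (@plR (urq_polarity U)) (@LU U)
    (@plR (urq_polarity V)) (@LU V) P Q.
Proof.
have phiE W (C : set (urqZ W)) : LU C ->
    phi C = ~` image_rel (@plR (urq_polarity W)) C.
  move=> LC; apply: urq_phiE; first exact: urq_preorder1 (urqP W).
  exact: LU_upset.
split=> -[b sP sQ t].
- have PQE C' : LU C' -> image_rel (@plR (urq_polarity U)) (box P C') =
      preimage_rel Q (image_rel (@plR (urq_polarity V)) C').
    move=> LC; have [LP] := b _ LC.
    by rewrite !phiE // box_setC => /(congr1 setC); rewrite !setCK.
  split=> // [C' LC|z z'|z w [v [zv wv]]].
  + by split; [have [] := b _ LC|exact: PQE].
  + move=> /sQ[C' [LC]]; rewrite phiE // box_setC => zC /contrapT z'C.
    by exists C'.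
  + have [v' [Pvv' Qvv']] := t v; exists v', v'; split.
    * apply: contrapT => /sP[C' [LC zC v'C]]; apply: v'C.
      have [LP _] := b _ LC.
      by have := LU_upset LP zv zC; apply.
    * apply: contrapT => /sQ[C' [LC]]; rewrite phiE // box_setC -PQE //.
      move=> wC /contrapT v'C; apply: wC.
      have [LP _] := b _ LC; apply: (urq_downY LP wv).
      by rewrite PQE //; exists v'.
    * exact: urq_rel_total.
- split=> [C' LC|//|z z'|z].
  + have [LP PE] := b _ LC; split=> //.
    by rewrite !phiE // box_setC PE.
  + move=> /sQ[C' [LC zC z'C]]; exists C'; split=> //.
      by rewrite phiE // box_setC.
    by rewrite phiE //; exact.
  + have [x' [y' [Pzx' Qzy' [v [x'v y'v]]]]] := t z z (urq_rel_total z).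
    exists v; split.
      apply: contrapT => /sP[C' [LC zC vC]]; apply: vC.
      exact: LU_upset LC _ _ x'v (zC _ Pzx').
    apply: contrapT => /sQ[C' [LC zC vC]]; apply: zC.
    by exists y' => //; exact: urq_downY LC _ _ y'v vC.
Qed.

Definition urq_rel_category : category :=
  rel_category (fun U => lp_pl (urq_lattice U)).

Definition urq_map (U V : Urquhart_space) (f : Urq_hom U V) :
    @hom urq_rel_category U V :=
  exist _ (sval f) ((urquhart_rel_morphism _ _).1 (svalP f)).

Lemma urq_map_id U : urq_map (Urq_id U) = idm (U : urq_rel_category).
Proof. exact: eq_exist. Qed.

Lemma urq_map_comp U V W (g : Urq_hom V W) (f : Urq_hom U V) :
  urq_map (Urq_comp g f) = @comp urq_rel_category U V W (urq_map g) (urq_map f).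
Proof.
apply: eq_exist; congr (_, _) => /=.
have phiE (C : set (urqZ W)) : LU C ->
    phi C = ~` image_rel (@plR (urq_polarity W)) C.
  move=> LC; apply: urq_phiE; first exact: urq_preorder1 (urqP W).
  exact: LU_upset.
apply/seteqP; split=> -[y w] yw.
  move=> C LC Cw; apply: contrapT => yC.
  have := yw (phi C); rewrite phiE // !box_setC /=; apply=> //.
  by exists C; rewrite // phiE.
move=> _ [C LC <-]; rewrite phiE // !box_setC /= => yC Cw.
exact: yC (yw C LC Cw).
Qed.

Definition urq_functor : functor Urq urq_rel_category :=
  @Functor Urq urq_rel_category id urq_map urq_map_id urq_map_comp.

Lemma urq_functor_ff : fully_faithful urq_functor.
Proof.
move=> U V; split=> [[f fP] [g gP] /(congr1 sval) /= fg|[[P Q] PQ]].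
  exact: eq_exist.
exists (exist _ (P, Q) ((urquhart_rel_morphism P Q).2 PQ)); exact: eq_exist.
Qed.


(** * The Urquhart space of a lattice *)

Lemma closed_extends_ideal d (L : tbLatticeType d) (Z : topologicalType)
    (E : Z -> set L) (A : set Z) (J : set L) :
  compact [set: Z] -> closed A -> (forall a, closed (members E a)) ->
  (forall z, lattice_ideal (E z)) -> lattice_ideal J ->
  (forall a, J a -> exists2 z, A z & E z a) -> exists2 z, A z & J `<=` E z.
Proof.
move=> Zc cA cE EI /lattice_idealP[J0 JU _] JA.
have [i|i j|i|z _ zJ] := @compact_directed Z setT {a | J a} (exist _ _ J0)
  (fun i => A `&` members E (sval i)) Zc.
- by apply: closedI.
- case: i j => a Ja [b Jb]; exists (exist _ _ (JU _ _ Ja Jb)).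
  move=> z [Az]; rewrite /members /= => zab.
  have /lattice_idealP[_ _ zdown] := EI z.
  by split; (split=> //=); apply: zdown zab; rewrite ?leUl ?leUr.
- by case: i => a Ja; have [z Az za] := JA a Ja; exists z.
exists z; first by have [] := zJ (exist _ _ J0).
by move=> a Ja; have [] := zJ (exist _ a Ja).
Qed.

Definition pair_point d (L : tbLatticeType d) : Type :=
  {p : set L * set L | max_pair p.1 p.2}.

Definition pair_points d (L : tbLatticeType d) : topologicalType :=
  subbase_space (members_subbase (fun z : pair_point L => (sval z).1)
                 `|` members_subbase (fun z : pair_point L => (sval z).2)).

Section UrquhartOfLattice.
Variables (d : Order.disp_t) (L : tbLatticeType d).
Let Z := pair_points L.

Definition pair_filter (z : Z) : set L := (sval z).1.
Definition pair_ideal (z : Z) : set L := (sval z).2.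
Definition pair_le1 (x y : Z) : Prop := pair_filter x `<=` pair_filter y.
Definition pair_le2 (x y : Z) : Prop := pair_ideal x `<=` pair_ideal y.

Let Fl := pair_filter.
Let Id := pair_ideal.
Let R : set (Z * Z) := urq_rel pair_le1 pair_le2.

Lemma pair_pointP z : max_pair (Fl z) (Id z).
Proof. exact: svalP z. Qed.

Lemma pair_le1P : Relation_Definitions.preorder Z pair_le1.
Proof. by split=> [x a //|x y z xy yz a /xy /yz]. Qed.

Lemma pair_le2P : Relation_Definitions.preorder Z pair_le2.
Proof. by split=> [x a //|x y z xy yz a /xy /yz]. Qed.

Lemma pair_points_subbase :
  subbase (members_subbase Fl `|` members_subbase Id).
Proof. exact: subbase_spaceP. Qed.

Lemma pair_filter_closed a : closed (members Fl a).
Proof.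
rewrite -[members Fl a]setCK; apply: open_closedC.
apply: (pair_points_subbase).1; left.
by exists (members Fl a) => //; exists a.
Qed.

Lemma pair_ideal_closed a : closed (members Id a).
Proof.
rewrite -[members Id a]setCK; apply: open_closedC.
apply: (pair_points_subbase).1; right.
by exists (members Id a) => //; exists a.
Qed.

Lemma pair_ext F I : lattice_filter F -> lattice_ideal I ->
  (forall a, F a -> ~ I a) -> exists z, F `<=` Fl z /\ I `<=` Id z.
Proof.
move=> FF II FI; have [G [J [GJ FG IJ]]] := max_pair_ext FF II FI.
by exists (exist _ (G, J) GJ : Z).
Qed.

Lemma pair_canonical : canonical_polarity R Fl Id.
Proof.
split=> [z|z|x y|F I FF II FI].
- exact: mp_filter (pair_pointP z).
- exact: mp_ideal (pair_pointP z).
- split=> [[v [xv yv]] a /xv va /yv|xy].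
    exact: mp_disjoint (pair_pointP v) a va.
  have [] := pair_ext (mp_filter (pair_pointP x)) (mp_ideal (pair_pointP y)) xy.
  by move=> v [xv yv]; exists v.
- have [z [Fz Iz]] := pair_ext FF II FI; exists z, z; split=> //.
  exact: urq_rel_refl pair_le1P pair_le2P z.
Qed.

Lemma pair_points_compact : compact [set: Z].
Proof.
rewrite compact_ultra => U UU _.
have UF : ProperFilter U := @ultra_proper _ _ UU.
pose F := [set a | U (members Fl a)]; pose I := [set a | U (members Id a)].
have FlF z := mp_filter (pair_pointP z); have IdI z := mp_ideal (pair_pointP z).
have [||a Fa Ia|z [Fz Iz]] := @pair_ext F I.
- split=> [|a b Fa Fb|a b ab Fa].
  + by apply: filterS filterT => z _; have [] := FlF z.
  + apply: filterS (filterI Fa Fb) => z [za zb].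
    by have [_ zI _] := FlF z; exact: zI.
  + by apply: filterS Fa => z; exact: (fl_up pair_canonical ab).
- apply/lattice_idealP; split=> [|a b Ia Ib|a b ab Ib].
  + by apply: filterS filterT => z _; have /lattice_idealP[] := IdI z.
  + apply: filterS (filterI Ia Ib) => z [za zb].
    by have /lattice_idealP[_ zU _] := IdI z; exact: zU.
  + by apply: filterS Ib => z; exact: (id_down pair_canonical ab).
- have [z [za]] := filter_ex (filterI Fa Ia).
  exact: mp_disjoint (pair_pointP z) a za.
exists z; split=> //; apply: subbase_cvg pair_points_subbase _ _.
move=> _ [[_ [a _ <-] <-] nza|[_ [a _ <-] <-] nza].
  have [Ua|//] := in_ultra_setVsetC (members Fl a) UU.
  by exfalso; apply: nza; exact: Fz.
have [Ua|//] := in_ultra_setVsetC (members Id a) UU.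
by exfalso; apply: nza; exact: Iz.
Qed.

Lemma pair_urq_phi a : urq_phi pair_le2 (members Fl a) = members Id a.
Proof.
rewrite (@urq_phiE _ pair_le1) ?(image_members pair_canonical) ?setCK //.
  exact: pair_le1P.
by move=> x y xy; exact: xy.
Qed.

Lemma pair_urq_psi a : urq_psi pair_le1 (members Id a) = members Fl a.
Proof.
rewrite (@urq_psiE _ _ pair_le2) ?(box_members pair_canonical) //.
  exact: pair_le2P.
by move=> x y xy; exact: xy.
Qed.

Lemma pair_urq_L A :
  urq_L pair_le1 pair_le2 A <-> exists a, A = members Fl a.
Proof.
split=> [[upA AE cA cB]|[a ->]]; last first.
  split; last 2 first.
  - exact: pair_filter_closed.
  - by rewrite pair_urq_phi; exact: pair_ideal_closed.
  - by move=> x y xy; exact: xy.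
  - by rewrite pair_urq_phi pair_urq_psi.
have phiA : urq_phi pair_le2 A = ~` image_rel R A.
  exact: urq_phiE pair_le1P _ upA.
apply: (stable_members pair_canonical).
- by rewrite {1}AE; apply: urq_psiphiE upA; [exact: pair_le1P|exact: pair_le2P].
- move=> J JI JA.
  have [|//|a /JA[x [w [Ax [v [xv wv]] wa]]]|z Az Jz] :=
    closed_extends_ideal (J := J) pair_points_compact cA pair_ideal_closed.
  + by move=> z; exact: mp_ideal (pair_pointP z).
  + by exists v; [exact: upA xv Ax|exact: wv].
  exists z, z; split=> //; exact: urq_rel_refl pair_le1P pair_le2P z.
- rewrite -phiA => F FF FB.
  have [|//|a /FB[y [x [By [v [xv yv]] xa]]]|z Bz Fz] :=
    @closed_extends_ideal _ L^d _ Fl _ F pair_points_compact cB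
      pair_filter_closed.
  + by move=> z; exact: mp_filter (pair_pointP z).
  + exists v; last exact: xv.
    by apply: (urq_phi_upset pair_le2P) yv _.
  exists z, z; split=> //; exact: urq_rel_refl pair_le1P pair_le2P z.
Qed.

Lemma urquhart_space : is_Urquhart_space pair_le1 pair_le2.
Proof.
split.
- exact: pair_le1P.
- exact: pair_le2P.
- exact: pair_points_compact.
- move=> [[F I] /= FI] [[G J] /= GJ] /= FG IJ; apply: eq_exist.
  rewrite /pair_le1 /pair_le2 /pair_filter /pair_ideal /= in FG IJ.
  congr (_, _); apply/seteqP; split=> //.
    apply: (mp_maxF FI) FG _; first exact: mp_filter GJ.
    by move=> a Ga /IJ; exact: mp_disjoint GJ a Ga.
  apply: (mp_maxI FI) IJ _; first exact: mp_ideal GJ.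
  by move=> a /FG Ga; exact: mp_disjoint GJ a Ga.
- have -> : urq_L pair_le1 pair_le2 `|`
      [set urq_phi pair_le2 C | C in urq_L pair_le1 pair_le2] =
      range (members Fl) `|` range (members Id).
    apply/seteqP; split=> A.
      move=> [/pair_urq_L[a ->]|[_ /pair_urq_L[a ->] <-]].
        by left; exists a.
      by right; exists a; rewrite // pair_urq_phi.
    move=> [[a _ <-]|[a _ <-]]; first by left; apply/pair_urq_L; exists a.
    right; exists (members Fl a); last exact: pair_urq_phi.
    by apply/pair_urq_L; exists a.
  apply: subbase_closed_subbasis; rewrite image_setU.
  exact: pair_points_subbase.
- move=> C1 C2 /pair_urq_L[a ->] /pair_urq_L[b ->].
  rewrite (members_meet pair_canonical) pair_urq_phi.
  exact: pair_ideal_closed.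
- move=> C1 C2 /pair_urq_L[a ->] /pair_urq_L[b ->].
  rewrite !pair_urq_phi (members_join pair_canonical) pair_urq_psi.
  exact: pair_filter_closed.
- move=> x y /existsNP[a /not_implyP[xa ya]]; exists (members Fl a).
  by split=> //; apply/pair_urq_L; exists a.
- move=> x y /existsNP[a /not_implyP[xa ya]]; exists (members Fl a).
  by rewrite pair_urq_phi; split=> //; apply/pair_urq_L; exists a.
Qed.
End UrquhartOfLattice.

Lemma urquhart_essentially_surjective :
  essentially_surjective (stable_functor urq_lattice).
Proof.
move=> L; pose U := UrquhartSpace (urquhart_space (L : tbLatticeType _)).
exists U; apply: (@stable_lattice_iso _ urq_lattice L U
  (members (@pair_filter _ L))) => [A|a b]; first exact: pair_urq_L.
exact: members_le (pair_canonical L) a b.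
Qed.


(** * GvG-spaces *)

Section GvGLattice.
Variable G : GvG_space.
Let X := gvgX G.
Let Y := gvgY G.
Let R : set (X * Y) := @gvgR G.

Lemma gvg_L_stable U : gvg_L R U -> box R (image_rel R U) = U.
Proof. by move=> [_ <-]. Qed.

Lemma gvg_L_top : gvg_L R setT.
Proof.
split; last by apply/seteqP; split=> // x _ y Rxy; exists x.
by split=> //; split; [exact: openT|exact: closedT].
Qed.

Lemma gvg_L_closure U : clopen_upset U -> gvg_L R (box R (image_rel R U)).
Proof.
move=> cU; split; last by rewrite image_box_image.
exact/(gvg_box (gvgP G))/(gvg_image (gvgP G)).
Qed.

Lemma gvg_L_bot : gvg_L R (box R (image_rel R set0)).
Proof.
by apply: gvg_L_closure; split=> //; split; [exact: open0|exact: closed0].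
Qed.

Lemma gvg_L_meet U V : gvg_L R U -> gvg_L R V -> gvg_L R (U `&` V).
Proof.
move=> [[[oU cU] upU] UE] [[[oV cV] upV] VE]; split; last exact: stable_setI.
split; first by split; [exact: openI|exact: closedI].
by move=> x y xy [Ux Vx]; split; [exact: upU xy Ux|exact: upV xy Vx].
Qed.

Lemma gvg_L_join U V : gvg_L R U -> gvg_L R V ->
  gvg_L R (box R (image_rel R (U `|` V))).
Proof.
move=> [[[oU cU] upU] _] [[[oV cV] upV] _]; apply: gvg_L_closure.
split; first by split; [exact: openU|exact: closedU].
by move=> x y xy [Ux|Vx]; [left; exact: upU xy Ux|right; exact: upV xy Vx].
Qed.

Definition gvg_lattice : lattice_polarity :=
  @LatticePolarity (gvg_polarity G) gvg_L_stable gvg_L_top gvg_L_bot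
    gvg_L_meet gvg_L_join.

(** R is closed, being cut out by the clopen conditions that the separation
    axiom provides. *)
Lemma gvg_rel_compact : compact R.
Proof.
have [cX _] := gvg_priestleyX (gvgP G); have [cY _] := gvg_priestleyY (gvgP G).
have cXY := compact_setX cX cY; apply: subclosed_compact cXY _ => //.
have -> : R = \bigcap_(U in gvg_L R)
    ([set p | (~` U) p.1] `|` [set p | image_rel R U p.2]).
  apply/seteqP; split=> [[x y] Rxy U LU|[x y] Rxy].
    by have [Ux|nUx] := pselect (U x); [right; exists x|left].
  apply: contrapT => /(gvg_sep (gvgP G))[U [cU UE Ux Uy]].
  by have [|//|] := Rxy U; first by split.
apply: closed_bigI => U [cU _]; have [[_ cR] _] := gvg_image (gvgP G) cU.
have [[oU _] _] := cU; apply: closedU; last exact: closed_preimage_snd.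
by apply: closed_preimage_fst; exact: open_closedC.
Qed.

Lemma gvg_realizes : realizes_pairs gvg_lattice.
Proof.
apply: (@compact_realizes_pairs X Y gvg_lattice R id id) => //.
- exact: gvg_rel_compact.
- by move=> x y Rxy; exists x, y.
- by move=> U [[[]]].
- move=> U [cU _]; have [[oR _] _] := gvg_image (gvgP G) cU.
  exact: open_closedC.
Qed.
End GvGLattice.

(** * Admissible joins *)

Section AdmissibleJoins.
Variables (d : Order.disp_t) (L : tbLatticeType d).
Implicit Types (s : seq L) (a b : L).

Definition joins s : L := foldr Order.join \bot%O s.

Lemma joins_sup s a : a \in s -> (a <= joins s)%O.
Proof.
elim: s => //= b s IHs; rewrite inE => /orP[/eqP ->|/IHs]; first exact: leUl.
by move=> /le_trans; apply; exact: leUr.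
Qed.

Lemma joins_ideal (I : set L) s : lattice_ideal I ->
  I (joins s) <-> (forall a, a \in s -> I a).
Proof.
move=> /lattice_idealP[I0 IU Id]; split=> [Is a /joins_sup /Id|]; first exact.
elim: s => //= a s IHs Is; apply: IU; first by apply: Is; rewrite inE eqxx.
by apply: IHs => b bs; apply: Is; rewrite inE bs orbT.
Qed.

(** These are the finite joins that the distributive envelope of L preserves, so
    the filters that are prime for them correspond to its prime filters. *)
Definition join_admissible s : Prop :=
  forall b, (b `&` joins s <= joins [seq (b `&` a)%O | a <- s])%O.

(** If no member of s were in F, then by maximality each would have a meet with
    some element of F in I; for one f in F serving all of them, f meets the join
    of s in I. *)
Lemma max_pair_prime F I s : max_pair F I -> join_admissible s ->
  F (joins s) -> exists2 a, a \in s & F a.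
Proof.
move=> FI sadm Fs; apply: contrapT => nFs.
have [F1 FM Fup] := mp_filter FI.
have Fmeet a : a \in s -> exists2 f, F f & I (f `&` a)%O.
  move=> sa; apply: contrapT => nf.
  have Fa : F a.
    apply: (mp_maxF FI (filter_sup a (mp_filter FI))).
    - by move=> b Fb; exists b => //; exact: leIl.
    - move=> b [f Ff fab] Ib; apply: nf; exists f => //.
      by have /lattice_idealP[_ _ Id] := mp_ideal FI; exact: Id fab Ib.
    - by exists \top%O => //; exact: leIr.
  by apply: nFs; exists a.
have [f Ff If] : exists2 f, F f & forall a, a \in s -> I (f `&` a)%O.
  have /lattice_idealP[_ _ Id] := mp_ideal FI.
  elim: (s) Fmeet => [|a r IHr] rI; first by exists \top%O.
  have [f Ff fI] := IHr (fun b br => rI b (mem_behead (s := a :: r) br)).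
  have [g Fg gI] := rI a (mem_head a r).
  exists (f `&` g)%O; first exact: FM.
  move=> b; rewrite inE => /orP[/eqP ->|/fI fb].
    by apply: Id gI; rewrite leI2 // leIr.
  by apply: Id fb; rewrite leI2 // leIl.
apply: (mp_disjoint FI) (FM _ _ Ff Fs) _.
have /lattice_idealP[_ _ Id] := mp_ideal FI.
apply: Id (sadm f) _; apply/joins_ideal; first exact: mp_ideal FI.
by move=> _ /mapP[a sa ->]; exact: If.
Qed.

Lemma max_pair_admissible s :
  (forall F I, max_pair F I -> F (joins s) -> exists2 a, a \in s & F a) ->
  join_admissible s.
Proof.
move=> sprime b; apply: contrapT => nb.
have [|F [I [FI bF sI]]] := max_pair_ext (filter_up (b `&` joins s)%O)
  (ideal_down (joins [seq (b `&` a)%O | a <- s])).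
  by move=> c /= bc cb; apply: nb; exact: le_trans bc cb.
have [_ FM Fup] := mp_filter FI.
have Fbs : F (b `&` joins s)%O by apply: bF => /=.
have [a sa Fa] := sprime F I FI (Fup _ _ (leIr _ _) Fbs).
apply: (mp_disjoint FI) (FM _ _ (Fup _ _ (leIl _ _) Fbs) Fa) _.
by apply: sI; apply: joins_sup; exact: map_f.
Qed.
End AdmissibleJoins.

Lemma image_some_member d (L : tbLatticeType d) X Y (R : set (X * Y))
    (Fl : X -> set L) (Id : Y -> set L) (s : seq L) :
  canonical_polarity R Fl Id ->
  image_rel R [set x | exists2 a, a \in s & Fl x a] =
  ~` members Id (joins s).
Proof.
move=> can; apply/seteqP; split=> y.
  move=> [x [a sa xa] Rxy] /(joins_ideal _ (cp_ideal can y)) ys.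
  exact: (rel_disjoint can Rxy xa) (ys _ sa).
rewrite /setC /= => nys; apply: contrapT => ny; apply: nys.
apply/(joins_ideal _ (cp_ideal can y)) => a sa; apply: contrapT => nya.
have [x [_ [_ _ Rxy xa]]] := extend_filter_up can nya.
by apply: ny; exists x => //; exists a.
Qed.

(** * The GvG-space of a lattice *)

Definition gvg_point d (L : tbLatticeType d) : Type :=
  {F : set L | lattice_filter F /\
    forall s, join_admissible s -> F (joins s) -> exists2 a, a \in s & F a}.

Definition gvg_points d (L : tbLatticeType d) : Type :=
  subbase_space (range (members (fun x : gvg_point L => sval x))
                 `|` members_subbase (fun x : gvg_point L => sval x)).

HB.instance Definition _ d (L : tbLatticeType d) :=
  Topological.on (gvg_points L).

Section GvGPoints.
Variables (d : Order.disp_t) (L : tbLatticeType d).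

Definition gvg_filter (x : gvg_points L) : set L := sval x.

Definition gvg_le (x y : gvg_points L) : bool :=
  `[< gvg_filter x `<=` gvg_filter y >].

Lemma gvg_le_refl : reflexive gvg_le.
Proof. by move=> x; apply/asboolP. Qed.

Lemma gvg_le_anti : antisymmetric gvg_le.
Proof.
move=> [F FP] [G GP] /andP[/asboolP FG /asboolP GF].
by apply: eq_exist; exact/seteqP.
Qed.

Lemma gvg_le_trans : transitive gvg_le.
Proof.
by move=> y x z /asboolP xy /asboolP yz; apply/asboolP; exact: subset_trans yz.
Qed.

HB.instance Definition _ := Order.Le_isPOrder.Build dual_space_display
  (gvg_points L) gvg_le_refl gvg_le_anti gvg_le_trans.
End GvGPoints.

Section GvGPointsTopology.
Variables (d : Order.disp_t) (L : tbLatticeType d).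
Let X : topPOrderType := gvg_points L.
Let Fl : X -> set L := @gvg_filter _ L.

Lemma gvg_pointsP (x : X) : lattice_filter (Fl x).
Proof. by have [] := svalP x. Qed.

Lemma gvg_points_prime (x : X) s : join_admissible s -> Fl x (joins s) ->
  exists2 a, a \in s & Fl x a.
Proof. by have [_ xprime] := svalP x; exact: xprime. Qed.

Lemma gvg_points_leP (x y : X) : (x <= y)%O <-> Fl x `<=` Fl y.
Proof. by split=> [/asboolP|xy]; last exact/asboolP. Qed.

Lemma gvg_points_subbase :
  @subbase X (range (members Fl) `|` members_subbase Fl).
Proof. exact: subbase_spaceP. Qed.

Lemma gvg_members_clopen a : clopen (members Fl a : set X).
Proof.
split; first by apply: gvg_points_subbase.1; left; exists a.
rewrite -[members Fl a]setCK; apply: open_closedC.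
by apply: gvg_points_subbase.1; right; exists (members Fl a) => //; exists a.
Qed.

Lemma gvg_members_clopen_upset a : clopen_upset (members Fl a : set X).
Proof.
split; first exact: gvg_members_clopen.
by move=> x y /gvg_points_leP xy; exact: xy.
Qed.

Lemma gvg_points_compact : compact [set: X].
Proof.
rewrite compact_ultra => U UU _.
have UF : ProperFilter U := @ultra_proper _ _ UU.
pose F := [set a | U (members Fl a)].
have Uunion (s : seq L) : U [set x | exists2 a, a \in s & Fl x a] ->
    exists2 a, a \in s & F a.
  elim: s => [|a s IHs] Us; first by have [x []] := filter_ex Us.
  have [Ua|nUa] := in_ultra_setVsetC (members Fl a) UU.
    by exists a; rewrite ?inE ?eqxx.
  have [|b bs Fb] := IHs; last by exists b => //; rewrite inE bs orbT.
  apply: filterS (filterI Us nUa) => x [[b]].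
  by rewrite inE => /orP[/eqP -> //|bs xb] _; exists b.
have Fpt : lattice_filter F /\
    forall s, join_admissible s -> F (joins s) -> exists2 a, a \in s & F a.
  split; last first.
    move=> s sadm Fs; apply: Uunion; apply: filterS Fs => x.
    exact: gvg_points_prime.
  split=> [|a b Fa Fb|a b ab Fa].
  - by apply: filterS filterT => x _; have [] := gvg_pointsP x.
  - apply: filterS (filterI Fa Fb) => x [xa xb].
    by have [_ xI _] := gvg_pointsP x; exact: xI.
  - by apply: filterS Fa => x; have [_ _] := gvg_pointsP x; apply.
exists (exist _ F Fpt : X); split=> //.
apply: (@subbase_cvg X _ U _ gvg_points_subbase) => V [[a _ <-] //|].
move=> [_ [a _ <-] <-] nFa.
by have [Ua|//] := in_ultra_setVsetC (members Fl a) UU.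
Qed.

Lemma gvg_points_priestley : priestley_space X.
Proof.
split; first exact: gvg_points_compact.
move=> x y /gvg_points_leP/existsNP[a /not_implyP[xa ya]].
by exists (members Fl a); split=> //; exact: gvg_members_clopen_upset.
Qed.

Definition some_member (s : seq L) : set X :=
  [set x | exists2 a, a \in s & Fl x a].

(** The member sets inside an upset U that surround a point x of U suffice to
    cover U: otherwise compactness yields a point above x outside U. *)
Lemma gvg_clopen_upset (U : set X) :
  clopen_upset U -> exists s, U = some_member s.
Proof.
move=> [[oU cU] upU].
have Umem x : U x -> exists2 a, Fl x a & members Fl a `<=` U.
  move=> Ux; apply: contrapT => noa.
  have [x1 xI _] := gvg_pointsP x.
  have [i|i j|i|z _ xz] := @compact_directed X setT {a | Fl x a}
    (exist _ _ x1) (fun i => members Fl (sval i) `&` ~` U) gvg_points_compact.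
  - apply: closedI; last exact: open_closedC.
    by have [] := gvg_members_clopen (sval i).
  - case: i j => a xa [b xb]; exists (exist _ _ (xI _ _ xa xb)).
    move=> z [zab nUz]; have [_ _ zup] := gvg_pointsP z.
    by split; (split; last exact: nUz);
      apply: (zup (a `&` b)%O) zab; rewrite /po /= ?leIl ?leIr.
  - case: i => a xa; have /existsNP[z /not_implyP[za nUz]] :
        ~ members Fl a `<=` U by move=> aU; apply: noa; exists a.
    by exists z.
  have [_ nUz] := xz (exist _ _ x1); apply: nUz; apply: upU Ux.
  by apply/gvg_points_leP => a xa; have [] := xz (exist _ a xa).
have [|a|x /Umem[a xa aU]|s sU Us] := @compact_finite_cover X U L (members Fl)
  (fun a => members Fl a `<=` U).
- exact: subclosed_compact cU gvg_points_compact (@subsetT _ U).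
- by have [] := gvg_members_clopen a.
- by exists a.
exists s; apply/seteqP; split=> x; first exact: Us.
by move=> [a as_]; exact: sU as_ x.
Qed.

(** The condition bears on maximal pairs alone, but it forces the join to be
    admissible, hence to be respected by every point. *)
Lemma some_member_joins s :
  (forall F I, max_pair F I -> F (joins s) -> exists2 a, a \in s & F a) ->
  some_member s = members Fl (joins s).
Proof.
move=> /max_pair_admissible sadm; apply/seteqP; split=> x; last first.
  exact: gvg_points_prime.
move=> [a sa xa]; have [_ _ up] := gvg_pointsP x.
exact: up (joins_sup sa) xa.
Qed.

Lemma max_pair_gvg_point F I : max_pair F I -> exists x : X, Fl x = F.
Proof.
move=> FI; have FP : lattice_filter F /\
    forall s, join_admissible s -> F (joins s) -> exists2 a, a \in s & F a.
  by split; [exact: mp_filter FI|move=> s; exact: max_pair_prime FI].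
by exists (exist _ F FP : X).
Qed.
End GvGPointsTopology.

Section GvGOfLattice.
Variables (d : Order.disp_t) (L : tbLatticeType d).
Let X : topPOrderType := gvg_points L.
Let Y : topPOrderType := gvg_points L^d.
Let Fl : X -> set L := @gvg_filter _ L.
Let Id : Y -> set L := @gvg_filter _ L^d.
Let R : set (X * Y) := disjoint_rel Fl Id.

Lemma gvg_canonical : canonical_polarity R Fl Id.
Proof.
split=> [x|y|//|F I FF II FI].
- exact: gvg_pointsP.
- exact: (@gvg_pointsP _ L^d).
have [G [J [GJ FG IJ]]] := max_pair_ext FF II FI.
have [x xG] := max_pair_gvg_point GJ.
have [y yJ] := max_pair_gvg_point ((max_pair_dual G J).2 GJ).
exists x, y; rewrite [Fl x]xG [Id y]yJ; split=> //.
by rewrite /R /disjoint_rel /= [Fl x]xG [Id y]yJ; exact: mp_disjoint GJ.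
Qed.

Let can := gvg_canonical.
Let can' := canonical_polarity_dual can.

Lemma image_clopen_upset (U : set X) s : U = some_member s ->
  image_rel R U = ~` members Id (joins s).
Proof. by move=> ->; exact: image_some_member. Qed.

Lemma clopen_downset_some (V : set Y) : clopen_downset V ->
  exists s, V = ~` @some_member _ L^d s.
Proof.
move=> [[oV cV] downV].
have [|s sE] := @gvg_clopen_upset _ L^d (~` V).
  split; first by split; [exact: closed_openC|exact: open_closedC].
  by move=> x y xy nVx /(downV _ _ xy).
by exists s; rewrite -sE setCK.
Qed.

Lemma box_some_member s : box R (~` @some_member _ L^d s) =
  members Fl (@joins _ L^d s).
Proof.
rewrite box_setC -[preimage_rel _ _]/(image_rel (swap_rel R) _).
by rewrite (image_some_member _ can') setCK.
Qed.

Lemma gvg_X0_max_pair F I (x : X) : max_pair F I -> Fl x = F -> gvg_X0 R x.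
Proof.
move=> FI xF; have [y yI] := max_pair_gvg_point ((max_pair_dual F I).2 FI).
have Rxy : R (x, y).
  by rewrite /R /disjoint_rel /= xF [Id y]yI; exact: mp_disjoint FI.
exists y => //; split=> // x' Rx'y /gvg_points_leP xx'.
apply: le_anti; apply/andP; split; apply/gvg_points_leP => //.
rewrite -/Fl xF; apply: (mp_maxF FI).
- exact: gvg_pointsP.
- by rewrite -xF.
- by move=> a x'a; rewrite -[I]yI; exact: Rx'y.
Qed.

Lemma gvg_Y0_max_pair F I (y : Y) : max_pair F I -> Id y = I -> gvg_Y0 R y.
Proof.
move=> FI yI; have [x xF] := max_pair_gvg_point FI.
have Rxy : R (x, y).
  by rewrite /R /disjoint_rel /= yI [Fl x]xF; exact: mp_disjoint FI.
exists x => //; split=> // y' Rxy' /gvg_points_leP yy'.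
apply: le_anti; apply/andP; split; apply/gvg_points_leP => //.
rewrite -/Id yI; apply: (mp_maxI FI).
- exact: (@gvg_pointsP _ L^d).
- by rewrite -yI.
- by move=> a Fa; apply: Rxy'; rewrite /= [Fl x]xF.
Qed.

Lemma gvg_space : is_GvG_space R.
Proof.
split.
- exact: gvg_points_priestley.
- exact: (@gvg_points_priestley _ L^d).
- move=> x x'; rewrite gvg_points_leP; apply: iff_sym.
  exact: (fiber_sub can).
- move=> y y'; rewrite (@gvg_points_leP _ L^d); apply: iff_sym.
  exact: (cofiber_sub can).
- move=> U /gvg_clopen_upset[s /image_clopen_upset ->].
  have [[oD cD] upD] := @gvg_members_clopen_upset _ L^d (joins s).
  split; first by split; [exact: closed_openC|exact: open_closedC].
  by move=> x y xy nDy /(upD _ _ xy).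
- move=> V /clopen_downset_some[s ->]; rewrite box_some_member.
  exact: gvg_members_clopen_upset.
- move=> x y /existsNP[a /not_implyP[xa /contrapT ya]].
  exists (members Fl a); split=> //.
  + exact: gvg_members_clopen_upset.
  + by rewrite (members_stable can).
  + by rewrite (image_members can); exact.
- move=> U /gvg_clopen_upset[s sE]; have := image_clopen_upset sE.
  move=> ->; rewrite (box_members can) sE => X0s.
  apply: some_member_joins => F I FI Fs.
  have [x xF] := max_pair_gvg_point FI.
  have [|a sa xa] := X0s x; last by exists a; rewrite // -xF.
  split; first exact: gvg_X0_max_pair FI xF.
  by rewrite /members /= /Fl xF.
- move=> V /clopen_downset_some[s ->]; rewrite box_some_member.
  rewrite (image_members can) => Y0s; congr (~` _).
  apply: (@some_member_joins _ L^d) => I F IF Is.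
  have FI := (@max_pair_dual _ L F I).1 IF.
  have [y yI] := max_pair_gvg_point IF.
  rewrite -yI; apply: contrapT => ny; apply: (Y0s y).
    by split; first exact: gvg_Y0_max_pair FI yI.
  by rewrite /members /= /Id yI.
Qed.

Lemma gvg_L_members U : gvg_L R U <-> exists a, U = members Fl a.
Proof.
split=> [[/gvg_clopen_upset[s sE] UE]|[a ->]].
  by exists (joins s); rewrite UE (image_clopen_upset sE) (box_members can).
by split; [exact: gvg_members_clopen_upset|rewrite (members_stable can)].
Qed.
End GvGOfLattice.

Lemma gvg_essentially_surjective :
  essentially_surjective (stable_functor gvg_lattice).
Proof.
move=> L; pose G := GvGSpace (gvg_space (L : tbLatticeType _)); exists G.
apply: (@stable_lattice_iso _ gvg_lattice L G
  (members (@gvg_filter _ L))) => [A|a b]; first exact: gvg_L_members.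
exact: members_le (gvg_canonical L) a b.
Qed.


(** * Compact elements and the Lawson topology *)

Section SupremaAndCompactElements.
Variables (d : Order.disp_t) (L : tbLatticeType d).
Implicit Types (x y k l s : L) (S T : set L).

Definition principal x : set L := [set y | (x <= y)%O].

Lemma supremums_ub S s x : supremums S s -> S x -> (x <= s)%O.
Proof. by move=> [ub _]; exact: ub. Qed.

Lemma supremums_le S s y : supremums S s ->
  (forall x, S x -> (x <= y)%O) -> (s <= y)%O.
Proof. by move=> [_ lb] Sy; exact: lb. Qed.

Lemma supremums0 : supremums (set0 : set L) \bot%O.
Proof. by split=> [x []|y _]; exact: le0x. Qed.

Lemma supremumsU S T s t :
  supremums S s -> supremums T t -> supremums (S `|` T) (s `|` t)%O.
Proof.
move=> Ss Tt; split=> [x [Sx|Tx]|y STy].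
- exact: le_trans (supremums_ub Ss Sx) (leUl _ _).
- exact: le_trans (supremums_ub Tt Tx) (leUr _ _).
- rewrite leUx; apply/andP; split.
    by apply: (supremums_le Ss) => x Sx; apply: STy; left.
  by apply: (supremums_le Tt) => x Tx; apply: STy; right.
Qed.

Lemma directed_finite_ub S T : directed S -> finite_set T -> T `<=` S ->
  exists2 z, S z & forall x, T x -> (x <= z)%O.
Proof.
move=> [[z0 Sz0] Sdir] /finite_seqP[r ->]; elim: r => [|x r IHr] rS.
  by exists z0.
have [|z Sz rz] := IHr.
  by move=> y yr; apply: rS; rewrite /= inE (_ : y \in r) ?orbT.
have [|w [Sw xw zw]] := Sdir x z _ Sz; first by apply: rS; rewrite /= inE eqxx.
exists w => // y; rewrite /= inE => /orP[/eqP -> //|yr].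
exact: le_trans (rz _ yr) zw.
Qed.

Lemma compact_le_directed k S s : compact_element k -> directed S ->
  supremums S s -> (k <= s)%O -> exists2 x, S x & (k <= x)%O.
Proof.
move=> kc Sdir Ss ks; have [T [t [Tfin TS Tt kt]]] := kc _ _ Ss ks.
have [z Sz Tz] := directed_finite_ub Sdir Tfin TS.
by exists z => //; apply: le_trans kt _; exact: supremums_le Tt Tz.
Qed.

Lemma compact_bot : compact_element (\bot%O : L).
Proof.
move=> S s _ _; exists set0, \bot%O; split=> //; exact: supremums0.
Qed.

Lemma compact_join k l : compact_element k -> compact_element l ->
  compact_element (k `|` l)%O.
Proof.
move=> kc lc S s Ss; rewrite leUx => /andP[ks ls].
have [T [t [Tfin TS Tt kt]]] := kc _ _ Ss ks.
have [T' [t' [Tfin' TS' Tt' lt']]] := lc _ _ Ss ls.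
exists (T `|` T'), (t `|` t')%O; split.
- by rewrite finite_setU.
- by move=> x [/TS|/TS'].
- exact: supremumsU.
- exact: leU2.
Qed.

Lemma principal_sub x y : principal x `<=` principal y <-> (y <= x)%O.
Proof. by split=> [/(_ x (lexx x))//|yx z]; exact: le_trans. Qed.

Lemma principal_inj x y : principal x = principal y -> x = y.
Proof.
by move=> xy; apply/le_anti/andP; split; apply/principal_sub; rewrite xy.
Qed.

Lemma principal_join x y :
  principal (x `|` y)%O = principal x `&` principal y.
Proof.
by apply/seteqP; split=> z; rewrite /principal /= leUx => /andP.
Qed.

Lemma principal_bot : principal \bot%O = setT.
Proof. by apply/seteqP; split=> // z _; exact: le0x. Qed.

Lemma principal_closed x : closed (principal x : set (lawson L)).
Proof.
rewrite -[principal x]setCK; apply: open_closedC.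
by apply: (lawson_subbaseP L).1; right; exists x.
Qed.

Lemma principal_clopen k : compact_element k ->
  clopen (principal k : set (lawson L)).
Proof.
move=> kc; split; last exact: principal_closed.
apply: (lawson_subbaseP L).1; left; split=> [x y|S s Sdir Ss ks].
  by move=> xy kx; exact: le_trans kx xy.
by have [x Sx kx] := compact_le_directed kc Sdir Ss ks; exists x.
Qed.

(** Directed joins are limits for the Lawson topology. *)
Lemma lawson_open_directed (V : set (lawson L)) S s :
  open V -> directed S -> supremums S s -> V s -> exists2 x, S x & V x.
Proof.
move=> oV Sdir Ss Vs; have [r [rD rs rV]] := (lawson_subbaseP L).2 _ _ oV Vs.
suff [x Sx xr] : exists2 x, S x &
    forall y, S y -> (x <= y)%O -> forall W, W \in r -> W y.
  by exists x => //; apply: rV; exact: xr.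
have [[x0 Sx0] Sdir2] := Sdir.
elim: r rD rs {rV} => [|W r IHr] rD rs; first by exists x0.
have [W' Wr|W' Wr|x Sx xr] := IHr.
- by apply: rD; rewrite inE Wr orbT.
- by apply: rs; rewrite inE Wr orbT.
have Ws : W s by apply: rs; rewrite inE eqxx.
have [[Wup Wsc]|[z _ Wz]] := rD W (mem_head W r).
  have [y [Sy Wy]] := Wsc _ _ Sdir Ss Ws.
  have [w [Sw xw yw]] := Sdir2 _ _ Sx Sy.
  exists w => // u Su wu W'; rewrite inE => /orP[/eqP ->|W'r].
    by apply: Wup Wy; exact: le_trans yw wu.
  by apply: xr => //; exact: le_trans xw wu.
exists x => // u Su xu W'; rewrite inE => /orP[/eqP ->|W'r]; last exact: xr W'r.
rewrite -Wz /= => zu; move: Ws; rewrite -Wz; apply.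
exact: le_trans zu (supremums_ub Ss Su).
Qed.

Lemma finite_sups_directed S : directed [set t | exists T : set L,
  [/\ finite_set T, T `<=` S & supremums T t]].
Proof.
split; first by exists \bot%O, set0; split=> //; exact: supremums0.
move=> t t' [T [Tfin TS Tt]] [T' [Tfin' TS' Tt']]; exists (t `|` t')%O.
split; [|exact: leUl|exact: leUr]; exists (T `|` T'); split.
- by rewrite finite_setU.
- by move=> x [/TS|/TS'].
- exact: supremumsU.
Qed.

Lemma principal_open_compact k :
  open (principal k : set (lawson L)) -> compact_element k.
Proof.
move=> ok S s Ss ks.
have sup_s : supremums [set t | exists T : set L,
    [/\ finite_set T, T `<=` S & supremums T t]] s.
  split=> [t [T [_ TS Tt]]|y Sy].
    by apply: (supremums_le Tt) => x /TS; exact: supremums_ub.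
  apply: (supremums_le Ss) => x Sx; apply: Sy; exists [set x].
  split=> [|_ -> //|]; first exact: finite_set1.
  by split=> [_ ->|z] //; apply.
have [t [T [Tfin TS Tt]] kt] :=
  lawson_open_directed ok (finite_sups_directed S) sup_s ks.
by exists T, t.
Qed.
End SupremaAndCompactElements.

Section CoherentLatticeTheory.
Variables (d : Order.disp_t) (L : tbLatticeType d).
Hypothesis cL : coherent_lattice L.
Implicit Types (x y k l s : L) (S T : set L).

Definition compacts_below x : set L :=
  [set k | compact_element k /\ (k <= x)%O].

Lemma compacts_below_directed x : directed (compacts_below x).
Proof.
split; first by exists \bot%O; split; [exact: compact_bot|exact: le0x].
move=> k l [kc kx] [lc lx]; exists (k `|` l)%O.
split; [split; [exact: compact_join|by rewrite leUx kx]|exact: leUl|].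
exact: leUr.
Qed.

Lemma compacts_below_sup x : supremums (compacts_below x) x.
Proof.
have [S Sc Sx] := coherent_algebraic cL x; split=> [k [] //|y xy].
apply: (supremums_le Sx) => k Sk; apply: xy; split; first exact: Sc.
exact: supremums_ub Sx Sk.
Qed.

Lemma compact_leP x y :
  (forall k, compact_element k -> (k <= x)%O -> (k <= y)%O) -> (x <= y)%O.
Proof.
move=> xy; apply: (supremums_le (compacts_below_sup x)) => k [kc kx].
exact: xy.
Qed.

Lemma compact_nle x y : ~ (x <= y)%O ->
  exists k, [/\ compact_element k, (k <= x)%O & ~ (k <= y)%O].
Proof.
move=> nxy; apply: contrapT => nk; apply: nxy; apply: compact_leP => k kc kx.
by apply: contrapT => nky; apply: nk; exists k.
Qed.

(** A Lawson closed filter contains its infimum, as filtered infima are limits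
    for the Lawson topology; when the filter is also open, that infimum is a
    compact element. *)
Lemma clopen_filter_principal (F : set L) :
  lattice_filter F -> clopen (F : set (lawson L)) ->
  exists2 k, compact_element k & F = principal k.
Proof.
move=> [F1 FI Fup] [oF cF].
have [m [mub mlb]] :=
  coherent_complete cL [set x | forall y, F y -> (x <= y)%O].
have mF y : F y -> (m <= y)%O by move=> Fy; apply: mlb => x; exact.
have Fm : F m.
  apply: contrapT => nFm.
  have [r [rD rm rF]] := (lawson_subbaseP L).2 _ _ (closed_openC cF) nFm.
  suff [f Ff fr] : exists2 f, F f &
      forall y, F y -> (y <= f)%O -> forall W, W \in r -> W y.
    exact: (rF f (fr f Ff (lexx f))) Ff.
  elim: r rD rm {rF} => [|W r IHr] rD rm; first by exists \top%O.
  have [W' Wr|W' Wr|f Ff fr] := IHr.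
  - by apply: rD; rewrite inE Wr orbT.
  - by apply: rm; rewrite inE Wr orbT.
  have Wm : W m by apply: rm; rewrite inE eqxx.
  have [[Wup _]|[z _ Wz]] := rD W (mem_head W r).
    exists f => // y Fy yf W'; rewrite inE => /orP[/eqP ->|]; last exact: fr.
    by apply: Wup Wm; exact: mF.
  have [g /not_implyP[Fg nzg]] : exists g, ~ (F g -> (z <= g)%O).
    apply/existsNP => zF; move: Wm; rewrite -Wz /=; apply; exact: mub.
  exists (f `&` g)%O; first exact: FI.
  move=> y Fy; rewrite lexI => /andP[yf yg] W'.
  rewrite inE => /orP[/eqP ->|]; last exact: fr.
  by rewrite -Wz /= => zy; apply: nzg; exact: le_trans zy yg.
have FE : F = principal m.
  apply/seteqP; split=> y; first exact: mF.
  by move=> my; exact: Fup my Fm.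
exists m => //; apply: principal_open_compact; rewrite -FE; exact: oF.
Qed.
End CoherentLatticeTheory.

Section ExtensionFromCompacts.
Variables (d1 d2 : Order.disp_t) (X : tbLatticeType d1) (X' : tbLatticeType d2).
Hypotheses (cX : coherent_lattice X) (cX' : coherent_lattice X').
Variable kappa : X' -> X.
Hypothesis kc : forall k, compact_element k -> compact_element (kappa k).
Hypothesis kbot : kappa \bot%O = \bot%O.
Hypothesis ktop : kappa \top%O = \top%O.
Hypothesis kjoin : forall k l, compact_element k -> compact_element l ->
  kappa (k `|` l)%O = (kappa k `|` kappa l)%O.
Hypothesis kmeet : forall k l, compact_element k -> compact_element l ->
  kappa (k `&` l)%O = (kappa k `&` kappa l)%O.

Let kmono k l : compact_element k -> compact_element l -> (k <= l)%O ->
  (kappa k <= kappa l)%O.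
Proof. by move=> ck cl; rewrite !leEjoin -kjoin // => /eqP ->. Qed.

(** The value of f at x is the join of the compact k with kappa k below x, and
    its left adjoint extends kappa by joins. Continuity of f and the behaviour
    of both maps on meets can be tested on compact elements. *)
Lemma cohlat_extension : exists2 f : X -> X', is_CohLat_morphism f &
  forall k x, compact_element k -> ((k <= f x)%O <-> (kappa k <= x)%O).
Proof.
pose D x := [set k | compact_element k /\ (kappa k <= x)%O].
pose f x := projT1 (cid (coherent_complete cX' (D x))).
have fsup x : supremums (D x) (f x) by rewrite /f; case: cid.
have Ddir x : directed (D x).
  split; first by exists \bot%O; split; [exact: compact_bot|rewrite kbot le0x].
  move=> k l [ck kx] [cl lx]; exists (k `|` l)%O.
  split; [split; first exact: compact_join|exact: leUl|exact: leUr].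
  by rewrite kjoin // leUx kx.
have fP k x : compact_element k -> ((k <= f x)%O <-> (kappa k <= x)%O).
  move=> ck; split=> [kfx|kx]; last by apply: (supremums_ub (fsup x)).
  have [l [cl lx] kl] := compact_le_directed ck (Ddir x) (fsup x) kfx.
  exact: le_trans (kmono ck cl kl) lx.
pose E a := [set kappa k | k in compacts_below a].
pose g a := projT1 (cid (coherent_complete cX (E a))).
have gsup a : supremums (E a) (g a) by rewrite /g; case: cid.
have Edir a : directed (E a).
  split; first by exists (kappa \bot%O), \bot%O => //; split;
    [exact: compact_bot|exact: le0x].
  move=> _ _ [k [ck ka] <-] [l [cl la] <-]; exists (kappa (k `|` l)%O).
  split; [|by rewrite kjoin // leUl|by rewrite kjoin // leUr].
  by exists (k `|` l)%O => //; split; [exact: compact_join|rewrite leUx ka].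
have gf a b : (g a <= b)%O <-> (a <= f b)%O.
  split=> [gab|afb].
    apply: (compact_leP cX') => k ck ka; apply/fP => //.
    by apply: le_trans gab; apply: (supremums_ub (gsup a)); exists k.
  apply: (supremums_le (gsup a)) => _ [k [ck ka] <-]; apply/fP => //.
  exact: le_trans ka afb.
have gmono a b : (a <= b)%O -> (g a <= g b)%O.
  by move=> ab; apply/gf; apply: le_trans ab _; exact/gf.
exists f => //; split.
- move=> x; apply: (@subbase_cvg (lawson X') _ _ _ (lawson_subbaseP X')).
    exact: (@fmap_filter (lawson X) (lawson X') f (nbhs (x : lawson X))).
  move=> V VD Vfx; suff oV : open (f @^-1` V : set (lawson X)).
    exact: (open_nbhs_nbhs (conj oV Vfx)).
  apply: open_sub_union => z Vfz; case: VD => [[Vup Vsc]|[a _ VE]].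
    have [k [[ck kfz] Vk]] := Vsc _ _ (compacts_below_directed (f z))
      (compacts_below_sup cX' (f z)) Vfz.
    exists (principal (kappa k)); split.
    + by have [] := principal_clopen (kc ck).
    + exact/fP.
    + by move=> u /fP ku; apply: Vup Vk; exact: ku.
  have [k [ck ka nk]] : exists k,
      [/\ compact_element k, (k <= a)%O & ~ (k <= f z)%O].
    by apply: compact_nle => //; move: Vfz; rewrite -VE.
  have oP : open (~` principal (kappa k) : set (lawson X)).
    exact/closed_openC/principal_closed.
  exists (~` principal (kappa k)); split; first exact: oP.
  + by move=> /fP kz; apply: nk; exact: kz.
  + move=> u nu; rewrite /preimage /= -VE => au; apply: nu; apply/fP => //.
    exact: le_trans ka au.
- split=> [|x y]; apply/le_anti/andP; split.
  + exact: lex1.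
  + by apply/gf; exact: lex1.
  + have gfx : (g (f (x `&` y)%O) <= x `&` y)%O by apply/gf.
    move: gfx; rewrite !lexI => /andP[gx gy]; apply/andP.
    by split; exact/gf.
  + apply/gf; rewrite lexI; apply/andP.
    by split; apply/gf; [exact: leIl|exact: leIr].
exists g => //; split=> [|a b].
  apply/le_anti; rewrite lex1 /= -ktop; apply: (supremums_ub (gsup \top%O)).
  by exists \top%O => //; split=> //; exact: compact_element_top cX'.
apply/le_anti/andP; split.
  by rewrite lexI !gmono // ?leIl ?leIr.
apply: (compact_leP cX) => c cc; rewrite lexI => /andP[ca cb].
have [_ [k [ck ka] <-] ck'] := compact_le_directed cc (Edir a) (gsup a) ca.
have [_ [l [cl lb] <-] cl'] := compact_le_directed cc (Edir b) (gsup b) cb.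
have ckl := compact_element_meet cX' ck cl.
apply: (@le_trans _ _ (kappa (k `&` l)%O)); first by rewrite kmeet // lexI ck'.
apply: (supremums_ub (gsup (a `&` b)%O)); exists (k `&` l)%O => //.
by split=> //; exact: leI2.
Qed.
End ExtensionFromCompacts.


(** * DH-spaces as polarities *)

Lemma dh_space_swap d1 d2 (X : tbLatticeType d1) (Y : tbLatticeType d2)
    (R : set (X * Y)) : is_DH_space R -> is_DH_space (swap_rel R).
Proof. by case=> *; split. Qed.

Section DHRelation.
Variables (d1 d2 : Order.disp_t).
Variables (X : tbLatticeType d1) (Y : tbLatticeType d2) (R : set (X * Y)).
Hypothesis RP : is_DH_space R.
Let cX := dh_coherentX RP.
Let cY := dh_coherentY RP.

Lemma dh_downX x x' y : (x <= x')%O -> R (x', y) -> R (x, y).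
Proof.
move=> xx' Rx'y; apply: contrapT => nRxy.
have [_ _ up] := dh_filter_cofiber RP y.
exact: (up x x' xx' nRxy) Rx'y.
Qed.

Lemma dh_downY x y y' : (y <= y')%O -> R (x, y') -> R (x, y).
Proof.
move=> yy' Rxy'; apply: contrapT => nRxy.
have [_ _ up] := dh_filter_fiber RP x.
exact: (up y y' yy' nRxy) Rxy'.
Qed.

Lemma dh_fiber_top : fiber R \top%O = set0.
Proof.
apply/seteqP; split=> // y Ry.
by have [nR _ _] := dh_filter_cofiber RP y; exact: nR Ry.
Qed.

Lemma dh_fiber_meet x x' : fiber R (x `&` x')%O = fiber R x `|` fiber R x'.
Proof.
apply/seteqP; split=> y; last first.
  by move=> [|]; apply: dh_downX; rewrite ?leIl ?leIr.
move=> Ry; apply: contrapT => /not_orP[nx nx'].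
by have [_ RI _] := dh_filter_cofiber RP y; exact: RI nx nx' Ry.
Qed.

Lemma dh_image_principal x : image_rel R (principal x) = fiber R x.
Proof.
apply/seteqP; split=> y; first by move=> [x' xx' Rx'y]; exact: dh_downX Rx'y.
by move=> Rxy; exists x => //; exact: (lexx x).
Qed.

Lemma dh_box_fiber x : box R (fiber R x) = principal x.
Proof.
apply/seteqP; split=> x'; first by move=> xx'; exact: (dh_orderX RP xx').
by move=> xx' y; exact: dh_downX.
Qed.

(** The complement of the fiber of a compact element is a clopen filter. *)
Lemma dh_dual_compact k : compact_element k ->
  exists2 l, compact_element l & fiber R k = ~` principal l.
Proof.
move=> kc; have := dh_clopen_image RP (principal_clopen kc).
rewrite dh_image_principal => -[oF cF].
have [|l lc lE] := clopen_filter_principal cY (dh_filter_fiber RP k).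
  by split; [exact: closed_openC|exact: open_closedC].
by exists l; rewrite // -lE setCK.
Qed.

Lemma dh_unrelated_directed (S : set X) x y :
  directed S -> supremums S x -> ~ R (x, y) -> exists2 k, S k & ~ R (k, y).
Proof.
move=> Sdir Sx nR.
have oR : open (~` cofiber R y : set (lawson X)).
  exact/closed_openC/(dh_closed_cofiber RP).
exact: (lawson_open_directed oR Sdir Sx nR).
Qed.
End DHRelation.

Section DHDuality.
Variables (d1 d2 : Order.disp_t).
Variables (X : tbLatticeType d1) (Y : tbLatticeType d2) (R : set (X * Y)).
Hypothesis RP : is_DH_space R.
Let RP' := dh_space_swap RP.

(** The element dual to l has the right fiber, as its own dual is l again. *)
Lemma dh_dual_compactY l : compact_element l ->
  exists2 k, compact_element k & fiber R k = ~` principal l.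
Proof.
move=> lc; have [k kc kE] := dh_dual_compact RP' lc; exists k => //.
have Rl x : R (x, l) <-> ~ (k <= x)%O.
  by have /seteqP[kl lk] := kE; split=> [/kl|/lk].
have nRkl : ~ R (k, l) by move/Rl; apply.
apply/seteqP; split=> y.
  move=> Rky ly; apply: nRkl; exact: (dh_downY RP ly).
move=> nly; apply: contrapT => nRky; apply: nly; apply: (dh_orderY RP) => x Rxy.
by apply/Rl => kx; apply: nRky; exact: (dh_downX RP kx).
Qed.
End DHDuality.

Definition principals d (X : tbLatticeType d) : set (set X) :=
  [set principal k | k in @compact_element d X].

Section DHLattice.
Variable A : DH_space.
Let X := dhX A.
Let Y := dhY A.
Let R : set (X * Y) := @dhR A.
Let RP : is_DH_space R := dhP A.
Let cX := dh_coherentX RP.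
Let cY := dh_coherentY RP.

Lemma dh_L_upX U : @principals _ X U -> upset (@po _ X) U.
Proof. by move=> [k kc <-] x y xy kx; exact: le_trans kx xy. Qed.

Lemma dh_L_downY U : @principals _ X U -> downset (@po _ Y) (image_rel R U).
Proof.
by move=> _ y y' yy' [x Ux Rxy']; exists x => //; exact: dh_downY Rxy'.
Qed.

Lemma dh_sepX (x x' : X) : ~ po x x' ->
  exists U, [/\ @principals _ X U, U x & ~ U x'].
Proof.
move=> /(compact_nle cX)[k [kc kx nk]]; exists (principal k).
by split=> //; exists k.
Qed.

Lemma dh_sepY (y y' : Y) : ~ po y y' ->
  exists U, [/\ @principals _ X U, ~ image_rel R U y & image_rel R U y'].
Proof.
move=> /(compact_nle cY)[l [lc ly nly']].
have [k kc kE] := dh_dual_compactY RP lc.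
exists (principal k); rewrite dh_image_principal // kE; split=> //.
by exists k.
Qed.

Definition dh_polarity : polarity :=
  @Polarity X Y R (@principals _ X) (@po _ X) (@po _ Y)
    (fun=> lexx _) (fun=> lexx _) dh_L_upX dh_L_downY dh_sepX dh_sepY.

Lemma dh_stable U : @principals _ X U -> box R (image_rel R U) = U.
Proof. by move=> [k _ <-]; rewrite dh_image_principal // dh_box_fiber. Qed.

Lemma dh_top : @principals _ X setT.
Proof. by exists \bot%O; [exact: compact_bot|exact: principal_bot]. Qed.

Lemma dh_bot_principal : box R (image_rel R set0) = principal \top%O.
Proof. by rewrite image_rel0 -(dh_fiber_top RP) dh_box_fiber. Qed.

Lemma dh_bot : @principals _ X (box R (image_rel R set0)).
Proof.
by exists \top%O; [exact: compact_element_top cX|rewrite dh_bot_principal].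
Qed.

Lemma dh_meet U V : @principals _ X U -> @principals _ X V ->
  @principals _ X (U `&` V).
Proof.
move=> [k kc <-] [l lc <-]; exists (k `|` l)%O; first exact: compact_join.
exact: principal_join.
Qed.

Lemma dh_join_principal k l :
  box R (image_rel R (principal k `|` principal l)) = principal (k `&` l)%O.
Proof.
by rewrite image_relU !dh_image_principal // -dh_fiber_meet // dh_box_fiber.
Qed.

Lemma dh_join U V : @principals _ X U -> @principals _ X V ->
  @principals _ X (box R (image_rel R (U `|` V))).
Proof.
move=> [k kc <-] [l lc <-]; exists (k `&` l)%O.
  by apply: (compact_element_meet cX).
by rewrite dh_join_principal.
Qed.

Definition dh_lattice : lattice_polarity :=
  @LatticePolarity dh_polarity dh_stable dh_top dh_bot dh_meet dh_join.

(** Two directed families indexed alike are related in the limit: if their joins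
    were not related, then some members with a common index would not be. *)
Lemma dh_realizes : realizes_pairs dh_lattice.
Proof.
apply: realizes_pairs_directed => I i0 f g dir fg.
have fk i : exists k : X, compact_element k /\ sval (f i) = principal k.
  by have [k kc kE] := svalP (f i); exists k.
have gl i : exists l : Y, compact_element l /\
    image_rel R (sval (g i)) = ~` principal l.
  have [k kc kE] := svalP (g i); have [l lc lE] := dh_dual_compact RP kc.
  by exists l; rewrite -kE dh_image_principal.
have [k kP] := boolp.choice fk; have [l lP] := boolp.choice gl.
have dir' i j : exists n,
    [/\ (k i <= k n)%O, (k j <= k n)%O, (l i <= l n)%O & (l j <= l n)%O].
  have [n [/stable_leP ni /stable_leP nj /stable_leP ing /stable_leP jng]] :=
    dir i j.
  exists n; split; apply/principal_sub; rewrite -?(kP _).2 //; apply: subsetC2.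
    by rewrite -!(lP _).2; exact: image_relS.
  by rewrite -!(lP _).2; exact: image_relS.
have kdir : directed (range k).
  split; first by exists (k i0), i0.
  move=> _ _ [i _ <-] [j _ <-]; have [n [ik jk _ _]] := dir' i j.
  by exists (k n); split=> //; exists n.
have ldir : directed (range l).
  split; first by exists (l i0), i0.
  move=> _ _ [i _ <-] [j _ <-]; have [n [_ _ il jl]] := dir' i j.
  by exists (l n); split=> //; exists n.
have [x xsup] := coherent_complete cX (range k).
have [y ysup] := coherent_complete cY (range l).
exists x, y; split=> [|i|i]; last 2 first.
- by rewrite (kP i).2; apply: (supremums_ub xsup); exists i.
- rewrite [image_rel _ _](lP i).2; apply.
  by apply: (supremums_ub ysup); exists i.
apply: contrapT => /(dh_unrelated_directed RP kdir xsup)[_ [i _ <-]].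
move=> /(dh_unrelated_directed (dh_space_swap RP) ldir ysup)[_ [j _ <-]] nR.
have [n [ik _ _ jl]] := dir' i j; apply: (fg n); apply/stable_leP.
rewrite -(dh_stable (svalP (g n))) (lP n).2 (kP n).2 => z /= kz w Rzw lw.
apply: nR; apply: (dh_downX RP ik); apply: (dh_downY RP jl).
by apply: (dh_downX RP kz); exact: (dh_downY RP lw).
Qed.
End DHLattice.

Section DHMap.
Variables (A B : DH_space) (fg : DH_hom A B).

(** A map is encoded by the pairs whose second entry lies above its value, so
    that boxes and inverse images of stable sets become preimages under the
    map. *)
Definition dh_relX : set (dhX A * dhX B) :=
  [set p | ((sval fg).1 p.1 <= p.2)%O].
Definition dh_relY : set (dhY A * dhY B) :=
  [set p | ((sval fg).2 p.1 <= p.2)%O].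

Lemma box_dh_relX U : upset (@po _ (dhX B)) U ->
  box dh_relX U = (sval fg).1 @^-1` U.
Proof.
move=> upU; apply/seteqP; split=> x; first by apply; exact: (lexx _).
by move=> Ux x' xx'; exact: upU Ux.
Qed.

Lemma preimage_dh_relY V : downset (@po _ (dhY B)) V ->
  preimage_rel dh_relY V = (sval fg).2 @^-1` V.
Proof.
move=> downV; apply/seteqP; split=> y.
  by move=> [y' Vy' yy']; exact: downV Vy'.
by move=> Vy; exists ((sval fg).2 y) => //; exact: (lexx _).
Qed.

Lemma dh_rel_morphism : is_rel_morphism (@dhR A) (@principals _ (dhX A))
  (@dhR B) (@principals _ (dhX B)) dh_relX dh_relY.
Proof.
case: (svalP fg) => fm gm R_ bf bg.
split.
- move=> U LU; have upU := dh_L_upX LU.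
  rewrite box_dh_relX // preimage_dh_relY; last exact: (dh_L_downY LU).
  split; last first.
    apply/seteqP; split=> y.
      by move=> [x Ux Rxy]; exists ((sval fg).1 x) => //; exact: R_.
    move=> [x' Ux' Rx'y]; have [x [Rxy x'x]] := bf _ _ Rx'y.
    by exists x => //; exact: upU x'x Ux'.
  case: LU upU => k kc <- upk.
  have [||l lc lE] := @clopen_filter_principal _ _ (dh_coherentX (dhP A))
      ((sval fg).1 @^-1` principal k); last by exists l; rewrite // -lE.
    have [fT fI] := cohlat_meets fm; split=> [|x y kx ky|x y xy kx].
    + by rewrite /principal /= fT lex1.
    + by move: kx ky; rewrite /principal /= fI lexI => -> ->.
    + apply: le_trans kx _.
      exact: (preserves_finite_meets_homo (cohlat_meets fm)).
  have [ok ck] := principal_clopen kc; have fc := cohlat_continuous fm.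
  have preim_op := @open_comp (lawson (dhX A)) (lawson (dhX B)) (sval fg).1.
  have preim_cl := @closed_comp (lawson (dhX A)) (lawson (dhX B)) (sval fg).1.
  by split; [apply: preim_op|apply: preim_cl] => // x _; exact: fc.
- move=> x x' /dh_sepX[U [LU Ux Ux']]; exists U; split=> //.
  by rewrite box_dh_relX //; exact: dh_L_upX.
- move=> y y' /dh_sepY[U [LU Uy Uy']]; exists U; split=> //.
  by rewrite preimage_dh_relY //; exact: (dh_L_downY LU).
- move=> x y /R_ Rfg; exists ((sval fg).1 x), ((sval fg).2 y).
  by split=> //; exact: (lexx _).
Qed.
End DHMap.

Definition dh_rel_category : category :=
  rel_category (fun A => lp_pl (dh_lattice A)).

Definition dh_map (A B : DH_space) (fg : DH_hom A B) :
    @hom dh_rel_category A B :=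
  exist _ (dh_relX fg, dh_relY fg) (dh_rel_morphism fg).

Lemma dh_map_id A : dh_map (DH_id A) = idm (A : dh_rel_category).
Proof. exact: eq_exist. Qed.

Lemma dh_map_comp A B C (g : DH_hom B C) (f : DH_hom A B) :
  dh_map (DH_comp g f) = @comp dh_rel_category A B C (dh_map g) (dh_map f).
Proof.
apply: pl_homP => U LU /=.
  have upU := dh_L_upX LU; rewrite box_star // !box_dh_relX //.
  move=> x y xy; apply: upU; apply: preserves_finite_meets_homo xy.
  exact: cohlat_meets (dhm_f (svalP g)).
have downU := dh_L_downY LU; rewrite preimage_starY // !preimage_dh_relY //.
move=> x y xy; apply: downU; apply: preserves_finite_meets_homo xy.
exact: cohlat_meets (dhm_g (svalP g)).
Qed.

Definition dh_functor : functor DH dh_rel_category :=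
  @Functor DH dh_rel_category id dh_map dh_map_id dh_map_comp.

(** Passing to complements of images exchanges the two sides of a polarity,
    which transfers results on the first component of a morphism to the
    second. *)
Lemma rel_morphism_swap (A B : lattice_polarity)
    (S : set (plX A * plX B)) (T : set (plY A * plY B)) :
  is_rel_morphism (@plR A) (@plL A) (@plR B) (@plL B) S T ->
  is_rel_morphism
    (swap_rel (@plR A)) [set ~` image_rel (@plR A) U | U in @plL A]
    (swap_rel (@plR B)) [set ~` image_rel (@plR B) U | U in @plL B] T S.
Proof.
have pre (C : lattice_polarity) (U : set (plX C)) : plL U ->
    image_rel (swap_rel (@plR C)) (~` image_rel (@plR C) U) = ~` U.
  move=> LU; rewrite -{2}(lp_stable LU) /pl_closure.
  by rewrite -[in RHS](setCK (image_rel _ U)) box_setC setCK.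
move=> [b sX sY t]; split.
- move=> _ [U LU <-]; have [LSU SE] := b _ LU.
  rewrite box_setC -SE; split; first by exists (box S U).
  by rewrite !pre // -[U in LHS]setCK box_setC setCK.
- move=> y y' /sY[U [LU yU y'U]]; exists (~` image_rel (@plR B) U).
  by split=> [||]; [exists U|rewrite box_setC|apply].
- move=> x x' /sX[U [LU xU x'U]]; exists (~` image_rel (@plR B) U).
  split; [by exists U| |by rewrite pre].
  by rewrite pre // => -[z nUz Sxz]; exact: nUz (xU _ Sxz).
- by move=> y x Rxy; have [x' [y' [xx' yy' Rxy']]] := t _ _ Rxy; exists y', x'.
Qed.


(** * Functions from relations between DH-spaces *)

Definition dh_swap (A : DH_space) : DH_space := DHSpace (dh_space_swap (dhP A)).

Lemma principals_swap (A : DH_space) :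
  [set ~` image_rel (@dhR A) U | U in @principals _ (dhX A)] =
  @principals _ (dhY A).
Proof.
apply/seteqP; split=> [_ [_ [k kc <-] <-]|_ [l lc <-]].
  have [l lc lE] := dh_dual_compact (dhP A) kc; exists l => //.
  by rewrite (dh_image_principal (dhP A)) lE setCK.
have [k kc kE] := dh_dual_compactY (dhP A) lc.
exists (principal k); first by exists k.
by rewrite (dh_image_principal (dhP A)) kE setCK.
Qed.

Section FunctionOfRelation.
Variables (A B : DH_space) (h : pl_hom (dh_lattice A) (dh_lattice B)).
Let S : set (dhX A * dhX B) := (sval h).1.

(** The box of S maps principal filters of compact elements to such filters, and
    preserves the lattice operations on compact elements that they encode. *)
Lemma dh_function_of_relation : exists2 f : dhX A -> dhX B,
  is_CohLat_morphism f & forall x x', S (x, x') <-> (f x <= x')%O.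
Proof.
have hS := svalP h; have cA := dh_coherentX (dhP A).
have cB := dh_coherentX (dhP B).
have kex k : exists k0 : dhX A, compact_element k ->
    compact_element k0 /\ box S (principal k) = principal k0.
  have [kc|nkc] := pselect (compact_element k); last by exists \bot%O.
  have [|[k0 k0c k0E] _] := relm_box hS (U' := principal k); first by exists k.
  by exists k0.
have [kappa kP] := boolp.choice kex.
have kE k : compact_element k -> principal (kappa k) = box S (principal k).
  by move=> /kP[].
have hom := box_map_hom h.
pose pt k (kc : compact_element k) : stable_set (dh_lattice B) :=
  exist _ (principal k) (ex_intro2 _ _ k kc erefl).
have [|||k l kc lc|k l kc lc|f fM fP] :=
  @cohlat_extension _ _ _ _ cA cB kappa.
- by move=> k /kP[].
- apply: principal_inj; rewrite kE; last exact: compact_bot.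
  by rewrite !principal_bot boxT.
- apply: principal_inj; rewrite kE; last exact: compact_element_top cB.
  have /(congr1 sval)/= := lhom_bot hom.
  by rewrite /pl_closure /= !dh_bot_principal.
- apply: principal_inj; rewrite kE; last exact: compact_join.
  by rewrite !principal_join boxI !kE.
- apply: principal_inj; rewrite kE; last exact: (compact_element_meet cB).
  have /(congr1 sval)/= := lhom_join hom (pt k kc) (pt l lc).
  rewrite /pl_closure /= dh_join_principal => ->; rewrite -!kE //.
  exact: dh_join_principal.
exists f => // x x'; split=> [Sxx'|fx'].
  apply: (compact_leP cB) => k kc /(fP _ _ kc) kx.
  have : principal (kappa k) x by [].
  by rewrite kE // => xk; exact: xk Sxx'.
apply: contrapT => /(relm_sepX hS)[_ [[k kc <-] xk nkx']]; apply: nkx'.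
by apply: le_trans fx'; apply/(fP _ _ kc); move: xk; rewrite -kE.
Qed.
End FunctionOfRelation.

(** The left adjoint of f gives the least candidate for x; it is a directed join
    of values at compact elements, so it is related to y if these values are. *)
Lemma dh_back_of_relation (A B : DH_space)
    (h : pl_hom (dh_lattice A) (dh_lattice B))
    (f : dhX A -> dhX B) (g : dhY A -> dhY B) :
  is_CohLat_morphism f ->
  (forall x x', (sval h).1 (x, x') <-> (f x <= x')%O) ->
  (forall y y', (sval h).2 (y, y') <-> (g y <= y')%O) ->
  forall x' y, dhR (x', g y) -> exists x, dhR (x, y) /\ (x' <= f x)%O.
Proof.
move=> fM fP gP x' y Rx'y; have cB := dh_coherentX (dhP B).
have [l lf _] := cohlat_adjoint fM; exists (l x'); split; last exact/lf.
apply: contrapT => nR.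
have lmono a b : (a <= b)%O -> (l a <= l b)%O.
  by move=> ab; apply/lf; apply: le_trans ab _; exact/lf.
pose E := [set l k | k in compacts_below x'].
have Edir : directed E.
  split; first by exists (l \bot%O), \bot%O => //; split;
    [exact: compact_bot|exact: le0x].
  move=> _ _ [k [kc kx] <-] [m [mc mx] <-]; exists (l (k `|` m)%O).
  split; [|exact/lmono/leUl|exact/lmono/leUr].
  by exists (k `|` m)%O => //; split; [exact: compact_join|rewrite leUx kx].
have Esup : supremums E (l x').
  split=> [_ [k [_ kx] <-]|u uE]; first exact: lmono.
  apply/lf; apply: (compact_leP cB) => k kc kx; apply/lf; apply: uE.
  by exists k.
have [_ [k [kc kx] <-] nRk] := dh_unrelated_directed (dhP A) Edir Esup nR.
have [|_] := relm_box (svalP h) (U' := principal k); first by exists k.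
move=> /seteqP[_ hk]; have [|z zk Rzy] := hk y.
  exists (g y); last by apply/gP.
  exists k; first exact: (lexx k).
  exact: (dh_downX (dhP B) kx).
apply: nRk; apply: (dh_downX (dhP A) _ Rzy); apply/lf.
by apply: zk; apply/fP.
Qed.

Lemma dh_functor_ff : fully_faithful dh_functor.
Proof.
move=> A B; split=> [[[f g] fP] [[f' g'] fP'] /(congr1 sval) /= [] fE gE|h].
  have le_ext d (X : Type) (Y : tbLatticeType d) (u v : X -> Y) :
      [set p | (u p.1 <= p.2)%O] = [set p | (v p.1 <= p.2)%O] -> u = v.
    move=> /seteqP[uv vu]; apply/funext => x; apply/le_anti/andP; split.
      by apply: (vu (x, v x)); exact: (lexx (v x)).
    by apply: (uv (x, u x)); exact: (lexx (u x)).
  by apply: eq_exist; congr (_, _); exact: le_ext.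
have hM' := rel_morphism_swap (svalP h).
rewrite /= !principals_swap in hM'.
pose h' : pl_hom (dh_lattice (dh_swap A)) (dh_lattice (dh_swap B)) :=
  exist _ ((sval h).2, (sval h).1) hM'.
have [f fM fP] := dh_function_of_relation h.
have [g gM gP] := dh_function_of_relation h'.
have fgM : is_DH_morphism f g.
  split=> // [x y Rxy|x' y|x y' Rxy'].
  - have [x' [y' [/fP xx' /gP yy' Rxy']]] := relm_total (svalP h) Rxy.
    apply: (dh_downX (dhP B) xx'); exact: (dh_downY (dhP B) yy').
  - exact: dh_back_of_relation fM fP gP x' y.
  - have [y Ry] := @dh_back_of_relation _ _ h' g f gM gP fP y' x Rxy'.
    by exists y.
have relE : (dh_relX (exist _ (f, g) fgM), dh_relY (exist _ (f, g) fgM)) =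
    sval h.
  rewrite [RHS]surjective_pairing; congr (_, _); apply/seteqP.
    by split=> -[x x'] /fP.
  by split=> -[y y'] /gP.
by exists (exist _ (f, g) fgM); case: h relE {fP gP h' hM'} => ST hM /=;
  exact: eq_exist.
Qed.


(** * The DH-space of a lattice *)

Definition filter_lattice d (L : tbLatticeType d) : Type :=
  {F : set L | lattice_filter F}.

Section FilterLattice.
Variables (d : Order.disp_t) (L : tbLatticeType d).
Implicit Types (F G H : filter_lattice L) (a b : L).

HB.instance Definition _ := gen_eqMixin (filter_lattice L).
HB.instance Definition _ := gen_choiceMixin (filter_lattice L).

Definition filter_le F G : bool := `[< sval F `<=` sval G >].

Lemma filter_le_refl : reflexive filter_le.
Proof. by move=> F; apply/asboolP. Qed.

Lemma filter_le_anti : antisymmetric filter_le.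
Proof.
move=> [F FP] [G GP] /andP[/asboolP FG /asboolP GF].
by apply: eq_exist; exact/seteqP.
Qed.

Lemma filter_le_trans : transitive filter_le.
Proof.
by move=> G F H /asboolP FG /asboolP GH; apply/asboolP; exact: subset_trans GH.
Qed.

HB.instance Definition _ := Order.Le_isPOrder.Build dual_space_display
  (filter_lattice L) filter_le_refl filter_le_anti filter_le_trans.

Lemma filter_leP F G : reflect (sval F `<=` sval G) (F <= G)%O.
Proof. exact: asboolP. Qed.

Lemma filter_meet_subproof F G : lattice_filter (sval F `&` sval G).
Proof.
case: F G => F [F1 FI Fup] [G [G1 GI Gup]] /=.
split=> [//|a b [Fa Ga] [Fb Gb]|a b ab [Fa Ga]].
  by split; [exact: FI|exact: GI].
by split; [exact: Fup ab Fa|exact: Gup ab Ga].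
Qed.

Definition filter_meet F G : filter_lattice L :=
  exist _ _ (filter_meet_subproof F G).

Definition filter_join_set F G : set L :=
  [set c | exists a b, [/\ sval F a, sval G b & (a `&` b <= c)%O]].

Lemma filter_join_subproof F G : lattice_filter (filter_join_set F G).
Proof.
case: F G => F [F1 FI Fup] [G [G1 GI Gup]]; split=> [|c c'|c c' cc'] /=.
- by exists \top%O, \top%O; split=> //; exact: lex1.
- move=> [a [b [/= Fa Gb abc]]] [a' [b' [/= Fa' Gb' abc']]].
  exists (a `&` a')%O, (b `&` b')%O; split; [exact: FI|exact: GI|].
  by rewrite meetACA leI2.
- move=> [a [b [/= Fa Gb abc]]]; exists a, b; split=> //.
  exact: le_trans abc cc'.
Qed.

Definition filter_join F G : filter_lattice L :=
  exist _ _ (filter_join_subproof F G).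

Lemma filter_meetP F G H :
  (F <= filter_meet G H)%O = (F <= G)%O && (F <= H)%O.
Proof.
apply/filter_leP/andP => /= [FGH|[/filter_leP FG /filter_leP FH]].
  by split; apply/filter_leP => x /FGH[].
by move=> x Fx; split; [exact: FG|exact: FH].
Qed.

Lemma filter_joinP F G H :
  (filter_join F G <= H)%O = (F <= H)%O && (G <= H)%O.
Proof.
apply/filter_leP/andP => [FGH|[/filter_leP FH /filter_leP GH]].
  have [F1 _ _] := svalP F; have [G1 _ _] := svalP G.
  split; apply/filter_leP => x xF; apply: FGH.
    by exists x, \top%O; split=> //; exact: leIl.
  by exists \top%O, x; split=> //; exact: leIr.
move=> c [a [b [Fa Gb abc]]]; have [_ HI Hup] := svalP H.
by apply: Hup abc _; apply: HI; [exact: FH|exact: GH].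
Qed.

HB.instance Definition _ := Order.POrder_MeetJoin_isLattice.Build
  dual_space_display (filter_lattice L) filter_meetP filter_joinP.

Definition upfilter a : filter_lattice L := exist _ _ (filter_up a).

Lemma upfilter_leP a F : (upfilter a <= F)%O <-> sval F a.
Proof.
split=> [/filter_leP|Fa]; first by apply; exact: (lexx a).
by apply/filter_leP => b ab; have [_ _ Fup] := svalP F; exact: Fup ab Fa.
Qed.

Definition filter_top : filter_lattice L := upfilter \bot%O.
Definition filter_bot : filter_lattice L := upfilter \top%O.

Lemma filter_le0x F : (filter_bot <= F)%O.
Proof. by apply/upfilter_leP; have [] := svalP F. Qed.

Lemma filter_lex1 F : (F <= filter_top)%O.
Proof. by apply/filter_leP => a _; exact: le0x. Qed.

HB.instance Definition _ := Order.hasBottom.Build dual_space_display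
  (filter_lattice L) filter_le0x.
HB.instance Definition _ := Order.hasTop.Build dual_space_display
  (filter_lattice L) filter_lex1.
End FilterLattice.

Definition filters d (L : tbLatticeType d) : tbLatticeType dual_space_display :=
  filter_lattice L.

Definition filter_set d (L : tbLatticeType d) (F : filters L) : set L := sval F.

Section FiltersCoherent.
Variables (d : Order.disp_t) (L : tbLatticeType d).
Implicit Types (F G : filters L) (a b : L).
Let up : L -> filters L := @upfilter _ L.

Lemma filters_leP F G : (F <= G)%O <-> filter_set F `<=` filter_set G.
Proof. by split=> [/filter_leP|FG]; last exact/filter_leP. Qed.

Lemma filter_setP F : lattice_filter (filter_set F).
Proof. exact: svalP F. Qed.

Lemma up_leP a F : (up a <= F)%O <-> filter_set F a.
Proof. exact: upfilter_leP. Qed.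

Lemma principal_up a : principal (up a) = members (@filter_set _ L) a.
Proof. by apply/seteqP; split=> F /up_leP. Qed.

Lemma ups_directed F : directed [set up a | a in filter_set F].
Proof.
have [F1 FI _] := filter_setP F; split; first by exists (up \top%O), \top%O.
move=> _ _ [a Fa <-] [b Fb <-]; exists (up (a `&` b)%O); split.
- by exists (a `&` b)%O => //; exact: FI.
- by apply/up_leP; exact: leIl.
- by apply/up_leP; exact: leIr.
Qed.

Lemma ups_sup F : supremums [set up a | a in filter_set F] F.
Proof.
split=> [_ [a Fa <-]|G GF]; first exact/up_leP.
by apply/filters_leP => a Fa; apply/up_leP; apply: GF; exists a.
Qed.

Lemma filters_complete : complete_lattice (filters L).
Proof.
move=> S; pose M := [set a | forall G, ubound S G -> filter_set G a].
have MF : lattice_filter M.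
  split=> [G _|a b Ma Mb G SG|a b ab Ma G SG];
    have [G1 GI Gup] := filter_setP G.
  - exact: G1.
  - by apply: GI; [exact: Ma|exact: Mb].
  - exact: Gup ab (Ma _ SG).
exists (exist _ M MF : filters L); split=> [F SF|G SG].
  by apply/filters_leP => a Fa G SG; have /filters_leP := SG _ SF; exact.
by apply/filters_leP => a; exact.
Qed.

(** The elements of finite joins of members of S form a filter above S, so an
    element of the join of S already lies in a finite join. *)
Lemma up_compact a : compact_element (up a).
Proof.
move=> S s Ss /up_leP sa.
pose M := [set b | exists (T : set (filters L)) t,
  [/\ finite_set T, T `<=` S, supremums T t & filter_set t b]].
have MF : lattice_filter M.
  split=> [|b c [T [t [Tf TS Tt tb]]] [T' [t' [Tf' TS' Tt' tc]]]|].
  - exists set0, \bot%O; split=> //; first exact: supremums0.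
    exact: (lexx (\top%O : L)).
  - exists (T `|` T'), (t `|` t')%O; split.
    + by rewrite finite_setU.
    + by move=> F [/TS|/TS'].
    + exact: supremumsU.
    + by exists b, c; split=> //; exact: lexx.
  - move=> b c bc [T [t [Tf TS Tt tb]]]; exists T, t; split=> //.
    by have [_ _ tup] := filter_setP t; exact: tup bc tb.
have sM : (s <= (exist _ M MF : filters L))%O.
  apply: (supremums_le Ss) => F SF; apply/filters_leP => b Fb.
  exists [set F], F; split=> //; first by move=> _ ->.
  by split=> [_ ->|G] //; apply.
have [T [t [Tf TS Tt ta]]] : M a by move/filters_leP: sM; apply.
by exists T, t; split=> //; exact/up_leP.
Qed.

Lemma compact_filterP F : compact_element F <-> exists a, F = up a.
Proof.
split=> [Fc|[a ->]]; last exact: up_compact.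
have [_ [a Fa <-] aF] :=
  compact_le_directed Fc (ups_directed F) (ups_sup F) (lexx F).
by exists a; apply/le_anti; rewrite aF /=; exact/up_leP.
Qed.

Lemma filters_coherent : coherent_lattice (filters L).
Proof.
split.
- exact: filters_complete.
- move=> F; exists [set up a | a in filter_set F]; last exact: ups_sup.
  by move=> _ [a _ <-]; exact: up_compact.
- exact: up_compact.
- move=> _ _ /compact_filterP[a ->] /compact_filterP[b ->].
  suff -> : (up a `&` up b)%O = up (a `|` b)%O by exact: up_compact.
  apply/le_anti/andP; split.
    by apply/filters_leP => c [ac bc]; rewrite /filter_set /= leUx ac.
  by apply/up_leP; split; [exact: leUl|exact: leUr].
Qed.

Lemma filters_members_clopen a :
  clopen (members (@filter_set _ L) a : set (lawson (filters L))).
Proof. by have := principal_clopen (@up_compact a); rewrite principal_up. Qed.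

Lemma filters_lawson_compact : compact [set: lawson (filters L)].
Proof.
rewrite compact_ultra => U UU _.
have UF : ProperFilter U := @ultra_proper _ _ UU.
pose M := [set a | U (members (@filter_set _ L) a)].
have MF : lattice_filter M.
  split=> [|a b Ma Mb|a b ab Ma].
  - by apply: filterS filterT => F _; have [] := filter_setP F.
  - apply: filterS (filterI Ma Mb) => F [Fa Fb].
    by have [_ FI _] := filter_setP F; exact: FI.
  - by apply: filterS Ma => F; have [_ _ Fup] := filter_setP F; exact: Fup ab.
exists (exist _ M MF : filters L); split=> //.
apply: (subbase_cvg (lawson_subbaseP (filters L))) => V.
move=> [[Vup Vsc]|[G _ <-]] VM.
  have [_ [[a Ma <-] Va]] := Vsc _ _ (ups_directed _) (ups_sup _) VM.
  by apply: filterS Ma => F Fa; apply: Vup Va; exact/up_leP.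
have /existsNP[a /not_implyP[Ga nMa]] : ~ filter_set G `<=` M.
  by move=> GM; apply: VM; exact/filters_leP.
have [//|Ua] := in_ultra_setVsetC (members (@filter_set _ L) a) UU.
by apply: filterS Ua => F nFa /filters_leP GF; apply: nFa; exact: GF.
Qed.

Lemma ideal_meets_filter (J : set L) : lattice_ideal J ->
  lattice_filter [set F : filters L | exists2 a, J a & filter_set F a].
Proof.
move=> /lattice_idealP[J0 JU _]; split=> [|F G [a Ja Fa] [b Jb Gb]|F G FG].
- by exists \bot%O => //; exact: (lexx (\bot%O : L)).
- exists (a `|` b)%O; first exact: JU.
  have [_ _ Fup] := filter_setP F; have [_ _ Gup] := filter_setP G.
  by split; [exact: Fup (leUl _ _) Fa|exact: Gup (leUr _ _) Gb].
- by move=> [a Ja Fa]; exists a => //; have /filters_leP := FG; exact.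
Qed.

Lemma filters_avoiding_closed (J : set L) :
  closed ([set F | forall a, J a -> ~ filter_set F a] :
    set (lawson (filters L))).
Proof.
rewrite (_ : mkset _ = \bigcap_(a in J) ~` members (@filter_set _ L) a) //.
apply: closed_bigI => a _; apply: open_closedC.
by have [] := filters_members_clopen a.
Qed.

(** Each filter in an open set U contains an element whose principal filter is
    in U; finitely many such principal filters have the same image as U. *)
Lemma image_clopen_members (Y : Type) (R : set (filters L * Y))
    (Id : Y -> set L) (U : set (lawson (filters L))) :
  canonical_polarity R (@filter_set _ L) Id -> clopen U ->
  exists a, image_rel R U = ~` members Id a.
Proof.
move=> can [oU cU].
have [|a|F UF|s sU Us] := @compact_finite_cover (lawson (filters L)) U L
  (members (@filter_set _ L)) (fun a => U (up a)).
- exact: subclosed_compact cU filters_lawson_compact (@subsetT _ U).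
- by have [] := filters_members_clopen a.
- have [_ [a Fa <-] Ua] :=
    lawson_open_directed oU (ups_directed F) (ups_sup F) UF.
  by exists a.
exists (joins s); rewrite -(image_some_member s can).
apply/seteqP; split=> y; first by apply: image_relS => F; exact: Us.
move=> [F [a sa Fa] RFy]; exists (up a); first exact: sU.
apply/(cp_rel can) => b ab yb.
by apply: (rel_disjoint can RFy Fa); exact: (id_down can ab yb).
Qed.
End FiltersCoherent.

Section DHOfLattice.
Variables (d : Order.disp_t) (L : tbLatticeType d).
Let X := filters L.
Let Y := filters L^d.
Let Fl : X -> set L := @filter_set _ L.
Let Id : Y -> set L := @filter_set _ L^d.
Let R : set (X * Y) := disjoint_rel Fl Id.

Lemma filters_canonical : canonical_polarity R Fl Id.
Proof.
split=> [F|I|//|F I FF II FI]; [exact: filter_setP|exact: filter_setP|].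
by exists (exist _ F FF : X), (exist _ I II : Y); split.
Qed.

Let can := filters_canonical.
Let can' := canonical_polarity_dual can.

Lemma dh_space : is_DH_space R.
Proof.
have nonemptyE (P Q : set L) : (~ forall a, P a -> ~ Q a) <->
    exists2 a, P a & Q a.
  split=> [/existsNP[a /not_implyP[Pa /contrapT Qa]]|[a Pa Qa]].
    by exists a.
  by move/(_ a Pa); exact.
split.
- exact: filters_coherent.
- exact: filters_coherent.
- by move=> x; exact: (@filters_avoiding_closed _ L^d (Fl x)).
- move=> y; rewrite (_ : cofiber R y = [set F | forall a, Id y a -> ~ Fl F a]).
    exact: filters_avoiding_closed.
  by apply/seteqP; split=> F Fy a ya Fa; exact: Fy Fa ya.
- move=> U cU; have [a ->] := image_clopen_members can cU.
  have [oa ca] := @filters_members_clopen _ L^d a.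
  by split; [exact: closed_openC|exact: open_closedC].
- move=> V cV; have [a aE] := image_clopen_members can' cV.
  have [oa ca] := @filters_members_clopen _ L a.
  rewrite -[preimage_rel R V]/(image_rel (swap_rel R) V) aE.
  by split; [exact: closed_openC|exact: open_closedC].
- move=> x; rewrite (_ : ~` _ = [set I | exists2 a, Fl x a & Id I a]).
    exact: (@ideal_meets_filter _ L^d (Fl x) (filter_setP x)).
  by apply/seteqP; split=> I /nonemptyE.
- move=> y; rewrite (_ : ~` _ = [set F | exists2 a, Id y a & Fl F a]).
    exact: (ideal_meets_filter (filter_setP y)).
  apply/seteqP; split=> F; first by move=> /nonemptyE[a Fa ya]; exists a.
  by move=> [a ya Fa]; apply/nonemptyE; exists a.
- by move=> x x' /(fiber_sub can) ?; exact/filters_leP.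
- by move=> y y' /(cofiber_sub can) ?; exact/filters_leP.
Qed.
End DHOfLattice.

Lemma dh_essentially_surjective :
  essentially_surjective (stable_functor dh_lattice).
Proof.
move=> L; pose A := DHSpace (dh_space (L : tbLatticeType _)); exists A.
apply: (@stable_lattice_iso _ dh_lattice L A
  (members (@filter_set _ L))) => [U|a b]; last first.
  exact: members_le (filters_canonical L) a b.
split=> [[_ /compact_filterP[a ->] <-]|[a ->]].
  by exists a; exact: principal_up.
by rewrite -principal_up; exists (upfilter a) => //; exact: up_compact.
Qed.

(** * The equivalences *)

Theorem theorem13p16 :
  (equivalent_categories DH GvG /\
   equivalent_categories DH Hg /\
   equivalent_categories DH Urq) /\
  (equivalent_categories GvG Hg /\
   equivalent_categories GvG Urq) /\
  equivalent_categories Hg Urq.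
Proof.
have dhff := fully_faithful_comp (stable_functor_ff dh_realizes) dh_functor_ff.
have urff :=
  fully_faithful_comp (stable_functor_ff urq_realizes) urq_functor_ff.
have gvff := stable_functor_ff gvg_realizes.
have hgff := stable_functor_ff hg_realizes.
have dhes : essentially_surjective
    (comp_functor (stable_functor dh_lattice) dh_functor).
  exact: dh_essentially_surjective.
have ures : essentially_surjective
    (comp_functor (stable_functor urq_lattice) urq_functor).
  exact: urquhart_essentially_surjective.
have gves := gvg_essentially_surjective.
have hges := hartung_essentially_surjective.
do !split.
- exact: equivalent_categories_common_target dhff dhes gvff gves.
- exact: equivalent_categories_common_target dhff dhes hgff hges.
- exact: equivalent_categories_common_target dhff dhes urff ures.
- exact: equivalent_categories_common_target gvff gves hgff hges.
- exact: equivalent_categories_common_target gvff gves urff ures.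
- exact: equivalent_categories_common_target hgff hges urff ures.
Qed.
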